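(* Let $(M,g)$ be a Lorentzian manifold and fix a finite real number $a>0$. Let $d$ be a metric (distance) on $M$ which is compatible with the manifold topology. Let $(\gamma_i:[0,a)\to M)_i$ be a sequence of causal curves which converges uniformly on compact subsets of $[0,a)$, with respect to $d$, to a causal curve $\gamma:[0,a)\to M$. Suppose that 1. the Lorentzian lengths $L(\gamma_i)$ are all finite and the sequence $(L(\gamma_i))_i$ is bounded above, and 2. there exists $b>0$ such that for all $i\in\mathbb{N}$ and all $t_1,t_2\in[0,a)$ with $t_1\le t_2$, $$L(\gamma_i|_{[t_1,t_2]})\le b|t_2-t_1|\quad\text{and}\quad L(\gamma_i|_{[t_1,a)})\le b|a-t_1|.$$ Then there exists a subsequence $(\gamma_{i_k})_k$ such that $L(\gamma)\ge\limsup_k L(\gamma_{i_k})$. Moreover, if for all $t\in[0,a)$ we have $L(\gamma|_{[0,t]})=\lim_k L(\gamma_{i_k}|_{[0,t]})$, then $L(\gamma)=\lim_k L(\gamma_{i_k})$.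
   Context: Manifolds are smooth, Hausdorff, paracompact; Lorentzian metrics are smooth with signature $(-,+,\dots,+)$ and $M$ is time-oriented. A continuous curve $\gamma:I\to M$ ($I$ an interval) is future directed causal if each $t\in I$ has a neighbourhood $J\subset I$ and a convex normal neighbourhood $U$ of $\gamma(t)$ with $\gamma(J)\subset U$ such that for all $t_1<t_2$ in $J$ one has $\gamma(t_1)\ne\gamma(t_2)$ and the geodesic in $U$ from $\gamma(t_1)$ to $\gamma(t_2)$ is future directed causal; past directed causal curves are defined dually. Every causal curve can be reparametrised to be locally Lipschitz in charts, and for a locally Lipschitz causal curve on a compact interval $[u,v]$ the Lorentzian length is $L(\gamma)=\int_u^v\sqrt{-g(\gamma',\gamma')}\,dt$ (independent of such parametrisation). For a causal curve on an arbitrary interval $I$, $L(\gamma)=\sup\{L(\gamma|_{[u,v]}):u,v\in I,\ u<v\}$. *)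

(* Defs.v *)
From mathcomp Require Import all_boot all_order all_algebra.
From mathcomp Require Import all_classical all_reals all_analysis.

Set Implicit Arguments.
Unset Strict Implicit.
Unset Printing Implicit Defensive.

Import Order.TTheory GRing.Theory Num.Theory.
Import numFieldNormedType.Exports.

Local Open Scope classical_set_scope.
Local Open Scope ring_scope.

Section SmoothFunctions.
Context {R : realType} {m : nat}.

Definition partial (k : 'I_m) (f : 'rV[R]_m -> R) : 'rV[R]_m -> R :=
  fun x => 'D_(delta_mx 0 k) f x.

Definition iter_partial (s : seq 'I_m) (f : 'rV[R]_m -> R) : 'rV[R]_m -> R :=
  foldr partial f s.

(* C^oo on U: all iterated partial derivatives exist and are continuous at
   every point of U. The functions are total but only used with U open, so
   that their values outside U are irrelevant. *)
Definition smooth_on (U : set 'rV[R]_m) (f : 'rV[R]_m -> R) : Prop :=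
  forall (s : seq 'I_m) (x : 'rV[R]_m), U x ->
    {for x, continuous (iter_partial s f)} /\
    forall k, derivable (iter_partial s f) x (delta_mx 0 k).

End SmoothFunctions.

Definition paracompact (M : topologicalType) : Prop :=
  forall C : set (set M),
    (forall A, C A -> open A) -> (forall p, exists2 A, C A & A p) ->
    exists D : set (set M),
      [/\ forall B, D B -> open B,
          forall p, exists2 B, D B & B p,
          forall B, D B -> exists2 A, C A & B `<=` A
        & forall p : M, exists2 N, nbhs p N &
            finite_set [set B | D B /\ B `&` N !=set0]].

(* An atlas of a smooth manifold modelled on R^m. The index type [chart] and
   the selection [chart_at] of a chart around each point are bookkeeping: all
   the notions below are independent of the chart used to express them.
   [coord i] and [point i] are total functions, meaningful on [dom i] and on
   its image under [coord i] respectively. *)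
Record manifold (R : realType) (m : nat) (M : topologicalType) := Manifold {
  chart : Type;
  chart_at : M -> chart;
  dom : chart -> set M;
  coord : chart -> M -> 'rV[R]_m;
  point : chart -> 'rV[R]_m -> M;
  manifold_hausdorff : hausdorff_space M;
  manifold_paracompact : paracompact M;
  dom_open : forall i, open (dom i);
  dom_chart_at : forall p, dom (chart_at p) p;
  coord_open : forall i, open (coord i @` dom i);
  coordK : forall i p, dom i p -> point i (coord i p) = p;
  coord_continuous : forall i p, dom i p -> {for p, continuous (coord i)};
  point_continuous : forall i x, (coord i @` dom i) x ->
    {for x, continuous (point i)};
  transition_smooth : forall i j k,
    smooth_on (coord i @` (dom i `&` dom j))
      (fun x => coord j (point i x) 0 k)
}.

Section BilinearForms.
Context {R : realType}.

Definition form {m : nat} (G : 'M[R]_m) (v w : 'rV[R]_m) : R :=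
  (v *m G *m w^T) 0 0.

Definition minkowski (n : nat) : 'M[R]_n.+1 :=
  diag_mx (\row_k (if k == 0 then -1 else 1)).

Definition lorentz_signature (n : nat) (G : 'M[R]_n.+1) : Prop :=
  exists2 P : 'M[R]_n.+1, P \in unitmx & P *m G *m P^T = minkowski n.

End BilinearForms.

(* A time-oriented Lorentzian manifold of dimension n.+1. [metric i x] is the
   Gram matrix of g, and [time i x] the components of a continuous timelike
   vector field representing the time orientation, both in the chart i at the
   point of coordinates x; the derivative 'D_v of a transition map is its
   differential applied to v. *)
Record spacetime (R : realType) (n : nat) (M : topologicalType) := Spacetime {
  manifold_of :> manifold R n.+1 M;
  metric : chart manifold_of -> 'rV[R]_n.+1 -> 'M[R]_n.+1;
  time : chart manifold_of -> 'rV[R]_n.+1 -> 'rV[R]_n.+1;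
  metric_smooth : forall i k l,
    smooth_on (coord i @` dom i) (fun x => metric i x k l);
  metric_lorentz : forall i x, (coord i @` dom i) x ->
    lorentz_signature (metric i x);
  metric_transition : forall i j p v w, dom i p -> dom j p ->
    form (metric i (coord i p)) v w =
    form (metric j (coord j p))
      ('D_v (coord j \o point i) (coord i p))
      ('D_w (coord j \o point i) (coord i p));
  time_continuous : forall i x, (coord i @` dom i) x ->
    {for x, continuous (time i)};
  time_timelike : forall i x, (coord i @` dom i) x ->
    form (metric i x) (time i x) (time i x) < 0;
  time_transition : forall i j p, dom i p -> dom j p ->
    time j (coord j p) =
    'D_(time i (coord i p)) (coord j \o point i) (coord i p)
}.

Section Causality.
Context {R : realType} {n : nat} {M : topologicalType}.
Variable X : spacetime R n M.

Definition future_causal_vector (i : chart X) (x v : 'rV[R]_n.+1) : Prop :=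
  [/\ v != 0, form (metric i x) v v <= 0
    & form (metric i x) (time i x) v < 0].

Definition past_causal_vector (i : chart X) (x v : 'rV[R]_n.+1) : Prop :=
  future_causal_vector i x (- v).

Definition velocity (i : chart X) (c : R -> M) : R -> 'rV[R]_n.+1 :=
  derive1 (fun t : R => coord i (c t)).

Definition christoffel (i : chart X) (x : 'rV[R]_n.+1)
    (k a b : 'I_n.+1) : R :=
  2^-1 * \sum_l invmx (metric i x) k l *
    (partial a (fun y => metric i y l b) x
     + partial b (fun y => metric i y l a) x
     - partial l (fun y => metric i y a b) x).

(* [J] is meant to be open. *)
Definition geodesic_on (J : set R) (c : R -> M) : Prop :=
  forall t, J t -> {for t, continuous c} /\
    forall i : chart X, dom i (c t) ->
      [/\ derivable (fun s : R => coord i (c s)) t 1,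
          derivable (velocity i c) t 1
        & derive1 (velocity i c) t =
          \row_k - \sum_a \sum_b christoffel i (coord i (c t)) k a b *
                     velocity i c t 0 a * velocity i c t 0 b].

(* Geodesics are parametrised by [0, 1]; asking for the geodesic equation on an
   open set containing [0, 1] avoids one-sided derivatives and loses nothing. *)
Definition geodesic_from_to (p q : M) (c : R -> M) : Prop :=
  [/\ exists J : set R, [/\ open J, `[0, 1] `<=` J & geodesic_on J c],
      c 0 = p & c 1 = q].

(* exp_p v = q; v is given by its components in the chart [chart_at X p]. *)
Definition exp_rel (p : M) (v : 'rV[R]_n.+1) (q : M) : Prop :=
  exists2 c, geodesic_from_to p q c & velocity (chart_at X p) c 0 = v.

(* U is the diffeomorphic image under exp_p of an open star-shaped
   neighbourhood V of 0 in the tangent space at p. *)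
Definition normal_nbhd (U : set M) (p : M) : Prop :=
  exists (V : set 'rV[R]_n.+1) (E : 'rV[R]_n.+1 -> M) (L : M -> 'rV[R]_n.+1),
    [/\ [/\ open V, V 0 & forall v (s : R), V v -> 0 <= s <= 1 -> V (s *: v)],
        forall v, V v -> exp_rel p v (E v),
        [/\ E @` V = U, forall v, V v -> L (E v) = v
          & (forall v, V v -> {for v, continuous E}) /\
            (forall q, U q -> {for q, continuous L})],
        forall (j : chart X) k, smooth_on (V `&` E @^-1` dom j)
          (fun v => coord j (E v) 0 k)
      & forall (j : chart X) k, smooth_on (coord j @` (dom j `&` U))
          (fun x => L (point j x) 0 k)].

Definition convex_normal (U : set M) : Prop :=
  open U /\ forall p, U p -> normal_nbhd U p.

(* The predicate [P] on tangent vectors is one of [future_causal_vector] and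
   [past_causal_vector]. A curve on I is represented by a function on R of
   which only the values on I matter. *)
Definition directed_curve
    (P : chart X -> 'rV[R]_n.+1 -> 'rV[R]_n.+1 -> Prop)
    (I : set R) (gam : R -> M) : Prop :=
  {within I, continuous gam} /\
  forall t, I t -> exists (J : set R) (U : set M),
    [/\ J `<=` I, within I (nbhs t) J, convex_normal U,
        U (gam t) /\ gam @` J `<=` U
      & forall t1 t2, J t1 -> J t2 -> t1 < t2 ->
          gam t1 <> gam t2 /\
          exists c : R -> M,
            [/\ geodesic_from_to (gam t1) (gam t2) c,
                c @` `[0, 1] `<=` U
              & forall s (i : chart X), s \in `[0, 1] -> dom i (c s) ->
                  P i (coord i (c s)) (velocity i c s)]].

Definition causal_curve (I : set R) (gam : R -> M) : Prop :=
  directed_curve future_causal_vector I gam \/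
  directed_curve past_causal_vector I gam.

Definition locally_lipschitz (u v : R) (sig : R -> M) : Prop :=
  forall t (i : chart X), t \in `[u, v] -> dom i (sig t) ->
    exists e K : R, 0 < e /\
      forall t1 t2, t1 \in `[u, v] -> t2 \in `[u, v] ->
        `|t1 - t| < e -> `|t2 - t| < e ->
        [/\ dom i (sig t1), dom i (sig t2)
          & `|coord i (sig t1) - coord i (sig t2)| <= K * `|t1 - t2|].

(* sqrt (- g (sig', sig')); Lipschitz curves are differentiable at almost every
   parameter, the value elsewhere is irrelevant to the integral. *)
Definition speed (sig : R -> M) (t : R) : R :=
  let i := chart_at X (sig t) in
  Num.sqrt (- form (metric i (coord i (sig t)))
                (velocity i sig t) (velocity i sig t)).

Definition lipschitz_length (u v : R) (sig : R -> M) : \bar R :=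
  \int[lebesgue_measure]_(t in `[u, v]) (speed sig t)%:E.

Definition reparametrisation (u v u' v' : R) (h : R -> R) : Prop :=
  [/\ u' <= v', h u' = u, h v' = v,
      {within `[u', v'], continuous h}
    & {in `[u', v'] &, {homo h : x y / x < y}}].

(* The length of the restriction of gam to [u, v], u <= v. For a causal curve,
   locally Lipschitz reparametrisations exist and all have the same length, so
   the supremum is that of a singleton and merely names its element. *)
Definition segment_length (gam : R -> M) (u v : R) : \bar R :=
  ereal_sup [set l | exists u' v' h,
    [/\ reparametrisation u v u' v' h,
        locally_lipschitz u' v' (gam \o h)
      & l = lipschitz_length u' v' (gam \o h)]].

Definition curve_length (I : set R) (gam : R -> M) : \bar R :=
  ereal_sup [set l | exists u v,
    [/\ I u, I v, u < v & l = segment_length gam u v]].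

End Causality.

Definition cvg_uniformly_on_compacts {R : realType} {M : metricType R}
    (I : set R) (gam_ : nat -> R -> M) (gam : R -> M) : Prop :=
  forall K : set R, compact K -> K `<=` I ->
    forall e : R, 0 < e ->
      \forall i \near \oo, forall t, K t -> mdist (gam_ i t) (gam t) < e.

(* Main.v *)
From HB Require Import structures.
From Pilot Require Import Defs.
From mathcomp Require Import all_boot all_order all_algebra.
From mathcomp Require Import all_classical all_reals all_analysis.
From mathcomp Require Import measurable_realfun ring lra.
Import Pilot.Defs.

Set Implicit Arguments.
Unset Strict Implicit.
Unset Printing Implicit Defensive.

Import Order.TTheory GRing.Theory Num.Theory.
Import numFieldNormedType.Exports.

Local Open Scope classical_set_scope.
Local Open Scope ring_scope.

(* The length functional is upper semicontinuous along uniformly convergent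
   causal curves. In a chart, a linear form dominating the Lorentzian norm on
   the causal cones near a point bounds the length of every short causal curve
   there by its value on the coordinate displacement, which passes to the limit.
   Hence the upper limit F(s) of the lengths of gam_j up to the parameter s is a
   Lipschitz function of s, and since the form can be chosen almost sharp in the
   direction of the velocity of gam, F' is at most the speed of gam wherever both
   exist; integrating F' gives the claim on compact segments. Close to a,
   hypothesis 2 bounds the length of gam_j on [t, a) by b (a - t), uniformly in
   j, so the estimate extends to [0, a), and the full sequence may be taken as
   the subsequence. *)

(** * Lipschitz functions and Lebesgue integration *)

(** The definition of a causal curve speaks only of connecting geodesics: it gives neither
    derivatives nor a Lipschitz parameter. Two translations therefore precede the estimate. The
    exponential map, together with uniqueness of geodesics, makes the definition infinitesimal: a
    small displacement along the curve is, up to a relative error, a vector of the causal cone at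
    the base point. The value of a timelike covector on such displacements is then a local time
    function, and reparametrising by it produces the Lipschitz parameters in which the length
    integral makes sense. The obstacle in the limit is that the velocities of the [gam_ j] need not
    converge and that each [gam_ j] has a Lipschitz parameter of its own, unrelated to that of
    [gam]. A linear form applied to a displacement depends on two endpoints only, so it ignores both
    difficulties; this is why forms, rather than integrands, are compared. *)

Section LipschitzFTC.
Context {R : realType}.
Local Notation mu := (@lebesgue_measure R).

Lemma cumulative_of (g : R -> R) : {homo g : x y / x <= y} -> continuous g ->
  exists nu : {measure set (measurableTypeR R) -> \bar R},
    forall a b, a <= b -> nu `]a, b]%classic = (g b - g a)%:E.
Proof.
move=> gnd gc.
pose c : cumulative R R := HB.pack g
  (isCumulative.Build R _ R g gnd (right_continuousW gc)).
exists (lebesgue_stieltjes_measure c) => a b ab.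
transitivity (((wlength c)^*)%mu `]a, b]%classic); first by [].
by rewrite measurable_mu_extE/= ?wlength_itv_bnd//; exact: is_ocitv.
Qed.

(* The Stieltjes measures of the nondecreasing functions [x/2 + f] and [x/2 - f]
   add up to the Lebesgue measure, hence are absolutely continuous. *)
Lemma half_lipschitz_density (f : R -> R) (p q : R) :
  (forall x y, `|f x - f y| <= 2^-1 * `|x - y|) -> p < q ->
  exists g : R -> R, mu.-integrable setT (EFin \o g) /\
    forall x y, p <= x -> x <= y -> y <= q ->
      (\int[mu]_(t in `]x, y]) (g t)%:E = (f y - f x + 2^-1 * (y - x))%:E)%E.
Proof.
move=> fl pq.
have fc : continuous f.
  move=> x; apply/cvgrPdist_le => /= e e0; near=> t.
  apply: le_trans (fl _ _) _.
  have : `|x - t| <= e.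
    by near: t; apply/nbhs_ballP; exists e => //= t /ltW.
  by have := normr_ge0 (x - t); lra.
have fxy x y : x <= y -> `|f y - f x| <= 2^-1 * (y - x).
  by move=> xy; apply: le_trans (fl _ _) _; rewrite ger0_norm// subr_ge0.
have lc (s : R) : continuous (fun x : R => 2^-1 * x + s * f x).
  by move=> x; apply: cvgD; [exact: mulrl_continuous|];
    apply: cvgM; [exact: cvg_cst|exact: fc].
have [|nu1 nu1E] := @cumulative_of (fun x => 2^-1 * x + 1 * f x) _ (lc 1).
  by move=> x y xy; have := fxy _ _ xy; rewrite ler_norml => /andP[]; lra.
have [|nu2 nu2E] := @cumulative_of (fun x => 2^-1 * x + -1 * f x) _ (lc _).
  by move=> x y xy; have := fxy _ _ xy; rewrite ler_norml => /andP[]; lra.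
have nuE A : measurable A -> mu A = (nu1 A + nu2 A)%E.
  move=> mA; rewrite -measure_addE; move: A mA.
  apply: lebesgue_measure_unique => X XO.
  apply: eq_trans (esym (measure_addE _ _ _)); move: XO => /ocitvP[->|[[a b]/= /ltW ab ->]].
    have mu0 : mu set0 = 0%E := measure0 _.
    by rewrite mu0 (measure0 nu1) (measure0 nu2) adde0.
  rewrite nu1E// nu2E// lebesgue_measure_itv/= lte_fin.
  case: ltP => [_|ba]; first by rewrite -?EFinD; congr (_%:E); lra.
  have -> : a = b by lra.
  by rewrite -?EFinD; congr (_%:E); lra.
(* Radon-Nikodym is applied to a finite measure, hence the restriction of [nu1] to []p, q]]. *)
have Doo : (nu1 `]p, q]%classic < +oo)%E by rewrite nu1E ?ltry ?ltW.
have mD : measurable (`]p, q]%classic : set (measurableTypeR R)).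
  exact: measurable_itv.
pose nu := mfrestr mD Doo : {finite_measure set _ -> \bar R}.
have [|h [h0 hfin hint hE]] :=
    @radon_nikodym_sigma_finite _ (measurableTypeR R) R mu nu.
  move=> A A0 B mB BA /=; rewrite /mfrestr /mrestr.
  have := A0 _ mB BA; rewrite [X in X = _ -> _]nuE// => /eqP.
  rewrite padde_eq0// => /andP[/eqP B0 _].
  apply/eqP; rewrite eq_le measure_ge0 andbT -B0.
  by apply: le_measure; rewrite ?inE//; exact: measurableI.
exists (fine \o h); split.
  by apply: eq_integrable hint => // x _ /=; rewrite fineK.
move=> x y px xy yq.
under eq_integral do rewrite /= fineK//.
rewrite -hE//= /mfrestr /mrestr setIidl; last first.
  by move=> t /=; rewrite !in_itv/= => /andP[xt ty]; lra.
by rewrite nu1E//; rewrite -?EFinD; congr (_%:E); lra.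
Unshelve. all: by end_near. Qed.
End LipschitzFTC.

Section LipschitzDerivative.
Context {R : realType}.
Local Notation mu := (@lebesgue_measure R).

Lemma clamp_lipschitz (p q x y : R) : p <= q ->
  `|Num.max p (Num.min x q) - Num.max p (Num.min y q)| <= `|x - y|.
Proof.
move=> pq; rewrite ler_norml; have := ler_norm (x - y).
have := ler_norm (y - x); rewrite (distrC y).
have := normr_ge0 (x - y); move: `|_| => n.
by move=> ? ? ?; case: (leP x q) => ?; case: (leP y q) => ?;
  rewrite ?(max_r pq); case: (leP p x) => ?; case: (leP p y) => ?;
  apply/andP; split; lra.
Qed.

(** Clamping extends [f] to the whole line and a division makes it 1/2-Lipschitz, so the previous
    density [g0] of [x / 2 + f0] exists. Undoing the normalisation gives [g], and the Lebesgue
    differentiation theorem identifies it with the derivative at almost every point. *)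
Lemma lipschitz_FTC (f : R -> R) (K p q : R) : p < q ->
  (forall x y, x \in `[p, q] -> y \in `[p, q] ->
    `|f x - f y| <= K * `|x - y|) ->
  exists g : R -> R,
    [/\ mu.-integrable `[p, q] (EFin \o g),
        {ae mu, forall x, x \in `]p, q[ -> is_derive x 1 f (g x)}
      & (\int[mu]_(t in `[p, q]) (g t)%:E = (f q - f p)%:E)%E].
Proof.
move=> pq fl.
pose cl x := Num.max p (Num.min x q).
have clI x : x \in `[p, q] -> cl x = x.
  rewrite in_itv/= => /andP[px xq].
  by rewrite /cl (min_idPl xq) (max_idPr px).
have clin x : cl x \in `[p, q].
  by rewrite in_itv/= /cl le_max lexx/= ge_max (ltW pq) ge_min lexx orbT.
(* [K] has no prescribed sign; the absolute value and the added 1 allow dividing by [2 * M]. *)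
pose M := `|K| + 1.
have M0 : 0 < M by rewrite /M; have := normr_ge0 K; lra.
pose f0 x := f (cl x) / (2 * M).
have [x y||g0 [ig0 g0E]] := @half_lipschitz_density R f0 p q.
- rewrite /f0 -mulrBl normrM normfV (gtr0_norm (_ : 0 < 2 * M)); last lra.
  rewrite ler_pdivrMr; last lra.
  apply: le_trans (fl _ _ (clin x) (clin y)) _.
  have h := @clamp_lipschitz p q x y (ltW pq).
  have -> : 2^-1 * `|x - y| * (2 * M) = M * `|x - y| by field.
  apply: (@le_trans _ _ (M * `|cl x - cl y|)).
    by apply: ler_wpM2r => //; rewrite /M; have := ler_norm K; lra.
  by apply: ler_wpM2l => //; lra.
- by [].
pose g t := (2 * M) * (g0 t - 2^-1).
have mI : measurable (`[p, q]%classic : set (measurableTypeR R)) by [].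
have ig0' : mu.-integrable `[p, q] (EFin \o g0).
  by apply: integrableS ig0 => //; exact: measurableT.
have ic : mu.-integrable `[p, q] (EFin \o (cst (2^-1 : R))).
  apply: measurable_bounded_integrable => //=.
    by rewrite lebesgue_measure_itv/=; case: ifPn => _; rewrite ltry.
  exact: bounded_cst.
pose c : R -> R := cst 2^-1.
have igB : mu.-integrable `[p, q] ((EFin \o g0) \- (EFin \o c))%E.
  exact: integrableB.
have gE : EFin \o g = (fun t => (2 * M)%:E * ((EFin \o g0) \- (EFin \o c)) t)%E.
  by apply/funext => t; rewrite /= -EFinM.
exists g; split.
- by rewrite gE; exact: integrableZl.
- have ax0 x : x \in `]p, q[ -> lebesgue_pt g0 x -> is_derive x 1 f (g x).
    move=> xpq leb; have /andP[px xq] : p < x < q by rewrite in_itv in xpq.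
    have ig0u : mu.-integrable [set` Interval (BRight p) (BRight q)] (EFin \o g0).
      by apply: integrableS ig0 => //; exact: measurableT.
    have [] := @FTC1_lebesgue_pt R g0 (BRight p) x q xq ig0u px leb.
    set F := (X in derivable X _ _) => dF F'.
    have isF : is_derive x 1 F (g0 x) by rewrite -F' derive1E; exact: derivableP.
    have isG : is_derive x 1 ((2 * M) \*: (F - (2^-1 \*: (id : R -> R)))) (g x).
      have -> : g x = (2 * M) *: (g0 x - 2^-1 *: (1 : R)).
        by rewrite /g /GRing.scale/= mulr1.
      by apply: is_deriveZ; apply: is_deriveB.
    (* The primitive [F y] is [f0 y - f0 p + (y - p) / 2], so with the constant [f p + M * p] the
       function is exactly [f] on []p, q[]. *)
    have isH : is_derive x 1 
       (((2 * M) \*: (F - (2^-1 \*: (id : R -> R)))) + cst (f p + M * p) : R -> R) (g x).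
      by rewrite -[g x]addr0; apply: is_deriveD.
    apply: near_eq_is_derive isH; near=> y.
    have : y \in `]p, q[ by near: y; exact: near_in_itvoo.
    rewrite in_itv/= => /andP[py yq].
    rewrite /= !fctE /= /F /Rintegral g0E ?(ltW py) ?(ltW yq)//=.
    rewrite /f0 !clI ?in_itv/= ?lexx ?(ltW pq) ?(ltW py) ?(ltW yq)//=.
    by rewrite /GRing.scale/=; field; lra.
  have := lebesgue_differentiation (open_integrable_locally openT ig0).
  apply: filterS; first exact: (ae_filter_ringOfSetsType mu).
  by move=> x leb xpq; exact: ax0.
- transitivity (\int[mu]_(t in `[p, q]) (EFin \o g) t)%E => //.
  rewrite gE integralZl//.
  rewrite integralB//= -[X in (X - _)%E]integral_itv_obnd_cbnd; last first.
    by apply: measurable_funS (measurable_int _ ig0) => //; exact: measurableT.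
  rewrite g0E//; last exact: ltW.
  have -> : (\int[mu]_(x in `[p, q]) (c x)%:E =
      \int[mu]_(x in `[p, q]) cst (2^-1 : R)%:E x)%E by [].
  rewrite integral_cst//= lebesgue_measure_itv/= lte_fin pq.
  rewrite -?EFinM -?EFinD -?EFinM; congr (_%:E).
  rewrite /f0 !clI ?in_itv/= ?lexx ?(ltW pq)//.
  by field; lra.
Unshelve. all: by end_near. Qed.
End LipschitzDerivative.

Section LowerIntegral.
Local Open Scope ereal_scope.
Context d (T : measurableType d) (R : realType) (mu : {measure set T -> \bar R}).
Import HBNNSimple.

(* The library assumes measurability in its comparison lemmas; for nonnegative
   functions the integral is a supremum over simple minorants and needs none,
   which spares proving that [speed] is measurable. *)
Lemma ae_le_integral_nonmeasurable (D : set T) (f g : T -> \bar R) :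
  (forall x, D x -> 0 <= f x) -> (forall x, D x -> 0 <= g x) ->
  {ae mu, forall x, D x -> f x <= g x} ->
  \int[mu]_(x in D) f x <= \int[mu]_(x in D) g x.
Proof.
move=> f0 g0 [N [mN N0 fgN]].
rewrite ge0_integralE// [leRHS]ge0_integralE//.
apply: ge_ereal_sup => _ [h /= hf <-].
have mNc : measurable (~` N) by exact: measurableC.
(* Cutting the simple minorant off on the null set [N] makes it a minorant of [g] everywhere without
   changing its integral. *)
pose h' := proj_nnsfun h mNc.
have h'E x : h' x = (h x * \1_(~` N) x)%R by [].
have int_s (k : {nnsfun T >-> R}) : sintegral mu k = \int[mu]_x (k x)%:E.
  by rewrite integral_nnsfun// patch_setT.
apply: ereal_sup_ubound => /=; exists h'.
  move=> x; rewrite h'E indicE.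
  case: (boolP (x \in ~` N)) => [|_]; last first.
    rewrite mulr0 /patch; case: ifPn => // /set_mem Dx; exact: g0.
  rewrite inE /= => Nx; rewrite mulr1; apply: le_trans (hf x) _.
  rewrite /patch; case: ifPn => // /set_mem Dx.
  by apply: contrapT => fg; apply/Nx/fgN => /= /(_ Dx).
rewrite !int_s; apply: ge0_ae_eq_integral => //.
- by apply/measurable_EFinP.
- by apply/measurable_EFinP.
- by move=> x _; rewrite lee_fin; exact: fun_ge0.
- by move=> x _; rewrite lee_fin; exact: fun_ge0.
exists N; split => // x /not_implyP[_ hh']; apply: contrapT => Nx; apply: hh'.
by congr (_%:E); apply: (eq_trans (h'E x)); rewrite indicE mem_set// mulr1.
Qed.

(** A simple minorant is measurable even when [f] is not, so its integral splits over [A] and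
    [B \ A]. The two sets may overlap, as adjacent closed intervals do. *)
Lemma integral_setU_le_nonmeasurable (A B : set T) (f : T -> \bar R) :
  measurable A -> measurable B -> (forall x, 0 <= f x) ->
  \int[mu]_(x in A `|` B) f x <=
  \int[mu]_(x in A) f x + \int[mu]_(x in B) f x.
Proof.
move=> mA mB f0; rewrite ge0_integralE//.
apply: ge_ereal_sup => _ [h /= hf <-].
have mh D : measurable_fun D (EFin \o h).
  by apply/measurable_EFinP; exact: measurable_funTS.
have h0 x : 0 <= (h x)%:E by rewrite lee_fin; exact: fun_ge0.
have mBA : measurable (B `\` A) by exact: measurableD.
have hfD (D : set T) : D `<=` A `|` B ->
    \int[mu]_(x in D) (h x)%:E <= \int[mu]_(x in D) f x.
  move=> DAB; apply: ae_le_integral_nonmeasurable => //.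
  apply: aeW => x Dx; apply: le_trans (hf x) _.
  by rewrite /patch mem_set//; exact: DAB.
have -> : sintegral mu h = \int[mu]_(x in A `|` (B `\` A)) (h x)%:E.
  rewrite integral_nnsfun; last exact: measurableU.
  congr sintegral; apply/funext => x; rewrite /patch; case: ifPn => // xAB.
  apply/eqP; rewrite eq_le -!lee_fin h0 andbT; apply: le_trans (hf x) _.
  rewrite /patch ifF//; apply/negbTE; apply: contra xAB.
  by rewrite !inE /= => -[|Bx]; [left|have [|] := pselect (A x); [left|right]].
rewrite ge0_integral_setU//=; last first.
  by apply/disj_set2P; rewrite setIDA setIC -setIDA setDv setI0.
apply: leeD; first by apply: hfD => x; left.
apply: le_trans (hfD _ _); last by move=> x; right.
by apply: ge0_subset_integral => // x [].
Qed.
End LowerIntegral.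

(** * Differential calculus in coordinates *)

Section RowNorm.
Context {R : realType}.

Lemma nbhs_distP (V : normedModType R) (x : V) (A : set V) :
  nbhs x A <-> exists2 e : R, 0 < e & forall y, `|y - x| < e -> A y.
Proof.
split=> [/nbhs_ballP[e /= e0 eA]|[e e0 eA]].
  by exists e => // y yx; apply: eA; rewrite -ball_normE /= distrC.
apply/nbhs_ballP; exists e => //= y; rewrite -ball_normE /= distrC; exact: eA.
Qed.

Lemma row_norm_le {m} (v : 'rV[R]_m) (e : R) : 0 <= e ->
  (forall k, `|v 0 k| <= e) -> `|v| <= e.
Proof.
move=> e0 ve; rewrite [leLHS]/Num.Def.normr/= mx_normrE.
by apply: bigmax_le => // -[i j] _ /=; rewrite ord1.
Qed.

Lemma coord_norm_le {m} (v : 'rV[R]_m) k : `|v 0 k| <= `|v|.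
Proof.
by rewrite [leRHS]/Num.Def.normr/= mx_normrE; exact: (le_bigmax _ _ (0, k)).
Qed.

End RowNorm.

Section StrictDifferentiability.
Context {R : realType}.

Lemma mean_value_estimate (g : R -> R) (dg : R -> R) (a b c e : R) :
  (forall t, t \in `[Num.min a b, Num.max a b] ->
     is_derive t 1 g (dg t) /\ `|dg t - c| <= e) ->
  `|g b - g a - c * (b - a)| <= e * `|b - a|.
Proof.
wlog ab : a b / a <= b => [H|].
  case/orP: (le_total a b) => [|ab]; first exact: H.
  move=> gP; rewrite -normrN [in leRHS]distrC.
  have -> : - (g b - g a - c * (b - a)) = g a - g b - c * (a - b) by ring.
  by apply: H => //; rewrite minC maxC.
rewrite (min_idPl ab) (max_idPr ab) => gP.
have [||t tab ->] := @MVT_segment R g dg a b ab.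
- by move=> t tab; apply: (gP t _).1; exact: subset_itv_oo_cc.
- apply: derivable_within_continuous => t tab.
  by have [[]] := gP _ tab.
rewrite -mulrBl normrM; apply: ler_wpM2r => //.
exact: (gP _ tab).2.
Qed.

Lemma is_derive_line (V : normedModType R) (f : V -> R) (w e : V) (t : R) :
  derivable f (t *: e + w) e ->
  is_derive t 1 (fun s => f (s *: e + w)) ('D_e f (t *: e + w)).
Proof.
have E : (fun h : R => h^-1 *: ((fun s => f (s *: e + w)) (h *: (1 : R) + t) -
      f (t *: e + w))) =
    (fun h : R => h^-1 *: (f (h *: e + (t *: e + w)) - f (t *: e + w))).
  by apply/funext => h; rewrite [h *: 1]mulr1 scalerDl addrA.
move=> df; split; first by rewrite /derivable E.
by rewrite /derive E.
Qed.

Context {m : nat}.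
Implicit Types (x y z : 'rV[R]_m).

(** Passing from [z] to [y] one coordinate at a time reduces the claim to the mean value theorem for
    each partial derivative, which is nearly constant by continuity. Both [y] and [z] vary: this
    strict form contains Lipschitz bounds as well as differentiability at [x]. *)
Lemma smooth_strict_diff (U : set 'rV[R]_m) (f : 'rV[R]_m -> R) x :
  smooth_on U f -> nbhs x U -> forall e : R, 0 < e ->
  exists2 d : R, 0 < d & forall y z, `|y - x| < d -> `|z - x| < d ->
    `|f y - f z - \sum_k (y - z) 0 k * partial k f x| <= e * `|y - z|.
Proof.
move=> fs /nbhs_distP[d1 d10 d1U] e e0.
have Ux : U x by apply: d1U; rewrite subrr normr0.
pose e' := e / m.+1%:R.
have e'0 : 0 < e' by rewrite divr_gt0.
have /nbhs_distP[d2 d20 d2P] :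
    \forall y \near x, forall k, `|partial k f y - partial k f x| <= e'.
  apply: (filter_forall (nbhs_filter x)) => k.
  have [pc _] := fs [:: k] _ Ux.
  move/cvgrPdist_le : pc => /(_ _ e'0); apply: filterS => y /=.
  by rewrite distrC.
exists (Num.min d1 d2) => [|y z]; first by rewrite lt_min d10.
rewrite !lt_min => /andP[y1 y2] /andP[z1 z2].
(* The first [j] coordinates of [w j] are those of [y], the others those of [z]: a path from
   [w 0 = z] to [w m = y]. *)
pose w (j : nat) : 'rV[R]_m := \row_k (if (k < j)%N then y 0 k else z 0 k).
have wS (j : 'I_m) : w j.+1 = (y - z) 0 j *: delta_mx 0 j + w j.
  apply/rowP => k; rewrite !mxE eqxx /= ltnS leq_eqVlt.
  have [->|kj] := eqVneq k j; first by rewrite eqxx /= ltnn mulr1 subrK.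
  by rewrite (inj_eq val_inj) (negPf kj) /= mulr0 add0r.
have step (j : 'I_m) :
    `|f (w j.+1) - f (w j) - (y - z) 0 j * partial j f x| <= e' * `|y - z|.
  have := @mean_value_estimate (fun s => f (s *: delta_mx 0 j + w j))
    (fun s => partial j f (s *: delta_mx 0 j + w j))
    0 ((y - z) 0 j) (partial j f x) e'.
  rewrite subr0 scale0r add0r -wS [partial j f x * _]mulrC => H.
  apply: le_trans (H _) _; last by apply: ler_wpM2l; [exact: ltW|exact: coord_norm_le].
  move=> t tyz.
  (* In the sup norm every leg of the path stays in any ball about [x] containing [y] and [z],
     because each coordinate stays between those of [y] and [z]. *)
  have near_x d : `|y - x| < d -> `|z - x| < d ->
      `|t *: delta_mx 0 j + w j - x| < d.
    move=> yd zd; apply: le_lt_trans (_ : _ <= Num.max `|y - x| `|z - x|) _; last first.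
      by rewrite gt_max yd zd.
    apply: row_norm_le => [|k]; first by rewrite le_max normr_ge0.
    have := coord_norm_le (y - x) k; have := coord_norm_le (z - x) k.
    rewrite !mxE eqxx /=; move: tyz; rewrite in_itv/= !mxE.
    have [->|_] := eqVneq k j; last first.
      rewrite mulr0 add0r => _ h1 h2; case: ifP => _.
        by apply: le_trans h2 _; rewrite le_max lexx.
      by apply: le_trans h1 _; rewrite le_max lexx orbT.
    rewrite ltnn mulr1 => tyz h1 h2.
    have : `|t + z 0 j - x 0 j| <= Num.max `|y 0 j - x 0 j| `|z 0 j - x 0 j|.
      rewrite le_max; apply/orP.
      move: tyz; case: (leP 0 (y 0 j - z 0 j)) => ? /andP[? ?].
      + case: (leP 0 (t + z 0 j - x 0 j)) => ?; [left|right].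
          by rewrite ger0_norm//; have := ler_norm (y 0 j - x 0 j); lra.
        by rewrite ltr0_norm//; have := ler_norm (-(z 0 j - x 0 j));
          rewrite normrN; lra.
      + case: (leP 0 (t + z 0 j - x 0 j)) => ?; [right|left].
          by rewrite ger0_norm//; have := ler_norm (z 0 j - x 0 j); lra.
        by rewrite ltr0_norm//; have := ler_norm (-(y 0 j - x 0 j));
          rewrite normrN; lra.
    by move=> h; apply: le_trans h _; rewrite ge_max !le_max h1 h2 orbT.
  split.
    by apply: is_derive_line; have [_] := fs [::] _ (d1U _ (near_x _ y1 z1)); exact.
  exact: (d2P _ (near_x _ y2 z2)).
have w0 : w 0%N = z by apply/rowP => k; rewrite mxE.
have wm : w m = y by apply/rowP => k; rewrite mxE ltn_ord.
have -> : f y - f z = \sum_(j < m) (f (w j.+1) - f (w j)).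
  by rewrite -(big_mkord xpredT (fun j => f (w j.+1) - f (w j)))
    (telescope_sumr (fun j => f (w j)))// w0 wm.
rewrite -sumrB; apply: le_trans (ler_norm_sum _ _ _) _.
apply: (@le_trans _ _ (\sum_(j < m) e' * `|y - z|)); first exact: ler_sum.
rewrite sumr_const card_ord -mulr_natl mulrA; apply: ler_wpM2r => //.
rewrite /e' mulrCA ler_piMr// ?(ltW e0)// ler_pdivrMr// mul1r ler_nat.
by [].
Qed.
End StrictDifferentiability.

Section LipschitzNear.
Context {R : realType}.

Definition lipschitz_near (V : normedModType R) (f : V -> R) (x : V) :=
  exists K d : R, [/\ 0 <= K, 0 < d & forall y z, `|y - x| < d ->
    `|z - x| < d -> `|f y - f z| <= K * `|y - z|].

Context {V : normedModType R}.
Implicit Types (f g : V -> R) (x : V).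

Lemma lipschitz_near_bounded f x : lipschitz_near f x ->
  exists B d : R, [/\ 0 <= B, 0 < d & forall y, `|y - x| < d -> `|f y| <= B].
Proof.
move=> [K [d [K0 d0 fK]]]; exists (`|f x| + K * d), d; split => //.
  by rewrite addr_ge0// mulr_ge0// ltW.
move=> y yx; have := fK y x yx; rewrite subrr normr0 => /(_ d0) h.
have := ler_normD (f x) (f y - f x); rewrite addrC subrK => /le_trans; apply.
rewrite lerD2l (le_trans h)//; apply: ler_wpM2l => //; exact: ltW.
Qed.

Lemma lipschitz_near_cst (c : R) x : lipschitz_near (fun=> c) x.
Proof. by exists 0, 1; split=> // y z _ _; rewrite subrr normr0 mul0r. Qed.

Lemma lipschitz_nearD f g x : lipschitz_near f x -> lipschitz_near g x ->
  lipschitz_near (fun y => f y + g y) x.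
Proof.
move=> [K [d [K0 d0 fK]]] [L [c [L0 c0 gL]]].
exists (K + L), (Num.min d c); split; [exact: addr_ge0|by rewrite lt_min d0|].
move=> y z; rewrite !lt_min => /andP[yd yc] /andP[zd zc].
rewrite opprD addrACA mulrDl; apply: le_trans (ler_normD _ _) _.
by apply: lerD; [exact: fK|exact: gL].
Qed.

Lemma lipschitz_nearM f g x : lipschitz_near f x -> lipschitz_near g x ->
  lipschitz_near (fun y => f y * g y) x.
Proof.
move=> lf lg; have [A [a [A0 a0 fA]]] := lipschitz_near_bounded lf.
have [B [b [B0 b0 gB]]] := lipschitz_near_bounded lg.
move: lf lg => [K [d [K0 d0 fK]]] [L [c [L0 c0 gL]]].
exists (A * L + B * K), (Num.min (Num.min d c) (Num.min a b)); split.
- by rewrite addr_ge0// mulr_ge0.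
- by rewrite !lt_min d0 c0 a0 b0.
move=> y z; rewrite !lt_min.
move=> /andP[/andP[yd yc] /andP[ya yb]] /andP[/andP[zd zc] /andP[za zb]].
have -> : f y * g y - f z * g z = f y * (g y - g z) + g z * (f y - f z) by ring.
apply: le_trans (ler_normD _ _) _; rewrite !normrM mulrDl -!mulrA.
by apply: lerD; apply: ler_pM; rewrite ?fA ?gB ?fK ?gL.
Qed.

Lemma lipschitz_nearN f x : lipschitz_near f x ->
  lipschitz_near (fun y => - f y) x.
Proof.
move=> /(lipschitz_nearM (lipschitz_near_cst (-1) x)).
by under eq_fun do rewrite mulN1r.
Qed.

Lemma lipschitz_near_sum (I : Type) (r : seq I) (F : I -> V -> R) x :
  (forall i, lipschitz_near (F i) x) ->
  lipschitz_near (fun y => \sum_(i <- r) F i y) x.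
Proof.
move=> lF; elim: r => [|i r IH].
  by under eq_fun do rewrite big_nil; exact: lipschitz_near_cst.
by under eq_fun do rewrite big_cons; exact: lipschitz_nearD.
Qed.

Lemma lipschitz_near_prod (I : Type) (r : seq I) (F : I -> V -> R) x :
  (forall i, lipschitz_near (F i) x) ->
  lipschitz_near (fun y => \prod_(i <- r) F i y) x.
Proof.
move=> lF; elim: r => [|i r IH].
  by under eq_fun do rewrite big_nil; exact: lipschitz_near_cst.
by under eq_fun do rewrite big_cons; exact: lipschitz_nearM.
Qed.

Lemma lipschitz_nearV f x : f x != 0 -> lipschitz_near f x ->
  lipschitz_near (fun y => (f y)^-1) x.
Proof.
move=> fx0 [K [d [K0 d0 fK]]].
pose c := `|f x| / 2; have c0 : 0 < c by rewrite divr_gt0// normr_gt0.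
pose d' := Num.min d (c / (K + 1)).
have K10 : 0 < K + 1 by lra.
have low y : `|y - x| < d' -> c <= `|f y|.
  rewrite lt_min ltr_pdivlMr// => /andP[yd yc].
  have := fK y x yd; rewrite subrr normr0 => /(_ d0) h.
  have : `|f y - f x| <= c.
    by have := normr_ge0 (y - x); move: h yc; set u := `|y - x|; nra.
  have := ler_normB (f y) (f y - f x); rewrite opprB addrC subrK.
  rewrite /c; lra.
exists (K / (c * c)), d'; split.
- by rewrite divr_ge0// mulr_ge0// ltW.
- by rewrite lt_min d0 divr_gt0.
move=> y z yd zd; have cy := low _ yd; have cz := low _ zd.
have y0 : f y != 0 by rewrite -normr_gt0; lra.
have z0 : f z != 0 by rewrite -normr_gt0; lra.
have -> : (f y)^-1 - (f z)^-1 = (f z - f y) / (f y * f z).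
  by field; rewrite y0 z0.
rewrite normrM normfV distrC (mulrC K) -mulrA [leRHS]mulrC.
apply: ler_pM => //.
- apply: fK; first by move: yd; rewrite lt_min => /andP[].
  by move: zd; rewrite lt_min => /andP[].
- rewrite lef_pV2 ?posrE ?mulr_gt0 ?normr_gt0 ?mulf_neq0//.
  by rewrite normrM; apply: ler_pM => //; exact: ltW.
Qed.

Lemma lipschitz_near_comp (W : normedModType R) (h : W -> V) (f : V -> R) (w : W) :
  (forall y z, `|h y - h z| <= `|y - z|) ->
  lipschitz_near f (h w) -> lipschitz_near (fun y => f (h y)) w.
Proof.
move=> hl [K [d [K0 d0 fK]]]; exists K, d; split => // y z yd zd.
apply: le_trans (fK _ _ _ _) _; try exact: le_lt_trans (hl _ _) _.
exact: ler_wpM2l.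
Qed.

Lemma lipschitz_near_det (k : nat) (A : V -> 'M[R]_k) x :
  (forall i j, lipschitz_near (fun y => A y i j) x) ->
  lipschitz_near (fun y => \det (A y)) x.
Proof.
move=> lA; apply: lipschitz_near_sum => s.
apply: lipschitz_nearM; first exact: lipschitz_near_cst.
exact: lipschitz_near_prod.
Qed.

(** By Cramer the entries are cofactors divided by the determinant. [invmx] is given by this formula
    only at invertible matrices, hence the assumption on a whole neighbourhood. *)
Lemma lipschitz_near_invmx (k : nat) (A : V -> 'M[R]_k) x :
  (forall i j, lipschitz_near (fun y => A y i j) x) ->
  (\near x, A x \in unitmx) ->
  forall i j, lipschitz_near (fun y => invmx (A y) i j) x.
Proof.
move=> lA uA i j.
have detx : \det (A x) != 0.
  by have := nbhs_singleton uA; rewrite unitmxE unitfE.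
have [K [d [K0 d0 fK]]] : lipschitz_near
    (fun y => (\det (A y))^-1 * cofactor (A y) j i) x.
  apply: lipschitz_nearM.
    by apply: lipschitz_nearV => //; exact: lipschitz_near_det.
  apply: lipschitz_nearM; first exact: lipschitz_near_cst.
  apply: lipschitz_near_det => a b.
  by under eq_fun do rewrite !mxE; exact: lA.
move/nbhs_distP : uA => [e e0 eA].
exists K, (Num.min d e); split => //; first by rewrite lt_min d0.
move=> y z; rewrite !lt_min => /andP[yd ye] /andP[zd ze].
by rewrite /invmx (eA _ ye) (eA _ ze) !mxE; exact: fK.
Qed.

End LipschitzNear.

Lemma smooth_lipschitz_near {R : realType} {m : nat} (U : set 'rV[R]_m)
  (f : 'rV[R]_m -> R) x : smooth_on U f -> nbhs x U -> lipschitz_near f x.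
Proof.
move=> fs Ux; have [d d0 dP] := smooth_strict_diff fs Ux ltr01.
exists (1 + \sum_(k < m) `|partial k f x|), d; split => //.
  by rewrite addr_ge0// sumr_ge0.
move=> y z yd zd; have := dP y z yd zd.
set s := \sum_k _ => h.
have : `|s| <= (\sum_(k < m) `|partial k f x|) * `|y - z|.
  apply: le_trans (ler_norm_sum _ _ _) _; rewrite mulr_suml ler_sum// => k _.
  by rewrite normrM mulrC ler_wpM2l// coord_norm_le.
have := ler_normD (f y - f z - s) s; rewrite subrK; lra.
Qed.

Lemma smooth_on_partial {R : realType} {m : nat} (U : set 'rV[R]_m)
  (f : 'rV[R]_m -> R) k : smooth_on U f -> smooth_on U (partial k f).
Proof.
move=> fs s x Ux; have := fs (rcons s k) x Ux.
by rewrite /iter_partial foldr_rcons.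
Qed.

Section RowDifferential.
Context {R : realType}.

(** The quotient limit multiplied by [|h|]: in this form the estimate includes [h = 0] and composes
    with other error bounds. *)
Lemma is_derive_distP (V W : normedModType R) (c : V -> W) (t u : V) (v : W) :
  is_derive t u c v <-> forall e : R, 0 < e -> exists2 d : R, 0 < d &
    forall h : R, `|h| < d -> `|c (h *: u + t) - c t - h *: v| <= e * `|h|.
Proof.
have E (h : R) : h != 0 ->
    `|v - h^-1 *: (c (h *: u + t) - c t)| * `|h| =
    `|c (h *: u + t) - c t - h *: v|.
  move=> h0; rewrite -normrN mulrC -normrZ scalerN scalerBr scalerA mulfV//.
  by rewrite scale1r opprB.
split=> [[/cvg_ex[l cl] cv] e e0|H].
  have lv : l = v by rewrite -cv; apply/esym/cvg_lim.
  move: cl; rewrite lv => /cvgrPdist_le /(_ _ e0) /nbhs_distP[d /= d0 dP].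
  exists d => // h hd; have [->|h0] := eqVneq h 0.
    by rewrite !scale0r add0r !subrr !normr0 mulr0.
  by rewrite -E// ler_wpM2r// dP// subr0.
have cv : h^-1 *: (c (h *: u + t) - c t) @[h --> 0^'] --> v.
  apply/cvgrPdist_le => /= e e0; have [d d0 dP] := H _ e0.
  apply/nbhs_distP; exists d => //= h; rewrite subr0 => hd h0.
  rewrite -(ler_pM2r (_ : 0 < `|h|)); last by rewrite normr_gt0.
  by rewrite E//; exact: dP.
split; first by apply/cvg_ex; exists v.
exact/cvg_lim.
Qed.

Lemma mulmx_norm_bound {m k} (A : 'M[R]_(m, k)) :
  exists2 C : R, 0 < C & forall v : 'rV[R]_m, `|v *m A| <= C * `|v|.
Proof.
exists (1 + \sum_i \sum_j `|A i j|).
  by rewrite ltr_pwDl// !sumr_ge0// => i _; rewrite sumr_ge0.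
move=> v; apply: row_norm_le.
  by rewrite mulr_ge0// addr_ge0// !sumr_ge0// => i _; rewrite sumr_ge0.
move=> j; rewrite mxE; apply: le_trans (ler_norm_sum _ _ _) _.
rewrite mulrDl mul1r -[leLHS]add0r; apply: lerD => //; rewrite mulr_suml.
apply: ler_sum => i _; rewrite normrM mulrC; apply: ler_pM => //.
  by rewrite (bigD1 j)//= lerDl sumr_ge0.
exact: coord_norm_le.
Qed.

Definition differential {m k} (F : 'rV[R]_m -> 'rV[R]_k) (x : 'rV[R]_m) :
  'M[R]_(m, k) := \matrix_(i, l) partial i (fun y => F y 0 l) x.

Definition strictly_differentiable {m k} (F : 'rV[R]_m -> 'rV[R]_k)
    (x : 'rV[R]_m) := forall e : R, 0 < e ->
  exists2 d : R, 0 < d & forall y z, `|y - x| < d -> `|z - x| < d ->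
    `|F y - F z - (y - z) *m differential F x| <= e * `|y - z|.

Lemma smooth_strictly_differentiable {m k} (U : set 'rV[R]_m)
    (F : 'rV[R]_m -> 'rV[R]_k) x :
  (forall l, smooth_on U (fun y => F y 0 l)) -> nbhs x U ->
  strictly_differentiable F x.
Proof.
move=> Fs Ux e e0.
have dl l := smooth_strict_diff (Fs l) Ux e0.
have [d d0 dP] : exists2 d : R, 0 < d & forall l y z,
    `|y - x| < d -> `|z - x| < d ->
    `|F y 0 l - F z 0 l - \sum_k (y - z) 0 k * partial k (fun y => F y 0 l) x|
      <= e * `|y - z|.
  pose D l := sval (cid2 (dl l)).
  have D0 l : 0 < D l by rewrite /D; case: cid2.
  exists (\big[Num.min/1]_l D l).
    by elim/big_ind: _ => // a b a0 b0; rewrite lt_min a0.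
  move=> l y z yd zd.
  have : \big[Num.min/1]_l D l <= D l by exact: bigmin_le_cond.
  by rewrite /D; case: cid2 => d /= _ dP ld; apply: dP;
    [exact: lt_le_trans yd _|exact: lt_le_trans zd _].
exists d => // y z yd zd; apply: row_norm_le => [|l].
  by rewrite mulr_ge0// ltW.
have := dP l y z yd zd; congr (_ <= _); congr `| _ |; rewrite !mxE.
by congr (_ - _); apply: eq_bigr => i _; rewrite !mxE.
Qed.

Section Fixed.
Context {m k : nat} (F : 'rV[R]_m -> 'rV[R]_k) (x : 'rV[R]_m).
Hypothesis Fd : strictly_differentiable F x.

Lemma strictly_differentiable_lipschitz :
  exists K d : R, [/\ 0 < K, 0 < d & forall y z, `|y - x| < d ->
    `|z - x| < d -> `|F y - F z| <= K * `|y - z|].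
Proof.
have [C C0 CP] := mulmx_norm_bound (differential F x).
have [d d0 dP] := Fd ltr01; exists (1 + C), d; split=> [||y z yd zd] //.
  by rewrite addr_gt0.
have := dP y z yd zd; have := CP (y - z).
set w := _ *m _ => h1 h2.
have := ler_normD (F y - F z - w) w; rewrite subrK; lra.
Qed.

Lemma is_derive_strict (v : 'rV[R]_m) : is_derive x v F (v *m differential F x).
Proof.
apply/is_derive_distP => e e0.
have v1 : 0 < `|v| + 1 by have := normr_ge0 v; lra.
have [|d d0 dP] := Fd (_ : 0 < e / (`|v| + 1)); first by rewrite divr_gt0.
exists (d / (`|v| + 1)) => [|h hd]; first by rewrite divr_gt0.
have hv : `|h *: v| < d.
  move: hd; rewrite ltr_pdivlMr// normrZ; have := normr_ge0 h; nra.
have := dP (h *: v + x) x; rewrite addrK subrr normr0 => /(_ hv d0).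
rewrite -scalemxAl => /le_trans; apply.
rewrite normrZ mulrAC -mulrA ler_wpM2l ?(ltW e0)//.
rewrite ler_pdivrMr//; have := normr_ge0 h; nra.
Qed.

Lemma is_derive_comp_strict (c : R -> 'rV[R]_m) (t : R) (v : 'rV[R]_m) :
  c t = x -> is_derive t 1 c v ->
  is_derive t 1 (fun s => F (c s)) (v *m differential F x).
Proof.
move=> ctx /is_derive_distP; rewrite ctx => cv.
apply/is_derive_distP => e e0; rewrite ctx.
have [C C0 CP] := mulmx_norm_bound (differential F x).
have v1 : 0 < `|v| + 1 by have := normr_ge0 v; lra.
(* The error is that of [F] on an increment of norm at most [(|v| + 1) |h|], plus that of [c] pushed
   through the differential, whose norm is bounded by [C]; each receives [e / 2]. The minimum with 1
   in [e2] is what bounds the increment. *)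
have e1 : 0 < e / (2 * (`|v| + 1)) by rewrite divr_gt0// mulr_gt0.
have e2 : 0 < Num.min 1 (e / (2 * C)) by rewrite lt_min ltr01 divr_gt0// mulr_gt0.
have [d d0 dP] := Fd e1; have [r r0 rP] := cv _ e2.
exists (Num.min r (d / (`|v| + 1))) => [|h]; first by rewrite lt_min r0 divr_gt0.
rewrite lt_min ltr_pdivlMr// => /andP[hr hd].
have := rP h hr; set w := h *: v; set y := c (h *: 1 + t) => cyw.
have hh := normr_ge0 h.
have cy : `|y - x| <= (`|v| + 1) * `|h|.
  have := ler_normD (y - x - w) w; rewrite subrK normrZ => h1.
  apply: le_trans h1 _; have : Num.min 1 (e / (2 * C)) <= 1 by rewrite ge_min lexx.
  by move: cyw; nra.
have := dP y x; rewrite subrr normr0 => /(_ _ d0) h1.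
have {h1} := h1 (_ : _ < d).
rewrite mulrC in cy; have h2 := le_lt_trans cy hd.
move=> /(_ h2) h1.
have h3 := CP (y - x - w); rewrite mulmxBl -scalemxAl in h3.
set D := differential _ _ in h1 h3 *.
have -> : F y - F x - h *: (v *m D) =
   (F y - F x - (y - x) *m D) + ((y - x) *m D - h *: (v *m D)).
  by rewrite addrA subrK.
apply: le_trans (ler_normD _ _) _; apply: (@le_trans _ _ (e / 2 * `|h| + e / 2 * `|h|)); last lra.
apply: lerD.
  apply: le_trans h1 _; apply: le_trans (ler_wpM2l (ltW e1) cy) _.
  have -> // : e / (2 * (`|v| + 1)) * (`|h| * (`|v| + 1)) = e / 2 * `|h|.
  by field; rewrite gt_eqF.
apply: le_trans h3 _; apply: le_trans (ler_wpM2l (ltW C0) cyw) _.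
rewrite mulrA ler_wpM2r//.
have : Num.min 1 (e / (2 * C)) <= e / (2 * C) by rewrite ge_min lexx orbT.
move/(ler_wpM2l (ltW C0)) => /le_trans; apply.
have -> // : C * (e / (2 * C)) = e / 2 by field; rewrite gt_eqF.
Qed.
End Fixed.
End RowDifferential.

(** * Induction along intervals, one-sided coincidence and second-order uniqueness *)

Section RealInduction.
Context {R : realType}.

(** Completeness of the reals in inductive form: the supremum of the [s] such that [P] holds on
    [[u, s]] is attained by the left-hand step and pushed up to [v] by the right-hand one. *)
Lemma real_induction (P : R -> Prop) (u v : R) : u <= v -> P u ->
  (forall s, u <= s < v -> (forall r, u <= r <= s -> P r) ->
     exists2 e : R, 0 < e & forall r, s < r < s + e -> r <= v -> P r) ->
  (forall s, u < s <= v -> (forall r, u <= r < s -> P r) -> P s) ->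
  forall s, u <= s <= v -> P s.
Proof.
move=> uv Pu right left.
pose A := [set s | u <= s <= v /\ forall r, u <= r <= s -> P r].
have Au : A u.
  split; first by rewrite lexx.
  by move=> r /andP[? ?]; have -> : r = u by lra.
have ubA : has_sup A.
  by split; [exists u|exists v => s [/andP[]]].
pose s := sup A.
have us : u <= s by apply: ub_le_sup => //; case: ubA.
have sv : s <= v by apply: ge_sup; [exists u|move=> r [/andP[]]].
have Plt r : u <= r < s -> P r.
  move=> /andP[ur rs].
  have sr : 0 < s - r by lra.
  have [t At rt] := sup_adherent sr ubA.
  by apply: At.2; rewrite ur /=; move: rt; rewrite -/s; lra.
have Ps : P s.
  have [<-//|us'] := eqVneq u s.
  by apply: left => //; rewrite lt_neqAle us' us.
have Ple r : u <= r <= s -> P r.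
  move=> /andP[ur]; rewrite le_eqVlt => /predU1P[->//|rs].
  by apply: Plt; rewrite ur.
have [sv'|vs] := ltP s v; last first.
  by move=> r /andP[ur rv]; apply: Ple; rewrite ur; lra.
have [|e e0 eP] := right s _ Ple; first by rewrite us.
pose t := Num.min v (s + e / 2).
have st : s < t by rewrite lt_min sv'/=; lra.
have At : A t.
  split; first by rewrite ge_min lexx; lra.
  move=> r /andP[ur rt]; have [rs|sr] := leP r s; first by apply: Ple; rewrite ur.
  have := rt; rewrite le_min => /andP[rv re].
  by apply: eP => //; lra.
have : t <= s by apply: ub_le_sup => //; case: ubA.
by rewrite leNgt st.
Qed.

(** Replaces subdivisions and Lebesgue numbers. The local assumption concerns only intervals having
    [t] as an endpoint, which is exactly what a first-order expansion at [t] provides. *)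
Lemma local_to_global (Q : R -> R -> Prop) (u v : R) : u <= v ->
  (forall t, u <= t <= v -> exists2 e : R, 0 < e &
     (forall s, t <= s < t + e -> s <= v -> Q t s) /\
     (forall s, t - e < s <= t -> u <= s -> Q s t)) ->
  (forall r s t, u <= r -> r <= s -> s <= t -> t <= v ->
     Q r s -> Q s t -> Q r t) ->
  Q u v.
Proof.
move=> uv loc tr.
suff : forall s, u <= s <= v -> Q u s by apply; rewrite uv lexx.
apply: real_induction => //.
- have [|e e0 [H _]] := loc u; first by rewrite lexx.
  by apply: H; lra.
- move=> s /andP[us sv] IH; have [|e e0 [H _]] := loc s; first by rewrite us ltW.
  exists e => // r /andP[sr re] rv; apply: (tr _ s) => //; try lra.
    by apply: IH; rewrite us lexx.
  by apply: H; lra.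
- move=> s /andP[us sv] IH; have [|e e0 [_ H]] := loc s; first by rewrite ltW.
  pose r := Num.max u (s - e / 2).
  have rs : r < s by rewrite gt_max us/=; lra.
  have ur : u <= r by rewrite le_max lexx.
  apply: (tr _ r) => //; try lra.
    by apply: IH; rewrite ur.
  apply: H => //; apply/andP; split; last lra.
  by rewrite lt_max; apply/orP; right; lra.
Qed.
End RealInduction.

Section RowCurves.
Context {R : realType}.

Lemma is_derive_coord {m} (c : R -> 'rV[R]_m) (t : R) (v : 'rV[R]_m) k :
  is_derive t 1 c v -> is_derive t 1 (fun s => c s 0 k) (v 0 k).
Proof.
move=> /is_derive_distP cv; apply/is_derive_distP => e /cv[d d0 dP].
exists d => // h /dP; apply: le_trans.
have := coord_norm_le (c (h *: (1 : R) + t) - c t - h *: v) k.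
by rewrite !mxE.
Qed.

Lemma row_mean_value {m} (g dg : R -> 'rV[R]_m) (a b e : R) : 0 <= e ->
  (forall t, t \in `[Num.min a b, Num.max a b] ->
     is_derive t 1 g (dg t) /\ `|dg t| <= e) ->
  `|g b - g a| <= e * `|b - a|.
Proof.
move=> e0 H; apply: row_norm_le => [|k]; first by rewrite mulr_ge0.
have := @mean_value_estimate R (fun s => g s 0 k) (fun s => dg s 0 k) a b 0 e.
rewrite mul0r subr0 !mxE; apply => t /H[dgt le]; split.
  exact: is_derive_coord.
by rewrite subr0; apply: le_trans le; exact: coord_norm_le.
Qed.

(** Coincidence at points accumulating at [t] already determines the derivative. This covers curves
    known to agree on one side of [t] only, as happens at the ends of parameter intervals. *)
Lemma is_derive_agree (V : normedModType R) (c1 c2 : R -> V) (t : R) v1 v2 :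
  is_derive t 1 c1 v1 -> is_derive t 1 c2 v2 -> c1 t = c2 t ->
  (forall d : R, 0 < d -> exists h : R, [/\ h != 0, `|h| < d & c1 (h + t) = c2 (h + t)]) ->
  v1 = v2.
Proof.
move=> /is_derive_distP d1 /is_derive_distP d2 ct fr.
apply/eqP; rewrite -subr_eq0 -normr_eq0; apply/eqP/le_anti.
rewrite normr_ge0 andbT; apply/ler_addgt0Pl => e e0; rewrite addr0.
have e2 : 0 < e / 2 by lra.
have [a a0 aP] := d1 _ e2; have [b b0 bP] := d2 _ e2.
have [|h [h0 + ch]] := fr (Num.min a b); first by rewrite lt_min a0.
rewrite lt_min => /andP[ha hb].
have := aP _ ha; have := bP _ hb.
rewrite [h *: 1]mulr1 -ch -ct => h1 h2.
rewrite -(ler_pM2r (_ : 0 < `|h|)) ?normr_gt0//.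
rewrite mulrC -normrZ scalerBr -normrN.
set y := c1 (h + t) - c1 t in h1 h2.
have -> : - (h *: v1 - h *: v2) = (y - h *: v1) - (y - h *: v2).
  by rewrite opprB [in RHS]opprB [RHS]addrC addrA subrK.
apply: le_trans (ler_normB _ _) _; lra.
Qed.

Lemma is_derive_continuous (W : normedModType R) (c : R -> W) (t : R) v :
  is_derive t 1 c v -> {for t, continuous c}.
Proof.
by move=> [d _]; apply: differentiable_continuous; apply/derivable1_diffP.
Qed.
End RowCurves.

Section CenteredIntervals.
Context {R : realType}.
Implicit Types (r s t z : R).

Lemma mem_minmax_itv r s t z : s \in `[t - r, t + r] ->
  z \in `[Num.min t s, Num.max t s] -> z \in `[t - r, t + r].
Proof.
rewrite !in_itv/= => /andP[? ?].
by case: (leP t s) => ? /andP[? ?]; apply/andP; split; lra.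
Qed.

Lemma mem_centered_itv r s t : s \in `[t - r, t + r] <-> `|s - t| <= r.
Proof. by rewrite ler_norml in_itv/=; split=> /andP[? ?]; apply/andP; split; lra. Qed.
End CenteredIntervals.

(** A contraction argument on a short interval of radius [r]: if [m] is the maximum of [|v1 - v2|]
    there, one mean value estimate gives [|x1 - x2| <= m r] and a second one
    [m <= K (1 + r) r m <= m / 2], so [m = 0]. *)
Lemma second_order_uniqueness {R : realType} {m : nat}
    (x1 x2 v1 v2 a1 a2 : R -> 'rV[R]_m) (t e K : R) : 0 < e -> 0 <= K ->
  (forall s, `|s - t| < e ->
     [/\ is_derive s 1 x1 (v1 s), is_derive s 1 x2 (v2 s),
         is_derive s 1 v1 (a1 s), is_derive s 1 v2 (a2 s)
       & `|a1 s - a2 s| <= K * (`|x1 s - x2 s| + `|v1 s - v2 s|)]) ->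
  x1 t = x2 t -> v1 t = v2 t -> \forall s \near t, x1 s = x2 s.
Proof.
move=> e0 K0 eP xt vt.
have [r rE] : exists r : R,
    r = Num.min (e / 2) (Num.min 1 (1 / (2 * (2 * K + 1)))) by eexists.
have r0 : 0 < r.
  by rewrite rE !lt_min ltr01 /= !divr_gt0// mulr_gt0//; lra.
have re : r < e by rewrite rE gt_min; apply/orP; left; lra.
have rK : K * (1 + r) * r <= 2^-1.
  have r1 : r <= 1 by rewrite rE !ge_min lexx orbT.
  have rK' : r <= 1 / (2 * (2 * K + 1)) by rewrite rE !ge_min lexx !orbT.
  rewrite ler_pdivlMr in rK'; last by lra.
  by have := mulr_ge0 K0 (ltW r0); nra.
have inr s : s \in `[t - r, t + r] -> `|s - t| < e.
  by move=> /mem_centered_itv h; exact: le_lt_trans h re.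
pose f s := `|v1 s - v2 s|.
have fc : {within `[t - r, t + r], continuous f}.
  apply: continuous_in_subspaceT => s; rewrite inE => sr.
  have [_ _ /is_derive_continuous c1 /is_derive_continuous c2 _] := eP s (inr s sr).
  by apply: cvg_norm; apply: cvgB.
have [|s0 s0r fmax] := EVT_max _ fc; first lra.
have m0 : 0 <= f s0 := normr_ge0 _.
have xle s : s \in `[t - r, t + r] -> `|x1 s - x2 s| <= f s0 * r.
  move=> sr.
  have := @row_mean_value R _ (fun s => x1 s - x2 s)
    (fun s => v1 s - v2 s) t s (f s0) m0.
  rewrite xt subrr subr0 => H; apply: le_trans (H _) _.
    move=> z /(mem_minmax_itv sr) zr; have [? ? _ _ _] := eP z (inr z zr).
    by split; [exact: is_deriveB|exact: fmax].
  by apply: (ler_wpM2l m0); apply/mem_centered_itv.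
have fle s : s \in `[t - r, t + r] -> f s <= K * (f s0 * r + f s0) * r.
  move=> sr.
  have B0 : 0 <= K * (f s0 * r + f s0).
    exact: (mulr_ge0 K0 (addr_ge0 (mulr_ge0 m0 (ltW r0)) m0)).
  have := @row_mean_value R _ (fun s => v1 s - v2 s)
    (fun s => a1 s - a2 s) t s _ B0.
  rewrite vt subrr subr0 => H; apply: le_trans (H _) _.
    move=> z /(mem_minmax_itv sr) zr.
    have [_ _ ? ? le] := eP z (inr z zr).
    split; first exact: is_deriveB.
    apply: le_trans le _.
    by apply: (ler_wpM2l K0); apply: lerD; [exact: xle|exact: fmax].
  by apply: (ler_wpM2l B0); apply/mem_centered_itv.
have fs0 : f s0 = 0.
  apply/le_anti; rewrite m0 andbT; move: (fle _ s0r) m0 rK.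
  by move: (f s0) => m'; clear; nra.
apply/nbhs_distP; exists r => // s sr.
have srI : s \in `[t - r, t + r] by apply/mem_centered_itv/ltW.
have := xle s srI; rewrite fs0 mul0r normr_le0 subr_eq0 => /eqP; exact.
Qed.

(** * Geodesics and the exponential map *)

Section Geodesics.
Context {R : realType} {n : nat} {M : topologicalType} (X : spacetime R n M).
Implicit Types (i : chart X) (x v : 'rV[R]_n.+1) (c : R -> M) (t s : R).

Lemma chart_image_nbhs i p : dom i p -> nbhs (coord i p) (coord i @` dom i).
Proof.
by move=> dp; apply: open_nbhs_nbhs; split; [exact: coord_open|exists p].
Qed.

Lemma metric_unitmx i x : (coord i @` dom i) x -> metric i x \in unitmx.
Proof.
move=> /(@metric_lorentz _ _ _ X)[P uP PGP].
have : \det (@minkowski R n) != 0.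
  rewrite /minkowski det_diag; apply/prodf_neq0 => k _; rewrite mxE.
  by case: ifP => _; rewrite ?oppr_eq0 oner_neq0.
rewrite -PGP !det_mulmx unitmxE unitfE !mulf_eq0 !negb_or.
by move=> /andP[/andP[]].
Qed.

Lemma christoffel_lipschitz_near i x k a b : (coord i @` dom i) x ->
  lipschitz_near (fun y => christoffel i y k a b) x.
Proof.
move=> [p dp <-]; have nx := chart_image_nbhs dp.
have ml k' l' : lipschitz_near (fun y => metric i y k' l') (coord i p).
  by apply: smooth_lipschitz_near nx; exact: metric_smooth.
have mpl k' l' j : lipschitz_near (partial j (fun y => metric i y k' l')) (coord i p).
  apply: smooth_lipschitz_near nx; apply: smooth_on_partial.
  exact: metric_smooth.
apply: lipschitz_nearM; first exact: lipschitz_near_cst.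
apply: lipschitz_near_sum => l; apply: lipschitz_nearM.
  apply: lipschitz_near_invmx => //.
  by apply: filterS nx => y; exact: metric_unitmx.
apply: lipschitz_nearD; last exact: lipschitz_nearN.
exact: lipschitz_nearD.
Qed.

Definition acceleration i x v : 'rV[R]_n.+1 :=
  \row_k - \sum_a \sum_b christoffel i x k a b * v 0 a * v 0 b.

Lemma acceleration_lipschitz i x v : (coord i @` dom i) x ->
  exists K d : R, [/\ 0 <= K, 0 < d & forall x1 x2 v1 v2,
    `|x1 - x| < d -> `|x2 - x| < d -> `|v1 - v| < d -> `|v2 - v| < d ->
    `|acceleration i x1 v1 - acceleration i x2 v2|
      <= K * (`|x1 - x2| + `|v1 - v2|)].
Proof.
move=> dx; pose V := ('rV[R]_n.+1 * 'rV[R]_n.+1)%type.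
have f1 (y z : V) : `|y.1 - z.1| <= `|y - z| by rewrite prod_normE le_max lexx.
have f2 (y z : V) : `|y.2 - z.2| <= `|y - z|.
  by rewrite prod_normE le_max lexx orbT.
have vl a : lipschitz_near (fun p : V => p.2 0 a) (x, v).
  exists 1, 1; split => // y z _ _; rewrite mul1r.
  by apply: le_trans (f2 y z); have := coord_norm_le (y.2 - z.2) a; rewrite !mxE.
have al k : lipschitz_near (fun p : V => acceleration i p.1 p.2 0 k) (x, v).
  under eq_fun do rewrite mxE.
  apply: lipschitz_nearN; apply: lipschitz_near_sum => a.
  apply: lipschitz_near_sum => b; apply: lipschitz_nearM => //.
  apply: lipschitz_nearM => //.
  apply: (lipschitz_near_comp (f := fun y => christoffel i y k a b)) => //.
  exact: christoffel_lipschitz_near.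
pose K k := sval (cid (al k)); pose D k := sval (cid (svalP (cid (al k)))).
have KDP k : [/\ 0 <= K k, 0 < D k & forall y z : V,
    `|y - (x, v)| < D k -> `|z - (x, v)| < D k ->
    `|acceleration i y.1 y.2 0 k - acceleration i z.1 z.2 0 k| <= K k * `|y - z|]
  := svalP (cid (svalP (cid (al k)))).
have K0 k : 0 <= K k by case: (KDP k).
have [d d0 dP] : exists2 d : R, 0 < d & forall k (y z : V),
    `|y - (x, v)| < d -> `|z - (x, v)| < d ->
    `|acceleration i y.1 y.2 0 k - acceleration i z.1 z.2 0 k| <= K k * `|y - z|.
  exists (\big[Num.min/1]_k D k).
    elim/big_ind: _ => // [a b a0 b0|k _]; first by rewrite lt_min a0.
    by case: (KDP k).
  move=> k y z yd zd; have [_ _ dP] := KDP k.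
  have ld : \big[Num.min/1]_k D k <= D k by exact: bigmin_le_cond.
  by apply: dP; [exact: lt_le_trans yd _|exact: lt_le_trans zd _].
exists (\sum_k K k), d; split=> //; first exact: sumr_ge0.
move=> x1 x2 v1 v2 x1d x2d v1d v2d; apply: row_norm_le => [|k].
  by rewrite mulr_ge0// ?sumr_ge0// addr_ge0.
have := dP k (x1, v1) (x2, v2); rewrite !prod_normE /= !gt_max x1d x2d v1d v2d.
move=> /(_ isT isT); rewrite !mxE => /le_trans; apply.
apply: ler_pM => //.
  by rewrite (bigD1 k)//= lerDl sumr_ge0.
by rewrite ge_max; apply/andP; split; [rewrite lerDl|rewrite lerDr].
Qed.

Lemma geodesic_is_derive (J : set R) c t i : geodesic_on X J c -> J t ->
  dom i (c t) ->
  is_derive t 1 (fun s => coord i (c s)) (velocity i c t) /\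
  is_derive t 1 (velocity i c) (acceleration i (coord i (c t)) (velocity i c t)).
Proof.
move=> gc Jt di; have [_ /(_ i di)[dx dv ac]] := gc t Jt.
split; first by rewrite /velocity derive1E; exact: (derivableP dx).
by rewrite /acceleration -ac derive1E; exact: (derivableP dv).
Qed.

Lemma dom_near i c t : {for t, continuous c} -> dom i (c t) ->
  \forall s \near t, dom i (c s).
Proof.
move=> cc di; apply: cc; apply: open_nbhs_nbhs; split => //; exact: dom_open.
Qed.

Lemma geodesic_local_uniqueness (J : set R) c1 c2 t i : open J -> J t ->
  geodesic_on X J c1 -> geodesic_on X J c2 ->
  c1 t = c2 t -> dom i (c1 t) -> velocity i c1 t = velocity i c2 t ->
  \forall s \near t, c1 s = c2 s.
Proof.
move=> oJ Jt g1 g2 ct di vt.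
have di2 : dom i (c2 t) by rewrite -ct.
have [K [d [K0 d0 aP]]] := acceleration_lipschitz (velocity i c1 t)
  (ex_intro2 _ _ (c1 t) di erefl).
have [dx1 dv1] := geodesic_is_derive g1 Jt di.
have [dx2 dv2] := geodesic_is_derive g2 Jt di2.
have close (f : R -> 'rV[R]_n.+1) a : is_derive t 1 f a ->
    \forall s \near t, `|f s - f t| < d.
  move=> /is_derive_continuous /cvgrPdist_lt /(_ _ d0).
  by apply: filterS => s; rewrite distrC.
have /nbhs_distP[e e0 eP] : nbhs t (J `&` ([set s | dom i (c1 s)] `&`
    ([set s | dom i (c2 s)] `&`
    ([set s | `|coord i (c1 s) - coord i (c1 t)| < d] `&`
    ([set s | `|coord i (c2 s) - coord i (c1 t)| < d] `&`
    ([set s | `|velocity i c1 s - velocity i c1 t| < d] `&`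
     [set s | `|velocity i c2 s - velocity i c1 t| < d])))))).
  apply: filterI; first exact: open_nbhs_nbhs.
  apply: filterI; first by apply: dom_near => //; exact: (g1 t Jt).1.
  apply: filterI; first by apply: dom_near => //; exact: (g2 t Jt).1.
  apply: filterI; first exact: (close _ _ dx1).
  apply: filterI; first by rewrite ct; exact: (close _ _ dx2).
  apply: filterI; first exact: (close _ _ dv1).
  by rewrite vt; exact: (close _ _ dv2).
have H s : `|s - t| < e ->
    [/\ is_derive s 1 (fun s => coord i (c1 s)) (velocity i c1 s),
        is_derive s 1 (fun s => coord i (c2 s)) (velocity i c2 s),
        is_derive s 1 (velocity i c1)
          (acceleration i (coord i (c1 s)) (velocity i c1 s)),
        is_derive s 1 (velocity i c2)
          (acceleration i (coord i (c2 s)) (velocity i c2 s))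
      & `|acceleration i (coord i (c1 s)) (velocity i c1 s) -
          acceleration i (coord i (c2 s)) (velocity i c2 s)|
        <= K * (`|coord i (c1 s) - coord i (c2 s)| +
                `|velocity i c1 s - velocity i c2 s|)].
  move=> /eP[Js [d1s [d2s [xs1 [xs2 [vs1 vs2]]]]]].
  have [? ?] := geodesic_is_derive g1 Js d1s.
  have [? ?] := geodesic_is_derive g2 Js d2s.
  by split => //; exact: aP xs1 xs2 vs1 vs2.
have /nbhs_distP[r r0 xx] := second_order_uniqueness
  (x1 := fun s => coord i (c1 s)) (x2 := fun s => coord i (c2 s))
  (v1 := velocity i c1) (v2 := velocity i c2)
  (a1 := fun s => acceleration i (coord i (c1 s)) (velocity i c1 s))
  (a2 := fun s => acceleration i (coord i (c2 s)) (velocity i c2 s))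
  e0 K0 H (congr1 (coord i) ct) vt.
apply/nbhs_distP; exists (Num.min e r) => [|s]; first by rewrite lt_min e0.
rewrite lt_min => /andP[se sr].
have [_ [d1s [d2s _]]] := eP s se.
by rewrite -(coordK d1s) (xx _ sr) coordK.
Qed.
End Geodesics.

Section AffineReparametrisation.
Context {R : realType}.

Lemma is_derive_comp_affine (W : normedModType R) (y : R -> W) (b r s : R) v :
  is_derive (b + r * s) 1 y v -> is_derive s 1 (fun z => y (b + r * z)) (r *: v).
Proof.
move=> /is_derive_distP yv; apply/is_derive_distP => e e0.
have r1 : 0 < `|r| + 1 by have := normr_ge0 r; lra.
have e1 : 0 < e / (`|r| + 1) by rewrite divr_gt0.
have [d d0 dP] := yv _ e1.
exists (d / (`|r| + 1)) => [|h]; first by rewrite divr_gt0.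
rewrite ltr_pdivlMr// => hd.
have hh := normr_ge0 h; have hr := normr_ge0 r.
have := dP (r * h); rewrite normrM => H.
have rh : `|r| * `|h| < d by nra.
move: (H rh); rewrite [h *: 1]mulr1 [r * h *: 1]mulr1.
have -> : b + r * (h + s) = r * h + (b + r * s) by ring.
rewrite scalerA [h * r]mulrC => /le_trans; apply.
rewrite -mulrA ler_wpM2l ?(ltW e0)//.
rewrite mulrA -[leRHS]mul1r ler_wpM2r// mulrC ler_pdivrMr//; lra.
Qed.

Context {n : nat} {M : topologicalType} (X : spacetime R n M).
Implicit Types (i : chart X) (c : R -> M) (J : set R).

Lemma acceleration_scale i x (r : R) (v : 'rV[R]_n.+1) :
  acceleration i x (r *: v) = r *: (r *: acceleration i x v).
Proof.
apply/rowP => k; rewrite !mxE !mulrN; congr (- _).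
rewrite mulrA mulr_sumr; apply: eq_bigr => a _.
by rewrite mulr_sumr; apply: eq_bigr => b _; rewrite !mxE; ring.
Qed.

Lemma affine_continuous (b r : R) : continuous (fun s : R => b + r * s).
Proof.
by move=> s; apply: cvgD; [exact: cvg_cst|exact: mulrl_continuous].
Qed.

Lemma geodesic_affine J c (b r : R) : open J -> geodesic_on X J c ->
  geodesic_on X ((fun s => b + r * s) @^-1` J) (fun s => c (b + r * s)).
Proof.
move=> oJ gc s /= Js.
have cc : {for s, continuous (fun s => c (b + r * s))}.
  by apply: continuous_comp; [exact: affine_continuous|exact: (gc _ Js).1].
split=> // i di; pose a (z : R) := b + r * z.
have vE z : J (a z) -> dom i (c (a z)) ->
    is_derive z 1 (fun z => coord i (c (a z))) (r *: velocity i c (a z)).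
  move=> Jz dz; have [dx _] := geodesic_is_derive gc Jz dz.
  exact: (is_derive_comp_affine dx).
have velE z : J (a z) -> dom i (c (a z)) ->
    r *: velocity i c (a z) = velocity i (fun z => c (a z)) z.
  by move=> Jz dz; rewrite [in RHS]/velocity derive1E; have [_ ->] := vE z Jz dz.
have nearE : \forall z \near s,
    r *: velocity i c (a z) = velocity i (fun z => c (a z)) z.
  have h1 : \forall z \near s, J (a z).
    by apply: affine_continuous; apply: open_nbhs_nbhs.
  have h2 : \forall z \near s, dom i (c (a z)) by exact: dom_near.
  by apply: filterS2 h1 h2; exact: velE.
have [_ dv] := geodesic_is_derive gc Js di.
have dv' := is_deriveZ r (is_derive_comp_affine dv).
have {}dv' := near_eq_is_derive nearE dv'.
split.
- by have [] := vE s Js di.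
- by have [] := dv'.
- rewrite derive1E; have [_ ->] := dv'.
  by rewrite -acceleration_scale (velE s Js di).
Qed.

Lemma velocity_affine J c (b r s : R) i : geodesic_on X J c -> J (b + r * s) ->
  dom i (c (b + r * s)) ->
  velocity i (fun z => c (b + r * z)) s = r *: velocity i c (b + r * s).
Proof.
move=> gc Js di; have [dx _] := geodesic_is_derive gc Js di.
by rewrite [in LHS]/velocity derive1E; have [_ ->] := is_derive_comp_affine dx.
Qed.

(** Real induction along [[0, 1]]: uniqueness for the geodesic equation in a chart continues the
    coincidence to the right, and the Hausdorff property carries it to limits from the left. *)
Lemma geodesic_uniqueness p q1 q2 c1 c2 :
  geodesic_from_to X p q1 c1 -> geodesic_from_to X p q2 c2 ->
  velocity (chart_at X p) c1 0 = velocity (chart_at X p) c2 0 ->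
  forall s : R, 0 <= s <= 1 -> c1 s = c2 s.
Proof.
move=> [[J1 [oJ1 J1I g1]] c10 _] [[J2 [oJ2 J2I g2]] c20 _] v0.
have oJ : open (J1 `&` J2) by exact: openI.
have {}g1 : geodesic_on X (J1 `&` J2) c1 by move=> t [/g1].
have {}g2 : geodesic_on X (J1 `&` J2) c2 by move=> t [_ /g2].
have JI t : 0 <= t <= 1 -> (J1 `&` J2) t.
  by move=> t01; split; [apply: J1I|apply: J2I]; rewrite /= in_itv.
apply: real_induction; [exact: ler01|by rewrite c10 c20| |].
- move=> s /andP[s0 s1] IH.
  have Js : (J1 `&` J2) s by apply: JI; rewrite s0 ltW.
  have cs : c1 s = c2 s by apply: IH; rewrite s0 lexx.
  pose i := chart_at X (c1 s).
  have di : dom i (c1 s) by exact: dom_chart_at.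
  (* At 0 this is the hypothesis; at a later [s] it follows from the coincidence of the curves to
     the left of [s]. *)
  have vs : velocity i c1 s = velocity i c2 s.
    have [s00|sn0] := eqVneq s 0; first by rewrite /i s00 c10 v0.
    have [d1 _] := geodesic_is_derive g1 Js di.
    have di2 : dom i (c2 s) by rewrite -cs.
    have [d2 _] := geodesic_is_derive g2 Js di2.
    apply: (is_derive_agree d1 d2); first by rewrite cs.
    move=> d d0; exists (- Num.min (d / 2) s).
    have sp : 0 < s by rewrite lt_neqAle eq_sym sn0.
    have m0 : 0 < Num.min (d / 2) s by rewrite lt_min sp andbT; lra.
    have md : Num.min (d / 2) s <= d / 2 by rewrite ge_min lexx.
    have ms : Num.min (d / 2) s <= s by rewrite ge_min lexx orbT.
    rewrite oppr_eq0 gt_eqF// normrN gtr0_norm//; split => //; first lra.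
    by rewrite IH//; apply/andP; split; lra.
  have /nbhs_distP[e e0 eP] := geodesic_local_uniqueness oJ Js g1 g2 cs di vs.
  exists e => // r /andP[sr re] _; apply: eP.
  by rewrite gtr0_norm; lra.
- move=> s /andP[s0 s1] IH.
  have Js : (J1 `&` J2) s by apply: JI; rewrite s1 ltW.
  have h1 : c1 x @[x --> s^'-] --> c1 s.
    by apply: cvg_at_left_filter; exact: (g1 s Js).1.
  have h2 : c2 x @[x --> s^'-] --> c2 s.
    by apply: cvg_at_left_filter; exact: (g2 s Js).1.
  apply: (cvg_unique (manifold_hausdorff X) h1).
  apply: cvg_trans h2; apply: near_eq_cvg; near=> x.
  apply/esym/IH; apply/andP; split; near: x.
    by apply: nbhs_left_ge.
  exact: nbhs_left_lt.
Unshelve. all: by end_near. Qed.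
End AffineReparametrisation.

Section ExponentialMap.
Context {R : realType} {n : nat} {M : topologicalType} (X : spacetime R n M).

Section FixedPoint.
Variables (U : set M) (p : M) (V : set 'rV[R]_n.+1) (E : 'rV[R]_n.+1 -> M)
  (L : M -> 'rV[R]_n.+1).
Hypotheses (oV : open V) (V0 : V 0)
  (Eexp : forall v, V v -> exp_rel X p v (E v)) (EV : E @` V = U)
  (EK : forall v, V v -> L (E v) = v)
  (Lc : forall q, U q -> {for q, continuous L}).

(** The point is that [s *: w] does not leave [V], the initial velocity [w] being arbitrary at the
    outset. While it is in [V], uniqueness gives [E (s *: w) = c s]. At a limit parameter
    [L (c z) = z *: w] tends both to [s *: w] and to [L (c s)], which lies in [V] since the geodesic
    stays in [U]. *)
Lemma geodesic_is_exponential q c : geodesic_from_to X p q c ->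
  c @` `[0, 1] `<=` U -> forall s : R, 0 <= s <= 1 ->
  V (s *: velocity (chart_at X p) c 0) /\
  E (s *: velocity (chart_at X p) c 0) = c s.
Proof.
move=> gpq cU; have [[J [oJ JI gc]] c0 c1] := gpq.
set w := velocity _ c 0.
have JI' (s : R) : 0 <= s <= 1 -> J s by move=> ?; apply: JI; rewrite /= in_itv.
have Ec (s : R) : 0 <= s <= 1 -> V (s *: w) -> E (s *: w) = c s.
  move=> /andP[s0 s1] Vsw; have [c' [gc' c'0 c'1] vc'] := Eexp Vsw.
  have J0 : J (0 + s * 0) by apply: JI'; rewrite mulr0 addr0 lexx ler01.
  have g'' : geodesic_from_to X p (c s) (fun z => c (0 + s * z)).
    split; last 2 first.
    - by rewrite mulr0 addr0.
    - by rewrite add0r mulr1.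
    exists ((fun z => 0 + s * z) @^-1` J); split.
    - by move/continuousP: (@affine_continuous R 0 s); exact.
    - move=> z; rewrite /= in_itv/= => /andP[z0 z1].
      by apply: JI'; rewrite add0r mulr_ge0//= mulr_ile1.
    - exact: geodesic_affine.
  have -> : c s = c (0 + s * 1) by rewrite add0r mulr1.
  rewrite -c'1; apply: (geodesic_uniqueness (And3 gc' c'0 c'1) g'' _ (s := 1));
    last by rewrite ler01 lexx.
  rewrite vc' (velocity_affine gc J0); first by rewrite mulr0 addr0.
  by rewrite mulr0 addr0 c0; exact: dom_chart_at.
have Vs : forall s : R, 0 <= s <= 1 -> V (s *: w).
  apply: real_induction; [exact: ler01|by rewrite scale0r| |].
  - move=> s /andP[s0 s1] IH.
    have Vsw : V (s *: w) by apply: IH; rewrite s0 lexx.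
    have : \forall z \near s, V (z *: w).
      have := @scalel_continuous _ 'rV[R]_n.+1 w s; apply.
      exact: open_nbhs_nbhs.
    move=> /nbhs_distP[e e0 eP]; exists e => // r /andP[sr re] _; apply: eP.
    by rewrite gtr0_norm; lra.
  - move=> s /andP[s0 s1] IH.
    have s01 : 0 <= s <= 1 by rewrite s1 ltW.
    have Ucs : U (c s) by apply: cU; exists s => //=; rewrite in_itv.
    have [v Vv Evs] : (E @` V) (c s) by rewrite EV.
    have h1 : L (c z) @[z --> s^'-] --> L (c s).
      apply: cvg_at_left_filter; apply: continuous_comp.
        exact: (gc s (JI' s s01)).1.
      exact: Lc.
    have h2 : z *: w @[z --> s^'-] --> s *: w.
      by apply: cvg_at_left_filter; exact: scalel_continuous.
    have : L (c z) @[z --> s^'-] --> s *: w.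
      apply: cvg_trans h2; apply: near_eq_cvg; near=> z.
      have zs : 0 <= z < s.
        by apply/andP; split; near: z; [exact: nbhs_left_ge|exact: nbhs_left_lt].
      rewrite -Ec ?EK//; try exact: IH.
      by move: zs => /andP[-> /ltW /le_trans]; apply.
    by move=> /(cvg_unique (@norm_hausdorff _ _) h1) <-; rewrite -Evs EK.
by move=> s s01; split; [exact: Vs|apply: Ec => //; exact: Vs].
Unshelve. all: by end_near. Qed.

End FixedPoint.
End ExponentialMap.

Section TangentExpansion.
Context {R : realType} {n : nat} {M : topologicalType} (X : spacetime R n M).
Implicit Types (U : set M) (j : chart X) (c gam : R -> M).

Lemma chart_image_nbhsI j U p : open U -> U p -> dom j p ->
  nbhs (coord j p) (coord j @` (dom j `&` U)).
Proof.
move=> oU Up dp; have nx := chart_image_nbhs dp.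
have nU : nbhs (coord j p) (point j @^-1` U).
  apply: (point_continuous (nbhs_singleton nx)).
  by rewrite coordK//; exact: open_nbhs_nbhs.
apply: filterS2 nx nU => x [q dq <-] /=; rewrite coordK// => Uq.
by exists q.
Qed.

(** The constant geodesic used for comparison is [c] itself reparametrised with factor 0, so that it
    comes with the geodesic equation. *)
Lemma exponential0 p q : exp_rel X p 0 q -> q = p.
Proof.
move=> [c gc vc]; have [[J [oJ JI gJ]] c0 c1] := gc.
have J0 : J (0 + 0 * 0) by apply: JI; rewrite /= in_itv/= mulr0 addr0 lexx ler01.
have gk : geodesic_from_to X p p (fun z => c (0 + 0 * z)).
  split; try by rewrite mul0r addr0.
  exists ((fun z => 0 + 0 * z) @^-1` J); split; last exact: geodesic_affine.
  - by move/continuousP: (@affine_continuous R 0 0); exact.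
  - move=> z _ /=; rewrite mul0r addr0; apply: JI.
    by rewrite /= in_itv/= lexx ler01.
have H := geodesic_uniqueness gc gk _ (s := 1).
rewrite -c1 H ?mul0r ?addr0 ?ler01 ?lexx//.
rewrite (velocity_affine gJ J0) ?vc ?scale0r//.
by rewrite mulr0 addr0 c0; exact: dom_chart_at.
Qed.

(** If [w] is the initial velocity in the selected chart, then [q = E w] and the velocity in the
    chart [j] is the image of [w] under the differential of [coord j] composed with [E]. Strict
    differentiability at 0 bounds the error by a small multiple of [|w|], and the Lipschitz bound
    for the inverse [L] turns this into a small multiple of the coordinate displacement. *)
Lemma exponential_expansion U p j : convex_normal X U -> U p -> dom j p ->
  forall e : R, 0 < e -> exists2 d : R, 0 < d & forall q c,
    geodesic_from_to X p q c -> c @` `[0, 1] `<=` U -> dom j q ->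
    `|coord j q - coord j p| < d ->
    `|coord j q - coord j p - velocity j c 0| <= e * `|coord j q - coord j p|.
Proof.
move=> [oU /(_ p) nU] Up dp e e0.
have [V [E [L [[oV V0 _] Eexp [EV EK [Ec Lc]] Es Ls]]]] := nU Up.
have E0 : E 0 = p by apply: exponential0; exact: Eexp.
have L0 : L p = 0 by rewrite -E0 EK.
pose FE (v : 'rV[R]_n.+1) := coord j (E v); pose FL x := L (point j x).
have dFE : strictly_differentiable FE 0.
  apply: (smooth_strictly_differentiable (Es j)).
  apply: filterI; first exact: open_nbhs_nbhs.
  apply: Ec => //; rewrite E0; apply: open_nbhs_nbhs.
  by split => //; exact: dom_open.
have dFL : strictly_differentiable FL (coord j p).
  exact: (smooth_strictly_differentiable (Ls j) (chart_image_nbhsI oU Up dp)).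
have [K [r [K0 r0 FLK]]] := strictly_differentiable_lipschitz dFL.
have eK : 0 < e / K by rewrite divr_gt0.
have [s s0 FEs] := dFE _ eK.
exists (Num.min r (s / K)); first by rewrite lt_min r0 divr_gt0.
move=> q c gc cU dq; rewrite lt_min ltr_pdivlMr// => /andP[qr qs].
have expc := geodesic_is_exponential oV V0 Eexp EV EK Lc gc cU.
have [[J [oJ JI gJ]] c0 c1] := gc.
have dj0 : dom j (c 0) by rewrite c0.
have J0 : J 0 by apply: JI; rewrite /= in_itv/= lexx ler01.
have [dc _] := geodesic_is_derive gJ J0 dj0.
set w := velocity _ c 0 in expc.
have [Vw Ew] : V w /\ E w = q.
  by have := expc 1; rewrite scale1r c1; apply; rewrite lexx ler01.
have wK : `|w| <= K * `|coord j q - coord j p|.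
  have := FLK (coord j q) (coord j p) qr.
  rewrite subrr normr0 => /(_ r0).
  by rewrite /FL !coordK// L0 subr0 -Ew EK.
have -> : velocity j c 0 = w *m differential FE 0.
  have dw : is_derive (0 : R) 1 (fun z : R => z *: w) w.
    apply/is_derive_distP => e' e'0; exists 1 => // h _.
    rewrite scale0r subr0 addr0 [h *: 1]mulr1 subrr normr0.
    by rewrite mulr_ge0// ltW.
  have dF := is_derive_comp_strict dFE (scale0r w) dw.
  (* [c] is known to be [E (z *: w)] for [z] in [[0, 1]] only, so the derivatives at 0 are compared
     from the right. *)
  apply: (is_derive_agree dc dF).
    by rewrite /FE scale0r E0 c0.
  move=> d d0; exists (Num.min (d / 2) 1).
  have m0 : 0 < Num.min (d / 2) 1 by rewrite lt_min ltr01 andbT divr_gt0.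
  have m1 : Num.min (d / 2) 1 <= 1 by rewrite ge_min lexx orbT.
  have md : Num.min (d / 2) 1 < d.
    by rewrite gt_min; apply/orP; left; rewrite ltr_pdivrMr// ltr_pMr// ltr1n.
  rewrite gt_eqF// gtr0_norm//; split => //.
  by rewrite addr0 /FE (expc _ _).2// (ltW m0).
have ws : `|w| < s by apply: le_lt_trans wK _; rewrite mulrC.
have := FEs w 0; rewrite !subr0 normr0 => /(_ ws s0).
rewrite /FE Ew E0 => /le_trans; apply.
apply: le_trans (ler_wpM2l (ltW eK) wK) _.
by rewrite mulrA divfK// gt_eqF.
Qed.

(** The infinitesimal form of the definition: nearby displacements are, up to a relative error, cone
    vectors at [gam t], with the opposite sign in the past of [t]. [gam] itself may have no
    derivative at [t]; the cone vector [w] depends on [s]. *)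
Lemma directed_curve_expansion
    (P : chart X -> 'rV[R]_n.+1 -> 'rV[R]_n.+1 -> Prop) (I : set R) gam t j :
  directed_curve P I gam -> I t -> dom j (gam t) ->
  forall e : R, 0 < e -> exists2 d : R, 0 < d & forall s, I s -> s != t ->
    `|s - t| < d -> [/\ dom j (gam s), gam s <> gam t
    & exists2 w, P j (coord j (gam t)) w &
      `|coord j (gam s) - coord j (gam t) - (if t < s then w else - w)|
        <= e * `|coord j (gam s) - coord j (gam t)|].
Proof.
move=> [gc gloc] It dt e e0.
have [J [U [JI nJ cU [Ut JU] geo]]] := gloc t It.
have Jt : J t by exact: nbhs_singleton nJ It.
have [d d0 dP] := exponential_expansion cU Ut dt e0.
have gct : gam @ within I (nbhs t) --> gam t.
  by move/subspace_continuousP : gc; exact.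
have h1 : \forall s \near within I (nbhs t), dom j (gam s).
  by apply: gct; apply: open_nbhs_nbhs; split => //; exact: dom_open.
have h2 : \forall s \near within I (nbhs t),
    `|coord j (gam s) - coord j (gam t)| < d.
  have /cvgrPdist_lt /(_ _ d0) : coord j (gam s) @[s --> within I (nbhs t)]
      --> coord j (gam t).
    by apply: cvg_comp gct _; exact: coord_continuous.
  by apply: filterS => s; rewrite distrC.
have /nbhs_distP[r r0 rP] : nbhs t [set s | I s ->
    [/\ J s, dom j (gam s) & `|coord j (gam s) - coord j (gam t)| < d]].
  have h3 : within I (nbhs t) (J `&` ([set s | dom j (gam s)] `&`
      [set s | `|coord j (gam s) - coord j (gam t)| < d])).
    exact: filterI nJ (filterI h1 h2).
  by apply: filterS (h3 : nbhs t _) => s H Is; have [? []] := H Is.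
exists r => // s Is st sr; have [Js ds sd] := rP s sr Is.
have [ts|st'] := ltP t s.
  have [gne [c [gcc ccU cP]]] := geo t s Jt Js ts.
  split; [exact: ds|by move=> h; apply: gne|].
  exists (velocity j c 0); last exact: dP gcc ccU ds sd.
  have [_ c0 _] := gcc; rewrite -c0; apply: cP.
    by rewrite in_itv/= lexx ler01.
  by rewrite c0.
have {}st : s < t by rewrite lt_neqAle st.
have [gne [c [gcc ccU cP]]] := geo s t Js Jt st.
split => //; have [[J' [oJ' J'I gJ']] c0 c1] := gcc.
have J'1 : J' (1 + -1 * 0).
  by apply: J'I; rewrite /= in_itv/= mulr0 addr0 lexx ler01.
(* For [s < t] the connecting geodesic ends at [gam t]; it is reversed so that the expansion can
   still be taken at that point. *)
have grev : geodesic_from_to X (gam t) (gam s) (fun z => c (1 + -1 * z)).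
  split; last 2 first.
  - by rewrite mulr0 addr0.
  - by rewrite mulr1 subrr.
  exists ((fun z => 1 + -1 * z) @^-1` J'); split; last exact: geodesic_affine.
  - by move/continuousP: (@affine_continuous R 1 (-1)); exact.
  - move=> z; rewrite /= in_itv/= => /andP[z0 z1].
    by apply: J'I; rewrite /= in_itv/=; apply/andP; split; lra.
exists (velocity j c 1).
  rewrite -c1; apply: cP; first by rewrite in_itv/= lexx ler01.
  by rewrite c1.
have := dP _ _ grev _ ds sd.
have dj1 : dom j (c (1 + -1 * 0)) by rewrite mulr0 addr0 c1.
rewrite (velocity_affine gJ' J'1 dj1) mulr0 addr0 scaleN1r; apply.
move=> _ [z + <-]; rewrite /= in_itv/= => /andP[z0 z1]; apply: ccU.
by exists (1 + -1 * z) => //; rewrite /= in_itv/=; apply/andP; split; lra.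
Qed.
End TangentExpansion.

(** * Causal cones and calibrations *)

Section FormAlgebra.
Context {R : realType} {m : nat}.
Implicit Types (G : 'M[R]_m) (u v w : 'rV[R]_m) (r : R).

Lemma formE G v w : form G v w = \sum_k (v *m G) 0 k * w 0 k.
Proof. by rewrite /form mxE; apply: eq_bigr => k _; rewrite !mxE. Qed.

Lemma formDl G u v w : form G (u + v) w = form G u w + form G v w.
Proof. by rewrite /form !mulmxDl mxE. Qed.

Lemma formZl G r v w : form G (r *: v) w = r * form G v w.
Proof. by rewrite /form -!scalemxAl mxE. Qed.

Lemma formDr G u v w : form G w (u + v) = form G w u + form G w v.
Proof. by rewrite /form linearD /= mulmxDr mxE. Qed.

Lemma formZr G r v w : form G w (r *: v) = r * form G w v.
Proof. by rewrite /form linearZ /= -scalemxAr mxE. Qed.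

Lemma formNl G v w : form G (- v) w = - form G v w.
Proof. by rewrite -scaleN1r formZl mulN1r. Qed.

Lemma formNr G v w : form G w (- v) = - form G w v.
Proof. by rewrite -scaleN1r formZr mulN1r. Qed.

Lemma form0l G v : form G 0 v = 0.
Proof. by rewrite /form !mul0mx mxE. Qed.

Lemma form_sym G v w : G^T = G -> form G v w = form G w v.
Proof.
move=> Gt; rewrite /form -[in LHS](trmxK (v *m G *m w^T)) mxE.
by rewrite !trmx_mul trmxK Gt mulmxA.
Qed.

Lemma form_near (T : topologicalType) (z : T) (g : T -> 'M[R]_m)
    (a b : T -> 'rV[R]_m) :
  (forall k l, {for z, continuous (fun t => g t k l)}) ->
  (forall k, {for z, continuous (fun t => a t 0 k)}) ->
  (forall k, {for z, continuous (fun t => b t 0 k)}) ->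
  {for z, continuous (fun t => form (g t) (a t) (b t))}.
Proof.
move=> gc ac bc.
have E : (fun t => form (g t) (a t) (b t)) =
    fun t => \sum_k \sum_l (a t 0 l * g t l k) * b t 0 k.
  by apply/funext => t; rewrite formE; apply: eq_bigr => k _;
    rewrite mxE mulr_suml.
have sumc (r : seq 'I_m) (F : 'I_m -> T -> R) :
    (forall k, {for z, continuous (F k)}) ->
    {for z, continuous (fun t => \sum_(k <- r) F k t)}.
  move=> Fc; elim: r => [|k r IH].
    rewrite (_ : (fun t => _) = fun=> 0); first exact: cvg_cst.
    by apply/funext => t; rewrite big_nil.
  rewrite (_ : (fun t => _) = fun t => F k t + \sum_(l <- r) F l t).
    by apply: cvgD; [exact: Fc|exact: IH].
  by apply/funext => t; rewrite big_cons.
rewrite E; apply: (sumc) => k; apply: (sumc) => l.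
apply: cvgM; last exact: bc.
by apply: cvgM; [exact: ac|exact: gc].
Qed.

End FormAlgebra.

Section LorentzAlgebra.
Context {R : realType} {n : nat}.
Implicit Types (G : 'M[R]_n.+1) (t u v w : 'rV[R]_n.+1).

Lemma lorentz_symmetric G : lorentz_signature G -> G^T = G.
Proof.
move=> [P uP PGP]; have : (P *m G *m P^T)^T = P *m G *m P^T.
  by rewrite PGP /minkowski tr_diag_mx.
rewrite !trmx_mul trmxK mulmxA => /(mulIr (_ : P^T \is a GRing.unit)).
rewrite unitmx_tr => /(_ uP) /(mulrI (_ : P \is a GRing.unit)); exact.
Qed.

(* Nothing else about the signature is needed. *)
Lemma lorentz_time_form G : lorentz_signature G ->
  exists f : 'cV[R]_n.+1, forall w, (w *m f) 0 0 = 0 -> w != 0 ->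
    0 < form G w w.
Proof.
move=> [P uP PGP]; pose Q := invmx P; exists (col 0 Q) => w wf w0.
pose a := w *m Q.
have wE : w = a *m P by rewrite /a -mulmxA mulVmx ?mulmx1.
have a0 : a 0 0 = 0 by rewrite -wf !mxE; apply: eq_bigr => k _; rewrite mxE.
have -> : form G w w = \sum_k (if k == 0 then -1 else 1) * a 0 k ^+ 2.
  rewrite wE; transitivity (form (@minkowski R n) a a).
    by rewrite /form -PGP trmx_mul !mulmxA.
  rewrite formE; apply: eq_bigr => k _.
  by rewrite /minkowski mul_mx_diag !mxE mulrAC mulrC expr2 mulrA.
have [k ak] : exists k, a 0 k != 0.
  apply/existsP; apply: contraNT w0; rewrite negb_exists => /forallP a0'.
  rewrite wE (_ : a = 0) ?mul0mx//; apply/rowP => k.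
  by have /negPn/eqP := a0' k; rewrite !mxE.
have k0 : k != 0 by apply: contraNneq ak => ->; rewrite a0.
rewrite (bigD1 k)//= (negPf k0) mul1r ltr_wpDr// ?exprn_even_gt0//.
apply: sumr_ge0 => l _; have [->|_] := eqVneq l 0.
  by rewrite a0 expr0n mulr0.
by rewrite mul1r sqr_ge0.
Qed.

Section Signature.
Variable G : 'M[R]_n.+1.
Hypothesis LG : lorentz_signature G.

Lemma lorentz_combination (f : 'cV[R]_n.+1) u v :
  form G ((v *m f) 0 0 *: u - (u *m f) 0 0 *: v)
         ((v *m f) 0 0 *: u - (u *m f) 0 0 *: v) =
  (v *m f) 0 0 ^+ 2 * form G u u
  - 2 * (u *m f) 0 0 * (v *m f) 0 0 * form G u v
  + (u *m f) 0 0 ^+ 2 * form G v v.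
Proof.
rewrite formDl !formDr !formNl !formNr !formZl !formZr.
rewrite (form_sym v u (lorentz_symmetric LG)); ring.
Qed.

(** The combination [f(v) u - f(u) v] lies in the kernel of [f], where the form is positive
    definite. Both sign statements below are read off this quadratic inequality. *)
Lemma lorentz_combination_ge0 (f : 'cV[R]_n.+1) u v :
  (forall w, (w *m f) 0 0 = 0 -> w != 0 -> 0 < form G w w) ->
  0 <= (v *m f) 0 0 ^+ 2 * form G u u
  - 2 * (u *m f) 0 0 * (v *m f) 0 0 * form G u v
  + (u *m f) 0 0 ^+ 2 * form G v v.
Proof.
move=> fP; rewrite -lorentz_combination.
set w := _ - _; have [->|w0] := eqVneq w 0; first by rewrite form0l.
apply/ltW/fP => //; rewrite /w mulmxBl -!scalemxAl !mxE; ring.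
Qed.

(** Write [x], [y] for the values of [f] at [u], [v] and [a], [b], [c] for the products [uu], [uv],
    [vv]. Multiplying the inequality for the combination by [a < 0] and completing the square gives
    [(a y - b x)^2 <= x^2 (b^2 - a c)]. *)
Lemma reverse_cauchy_schwarz u v : form G u u < 0 ->
  form G u u * form G v v <= form G u v ^+ 2.
Proof.
move=> uu; have [f fP] := lorentz_time_form LG.
have := lorentz_combination_ge0 u v fP.
have : (u *m f) 0 0 != 0.
  apply/eqP => fu; have u0 : u != 0.
    by apply/eqP => u0; move: uu; rewrite u0 form0l ltxx.
  by have := fP u fu u0; lra.
move: ((u *m f) 0 0) ((v *m f) 0 0) (form G u u) (form G v v) (form G u v) uu.
move=> x y a c b a0 x0 h.
have x2 : 0 < x ^+ 2 by rewrite exprn_even_gt0.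
rewrite -(ler_pM2l x2); have := sqr_ge0 (a * y - b * x); nra.
Qed.

(** [f] does not vanish on causal vectors, and for two of them, one being timelike, the inequality
    makes the scalar product opposite in sign to the product of their values under [f]. Hence [u]
    and [v] both have the sign of [t] under [f]. *)
Lemma timelike_causal_sign t u v : form G t t < 0 -> form G t u < 0 ->
  form G u u < 0 -> v != 0 -> form G v v <= 0 -> form G t v <= 0 ->
  form G u v < 0.
Proof.
move=> tt tu uu v0 vv tv; have [f fP] := lorentz_time_form LG.
have nz w : w != 0 -> form G w w <= 0 -> (w *m f) 0 0 != 0.
  by move=> w0 ww; apply/eqP => fw; have := fP w fw w0; lra.
have t0 : t != 0 by apply/eqP => t0; move: tt; rewrite t0 form0l ltxx.
have u0 : u != 0 by apply/eqP => u0; move: uu; rewrite u0 form0l ltxx.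
have := lorentz_combination_ge0 t u fP.
have := lorentz_combination_ge0 t v fP.
have := lorentz_combination_ge0 u v fP.
have := nz t t0 (ltW tt); have := nz u u0 (ltW uu); have := nz v v0 vv.
move: ((t *m f) 0 0) ((u *m f) 0 0) ((v *m f) 0 0) => x y z z0 y0 x0.
move: (form G t t) (form G u u) (form G v v) (form G t u) (form G t v)
  (form G u v) tt uu vv tu tv => tt uu vv tu tv uv {}tt0 uu0 vv0 tu0 tv0.
have x2 : 0 < x ^+ 2 by rewrite exprn_even_gt0.
have y2 : 0 < y ^+ 2 by rewrite exprn_even_gt0.
have z2 : 0 < z ^+ 2 by rewrite exprn_even_gt0.
move=> h1 h2 h3.
have huv : y * z * uv < 0 by nra.
have htv : x * z * tv < 0 by nra.
have htu : x * y * tu < 0 by nra.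
have xz : 0 < x * z by rewrite ltNge; apply/negP => h; nra.
have xy : 0 < x * y by rewrite ltNge; apply/negP => h; nra.
have yz : 0 < y * z.
  have : 0 < (x * z) * (x * y) by rewrite mulr_gt0.
  have -> : (x * z) * (x * y) = x ^+ 2 * (y * z) by ring.
  by rewrite pmulr_rgt0.
by move: huv; rewrite pmulr_rlt0.
Qed.
End Signature.
End LorentzAlgebra.

Section CausalCones.
Context {R : realType} {n : nat} {M : topologicalType} (X : spacetime R n M).
Variables (i : chart X) (p : M).
Hypothesis dp : dom i p.
Notation x0 := (coord i p).
Implicit Types (x u v y : 'rV[R]_n.+1).

Lemma metric_entry_continuous k l : {for x0, continuous (fun x => metric i x k l)}.
Proof.
have sm : smooth_on (coord i @` dom i) (fun x => metric i x k l).
  exact: metric_smooth.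
by have [] := sm [::] x0 (nbhs_singleton (chart_image_nbhs dp)).
Qed.

Lemma metric_lorentz_at : lorentz_signature (metric i x0).
Proof. by apply: metric_lorentz; exists p. Qed.

Lemma unit_sphere_compact : compact [set v : 'rV[R]_n.+1 | `|v| = 1].
Proof.
apply: bounded_closed_compact.
  exists 1; split; first by rewrite num_real.
  by move=> r r1 v /= ->; exact: ltW.
apply: (@closed_comp _ _ (fun v : 'rV[R]_n.+1 => `|v|) [set 1]).
  by move=> v _; exact: norm_continuous.
exact: closed_eq.
Qed.

(** Compactness of the unit sphere, then homogeneity. The cones are those at all points [x] near
    [x0], while the form is frozen at [x0]. *)
Lemma causal_cone_coercive u : form (metric i x0) u u < 0 ->
  form (metric i x0) (time i x0) u < 0 ->
  exists2 c : R, 0 < c & forall x v, `|x - x0| < c ->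
    future_causal_vector i x v -> c * `|v| <= - form (metric i x0) u v.
Proof.
move=> uu tu; have LG := metric_lorentz_at.
have tt : form (metric i x0) (time i x0) (time i x0) < 0.
  by apply: time_timelike; exists p.
(* A single [r] is both the radius about [x0] and the lower bound, so that one compactness argument
   yields both. *)
pose P (r : R) v := forall x, `|x - x0| < r -> future_causal_vector i x v ->
  r <= - form (metric i x0) u v.
have ck k w : {for w, continuous (fun z : 'rV[R]_n.+1 => z 0 k)}.
  exact: matrix_normedtype.coord_continuous.
have cG k l : continuous_at x0 (fun x => metric i x k l).
  exact: metric_entry_continuous.
have [] := compact_near_coveringP [set v : 'rV[R]_n.+1 | `|v| = 1].
move=> /(_ unit_sphere_compact) H _.
have {H} : \forall r \near 0^'+, [set v : 'rV[R]_n.+1 | `|v| = 1] `<=` P r.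
  apply: H => v /= v1.
  have v0 : v != 0 by rewrite -normr_gt0 v1.
  suff [e e0 eP] : exists2 e : R, 0 < e & forall w r, `|w - v| < e ->
      0 < r -> r < e -> P r w.
    exists ([set w | `|w - v| < e], [set r | 0 < r < e]) => /=; last first.
      by move=> [w r] /= [wv /andP[r0 re]]; exact: eP.
    split; first by apply/nbhs_distP; exists e.
    near=> r; apply/andP; split; near: r; first exact: nbhs_right_gt.
    exact: nbhs_right_lt.
  pose Z := ('rV[R]_n.+1 * 'rV[R]_n.+1)%type.
  have f1 : {for ((x0, v) : Z), continuous (fst : Z -> 'rV[R]_n.+1)}.
    exact: cvg_fst.
  have f2 : {for ((x0, v) : Z), continuous (snd : Z -> 'rV[R]_n.+1)}.
    exact: cvg_snd.
  have f2k k : {for ((x0, v) : Z), continuous (fun z : Z => z.2 0 k)}.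
    exact: (continuous_comp f2 (ck k _)).
  have open_cond (a : 'rV[R]_n.+1 -> 'rV[R]_n.+1 -> 'rV[R]_n.+1) :
      (forall k, {for ((x0, v) : Z), continuous (fun z : Z => a z.1 z.2 0 k)}) ->
      0 < form (metric i x0) (a x0 v) v ->
      exists2 e : R, 0 < e & forall x w, `|x - x0| < e -> `|w - v| < e ->
        0 < form (metric i x) (a x w) w.
    move=> ac av.
    have /cvgrPdist_lt /(_ _ av) : {for ((x0, v) : Z), continuous
        (fun z : Z => form (metric i z.1) (a z.1 z.2) z.2)}.
      apply: form_near => [k l||k]; [|exact: ac|].
        exact: (continuous_comp f1 (cG k l)).
      exact: f2k.
    move=> /nbhs_distP[e e0 eP]; exists e => // x w xe we.
    have := eP (x, w); rewrite prod_normE /= gt_max xe we => /(_ isT).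
    by rewrite ltr_norml => /andP[_]; lra.
  (* A unit vector that is spacelike or points to the past at [x0] remains so for nearby points and
     vectors, making [P] vacuous; for the remaining ones the product with [u] is negative and stays
     away from 0. *)
  have [vv|vv] := ltP 0 (form (metric i x0) v v).
    have [|e e0 eP] := open_cond (fun _ w => w) _ vv.
      exact: f2k.
    exists e => // w r wv r0 re x xr [_ + _].
    by rewrite leNgt eP//; exact: lt_trans re.
  have [tv|tv] := ltP 0 (form (metric i x0) (time i x0) v).
    have [|e e0 eP] := open_cond (fun x _ => time i x) _ tv.
      move=> k.
      have tc : {for x0, continuous (time i)}.
        by apply: time_continuous; exists p.
      have tkc : {for x0, continuous (fun x => time i x 0 k)}.
        exact: (continuous_comp tc (ck k _)).
      exact: (continuous_comp f1 tkc).
    exists e => // w r wv r0 re x xr [_ _].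
    by rewrite ltNge ltW// eP//; exact: lt_trans re.
  have uv : form (metric i x0) u v < 0.
    exact: (timelike_causal_sign LG tt tu uu v0 vv tv).
  pose c := - form (metric i x0) u v / 2.
  have c0 : 0 < c by rewrite /c; lra.
  have /cvgrPdist_lt /(_ _ c0) /nbhs_distP[e e0 eP] :
      {for v, continuous (fun w => form (metric i x0) u w)}.
    apply: (@form_near _ _ _ v (fun=> metric i x0) (fun=> u) id) => [k l|k|k].
    - exact: cst_continuous.
    - exact: cst_continuous.
    exact: ck.
  exists (Num.min e c) => [|w r]; first by rewrite lt_min e0.
  rewrite !lt_min => /andP[/eP we wc] r0 /andP[re rc] x _ _.
  move: we rc; rewrite /c ltr_norml.
  move: (form _ u v) (form _ u w) => A B /andP[AB _] rA; clear -AB rA; lra.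
move=> [e /= e0 eP].
have e20 : 0 < e / 2 by rewrite divr_gt0.
have Pe : [set v : 'rV[R]_n.+1 | `|v| = 1] `<=` P (e / 2).
  apply: eP => //=; rewrite sub0r normrN gtr0_norm//.
  by rewrite ltr_pdivrMr// ltr_pMr// ltr1n.
exists (e / 2) => // x v xe vx; have [v0 vv tv] := vx.
have nv : 0 < `|v| by rewrite normr_gt0.
have nv1 : `| `|v|^-1 *: v| = 1.
  by rewrite normrZ gtr0_norm ?invr_gt0// mulVf// gt_eqF.
have := Pe _ nv1 x xe; rewrite formZr -mulrN -(ler_pM2l nv) mulVKf ?gt_eqF//.
rewrite [`|v| * _]mulrC; apply; split.
- by rewrite scaler_eq0 invr_eq0 gt_eqF.
- by rewrite formZl formZr !mulr_ge0_le0// invr_ge0 ltW.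
- by rewrite formZr pmulr_rlt0// invr_gt0.
Unshelve. all: by end_near. Qed.
End CausalCones.

Section Calibration.
Context {R : realType} {n : nat} {M : topologicalType} (X : spacetime R n M).
Variables (i : chart X) (p : M).
Hypothesis dp : dom i p.
Notation x0 := (coord i p).
Notation G0 := (metric i x0).
Implicit Types (x u v y : 'rV[R]_n.+1).

Lemma form_delta (G : 'M[R]_n.+1) u k : form G u (delta_mx 0 k) = (u *m G) 0 k.
Proof.
rewrite formE (bigD1 k)//= big1 => [|l lk]; first by rewrite !mxE !eqxx mulr1 addr0.
by rewrite [delta_mx _ _ _ _]mxE (negPf lk) andbF mulr0.
Qed.

Lemma metric_form_continuous u v :
  {for x0, continuous (fun x => form (metric i x) u v)}.
Proof.
apply: (@form_near _ _ _ x0 (metric i) (fun=> u) (fun=> v)) => [k l|k|k].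
- exact: metric_entry_continuous.
- exact: cst_continuous.
- exact: cst_continuous.
Qed.

Lemma metric_form_uniform u (r : R) : 0 < r -> exists2 d : R, 0 < d &
  forall x y, `|x - x0| < d ->
    `|form (metric i x) u y - form G0 u y| <= r * `|y|.
Proof.
move=> r0; pose s := r / n.+1%:R.
have s0 : 0 < s by rewrite divr_gt0.
have : \forall x \near x0, forall k, `|(u *m metric i x) 0 k - (u *m G0) 0 k| <= s.
  apply: (filter_forall (nbhs_filter x0)) => k.
  have /cvgrPdist_le /(_ _ s0) := @metric_form_continuous u (delta_mx 0 k).
  by apply: filterS => x; rewrite !form_delta distrC.
move=> /nbhs_distP[d d0 dP]; exists d => // x y /dP xP.
rewrite !formE -sumrB; apply: le_trans (ler_norm_sum _ _ _) _.
apply: (@le_trans _ _ (\sum_(k < n.+1) s * `|y|)).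
  apply: ler_sum => k _; rewrite -mulrBl normrM; apply: ler_pM => //.
  exact: coord_norm_le.
by rewrite sumr_const card_ord -mulr_natl mulrA /s [n.+1%:R * _]mulrC divfK.
Qed.

(** Reverse Cauchy-Schwarz is applied with the metric at [x]. Replacing that metric by [G0] in the
    products [uy] and [uu] costs a factor [q] each in the squared inequality, hence the factor [q]
    in front. *)
Lemma timelike_calibration u (q : R) : form G0 u u < 0 ->
  form G0 (time i x0) u < 0 -> 1 < q -> exists2 d : R, 0 < d &
  forall x y, `|x - x0| < d -> future_causal_vector i x y ->
    Num.sqrt (- form (metric i x) y y) <=
    q * (- form G0 u y) / Num.sqrt (- form G0 u u).
Proof.
move=> uu tu q1; have [c c0 cP] := causal_cone_coercive dp uu tu.
pose a := - form G0 u u; have a0 : 0 < a by rewrite /a oppr_gt0.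
(* Since [k <= 1], [(1 + k)^2 <= 1 + 3 k <= q]. *)
pose k := Num.min 1 ((q - 1) / 3).
have k0 : 0 < k by rewrite lt_min ltr01 divr_gt0// subr_gt0.
have kq : (1 + k) ^+ 2 <= q.
  have k1 : k <= 1 by rewrite ge_min lexx.
  have : k <= (q - 1) / 3 by rewrite ge_min lexx orbT.
  by clearbody k; nra.
(* Tolerance [c * k]: by coercivity the error [c k |y|] is at most [k] times [- form G0 u y], so the
   change of metric becomes a relative one. *)
have [d1 d10 d1P] := metric_form_uniform u (mulr_gt0 c0 k0).
have aq : 0 < a - a / q by rewrite subr_gt0 ltr_pdivrMr ?ltr_pMr//; lra.
have /cvgrPdist_lt /(_ _ aq) /nbhs_distP[d2 d20 d2P] := @metric_form_continuous u u.
have /nbhs_distP[d3 d30 d3P] := chart_image_nbhs dp.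
exists (Num.min (Num.min c d1) (Num.min d2 d3)).
  by rewrite !lt_min c0 d10 d20 d30.
move=> x y; rewrite !lt_min => /andP[/andP[xc x1] /andP[x2 x3]] fy.
have LG : lorentz_signature (metric i x).
  by apply: metric_lorentz; exact: d3P.
have := d2P x x2; rewrite ltr_norml => /andP[auu _].
have h := cP _ _ xc fy; have h1 := d1P x y x1.
have ax : a / q <= - form (metric i x) u u.
  by move: auu; rewrite /a; set A := form G0 u u; set B := form _ u u;
     move=> auu; lra.
have aq0 : 0 < a / q by rewrite divr_gt0//; lra.
have xuu : form (metric i x) u u < 0 by move: ax aq0; lra.
have rcs := reverse_cauchy_schwarz LG y xuu.
have A0 : 0 <= - form G0 u y.
  by apply: le_trans h; rewrite mulr_ge0// ltW.
have bound : `|form (metric i x) u y| <= (1 + k) * (- form G0 u y).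
  have : `|form G0 u y| = - form G0 u y by rewrite ler0_norm// -oppr_ge0.
  have := ler_normD (form (metric i x) u y - form G0 u y) (form G0 u y).
  rewrite subrK => h2 h3; apply: le_trans h2 _.
  rewrite h3 mulrDl mul1r addrC lerD2l; apply: le_trans h1 _.
  by rewrite mulrAC mulrC; apply: ler_wpM2l => //; exact: ltW.
have yy : - form (metric i x) y y * (a / q) <= q * (- form G0 u y) ^+ 2.
  have yx : 0 <= - form (metric i x) y y by have [_ + _] := fy; rewrite oppr_ge0.
  apply: (@le_trans _ _ (- form (metric i x) y y * - form (metric i x) u u)).
    exact: ler_wpM2l.
  rewrite mulrNN mulrC; apply: le_trans rcs _.
  rewrite -real_normK ?num_real//.
  apply: (@le_trans _ _ (((1 + k) * - form G0 u y) ^+ 2)).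
    by rewrite ler_sqr ?nnegrE// mulr_ge0// addr_ge0// ltW.
  by rewrite exprMn ler_wpM2r// sqr_ge0.
have sa0 : 0 < Num.sqrt a by rewrite sqrtr_gt0.
have q0 : 0 < q by lra.
rewrite -[leRHS]ger0_norm; last by rewrite divr_ge0 ?mulr_ge0 ?sqrtr_ge0// ltW.
rewrite -sqrtr_sqr ler_wsqrtr// expr_div_n sqr_sqrtr ?(ltW a0)//.
rewrite ler_pdivlMr//.
have <- : - form (metric i x) y y * (a / q) * q = - form (metric i x) y y * a.
  by rewrite -mulrA divfK// gt_eqF.
by apply: le_trans (ler_wpM2r (ltW q0) yy) _; rewrite exprMn (expr2 q) mulrAC.
Qed.

(* Reverse Cauchy-Schwarz: for [w] timelike in the closed cone, [- form G0 w]
   divided by the norm of [w] dominates the norm on causal vectors, with equality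
   along [w]. Here [w] is a timelike perturbation of [v], and a factor slightly
   above 1 absorbs a small change of the metric. *)
Lemma calibration v (e : R) : form G0 v v <= 0 -> form G0 (time i x0) v <= 0 ->
  0 < e -> exists u, exists2 d : R, 0 < d &
  (forall x y, `|x - x0| < d -> future_causal_vector i x y ->
    Num.sqrt (- form (metric i x) y y) <= form G0 u y) /\
  `|form G0 u v| <= Num.sqrt (- form G0 v v) + e.
Proof.
move=> vv tv e0; pose T := time i x0.
have tt : form G0 T T < 0 by apply: time_timelike; exists p.
have symG := lorentz_symmetric (metric_lorentz_at dp).
pose A := - form G0 v v; pose B := - form G0 T v; pose D := - form G0 T T.
have A0 : 0 <= A by rewrite oppr_ge0.
have B0 : 0 <= B by rewrite oppr_ge0.
have D0 : 0 < D by rewrite oppr_gt0.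
(* [s] and [r] are chosen so that [(1 + 3 s) (A + r B) <= A + e^2]: the term [3 s A] is at most
   [e^2 / 2], and so is [4 r B], which bounds the rest because [s <= 1]. *)
pose s := Num.min 1 (e ^+ 2 / (6 * (A + 1))).
have e2 : 0 < e ^+ 2 by rewrite exprn_gt0.
have s0 : 0 < s by rewrite lt_min ltr01 divr_gt0// mulr_gt0//; lra.
pose r := e ^+ 2 / (8 * (B + 1)).
have r0 : 0 < r by rewrite divr_gt0// mulr_gt0//; lra.
pose u := v + r *: T.
have uuE : - form G0 u u = A + 2 * r * B + r ^+ 2 * D.
  rewrite /u formDl !formDr !formZl !formZr (form_sym v T symG) /A /B /D; ring.
have tuE : - form G0 T u = B + r * D by rewrite /u formDr formZr /B /D; ring.
have uvE : - form G0 u v = A + r * B by rewrite /u formDl formZl /A /B; ring.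
have uu : form G0 u u < 0.
  rewrite -oppr_gt0 uuE; have := mulr_ge0 (ltW r0) B0.
  have := mulr_gt0 (exprn_gt0 2 r0) D0; lra.
have tu : form G0 T u < 0.
  by rewrite -oppr_gt0 tuE; have := mulr_gt0 r0 D0; lra.
have q1 : 1 < 1 + s by lra.
have [d d0 dP] := timelike_calibration uu tu q1.
pose N := Num.sqrt (- form G0 u u).
have N0 : 0 < N by rewrite sqrtr_gt0 oppr_gt0.
exists (- ((1 + s) / N) *: u), d => //; split=> [x y xd fy|].
  apply: le_trans (dP x y xd fy) _; rewrite formZl -/N.
  by rewrite mulNr mulrN mulNr mulrAC.
have -> : form G0 (- ((1 + s) / N) *: u) v = (1 + s) * (A + r * B) / N.
  by rewrite formZl -uvE; ring.
have C0 : 0 <= A + r * B by rewrite addr_ge0// mulr_ge0// ltW.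
rewrite ger0_norm; last by rewrite divr_ge0 ?mulr_ge0// ?ltW//; lra.
have CN : (A + r * B) / N <= Num.sqrt (A + r * B).
  rewrite ler_pdivrMr// -{1}(sqr_sqrtr C0) expr2 ler_wpM2l ?sqrtr_ge0//.
  rewrite ler_wsqrtr// uuE; have := mulr_ge0 (ltW r0) B0.
  by have := mulr_gt0 (exprn_gt0 2 r0) D0; lra.
rewrite -mulrA; apply: (@le_trans _ _ ((1 + s) * Num.sqrt (A + r * B))).
  by apply: ler_wpM2l => //; lra.
have sA : 0 <= Num.sqrt A := sqrtr_ge0 _.
rewrite -(@ler_sqr R) ?nnegrE; last 2 first.
- by rewrite mulr_ge0 ?sqrtr_ge0//; lra.
- by rewrite addr_ge0// ltW.
rewrite exprMn sqr_sqrtr// (sqrrD (Num.sqrt _)) sqr_sqrtr//.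
have sle1 : s <= 1 by rewrite ge_min lexx.
have sle : s * (6 * (A + 1)) <= e ^+ 2.
  by rewrite -ler_pdivlMr ?mulr_gt0//; [rewrite ge_min lexx orbT|lra].
have rE : r * (8 * (B + 1)) = e ^+ 2 by rewrite /r divfK// gt_eqF// mulr_gt0//; lra.
have : 0 <= Num.sqrt A * e *+ 2 by rewrite mulrn_wge0// mulr_ge0// ltW.
move: (_ *+ 2) => Z Z0.
have sB : 0 <= r * B by rewrite mulr_ge0// ltW.
have h1 : (1 + s) ^+ 2 <= 1 + 3 * s by nra.
have h2 : (1 + s) ^+ 2 * (A + r * B) <= (1 + 3 * s) * (A + r * B).
  exact: ler_wpM2r.
apply: le_trans h2 _.
have h3 : s * (r * B) <= r * B by rewrite ler_piMl.
rewrite -/A; have := ltW s0; have := ltW r0; lra.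
Qed.
End Calibration.

(** * Causal curves in charts *)

Section CausalCurvesInCharts.
Context {R : realType} {n : nat} {M : topologicalType} (X : spacetime R n M).

(** With [sg] equal to 1 or -1, one predicate serves both time orientations; only [sg] enters the
    estimates. *)
Definition oriented_causal (sg : R) (I : set R) (gam : R -> M) :=
  directed_curve (fun (i : chart X) x v => future_causal_vector i x (sg *: v))
    I gam.

Lemma causal_curve_oriented (I : set R) (gam : R -> M) : causal_curve X I gam ->
  exists2 sg : R, `|sg| = 1 & oriented_causal sg I gam.
Proof.
move=> [fut|past].
  exists 1; first exact: normr1.
  rewrite /oriented_causal; under eq_fun do under eq_fun do under eq_fun do
    rewrite scale1r.
  exact: fut.
exists (-1); first by rewrite normrN1.
rewrite /oriented_causal; under eq_fun do under eq_fun do under eq_fun do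
  rewrite scaleN1r.
exact: past.
Qed.

Lemma form_norm_bound {m} (G : 'M[R]_m) (u : 'rV[R]_m) :
  exists2 B : R, 0 < B & forall y, `|form G u y| <= B * `|y|.
Proof.
exists (1 + \sum_k `|(u *m G) 0 k|); first by rewrite ltr_pwDl// sumr_ge0.
move=> y; rewrite formE mulrDl mul1r -[leLHS]add0r; apply: lerD => //.
rewrite mulr_suml; apply: le_trans (ler_norm_sum _ _ _) _; apply: ler_sum => k _.
by rewrite normrM ler_wpM2l// coord_norm_le.
Qed.

Lemma form0r {m} (G : 'M[R]_m) (u : 'rV[R]_m) : form G u 0 = 0.
Proof. by rewrite /form linear0 mulmx0 mxE. Qed.

(** The covector dual to the time direction at [p] grows at least like a multiple of the coordinate
    displacement: to first order by coercivity of the cones, and then along the whole segment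
    because its increments add up while norms are subadditive. *)
Lemma causal_time_increase (i : chart X) (p : M) : dom i p ->
  exists c d : R, [/\ 0 < c, 0 < d & forall (sg : R) I gam r s, `|sg| = 1 ->
    oriented_causal sg I gam -> r <= s ->
    (forall z, r <= z <= s -> [/\ I z, dom i (gam z) &
       `|coord i (gam z) - coord i p| < d]) ->
    c * `|coord i (gam s) - coord i (gam r)| <=
    - form (metric i (coord i p)) (time i (coord i p))
        (sg *: (coord i (gam s) - coord i (gam r)))].
Proof.
move=> dp; set x0 := coord i p; set G0 := metric i x0; set T := time i x0.
have TT : form G0 T T < 0 by apply: time_timelike; exists p.
have [c c0 cP] := causal_cone_coercive dp TT TT.
have [B B0 BP] := form_norm_bound G0 T.
exists (c / 2), c; split=> // [|sg I gam r s sg1 gor rs inW]; first by rewrite divr_gt0.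
pose x z := coord i (gam z).
pose Q r s := c / 2 * `|x s - x r| <= - form G0 T (sg *: (x s - x r)).
suff : Q r s by [].
have Qtr a b e : Q a b -> Q b e -> Q a e.
  rewrite /Q => h1 h2.
  have -> : x e - x a = (x e - x b) + (x b - x a) by rewrite addrA subrK.
  rewrite scalerDr formDr opprD; apply: le_trans (lerD h2 h1).
  by rewrite -mulrDr ler_wpM2l ?ler_normD// divr_ge0// ltW.
apply: (local_to_global (Q := fun a b => Q a b)) => // [|a b e _ _ _ _]; last exact: Qtr.
move=> t tI; have [It dt xt] := inW t tI.
(* Replacing the displacement by a cone vector with relative error [e] costs at most
   [e (c + B) = c / 2], half of the coercivity constant. *)
pose e := c / (2 * (c + B)).
have e0 : 0 < e by rewrite divr_gt0// mulr_gt0// addr_gt0.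
have eE : e * (c + B) = c / 2 by rewrite /e; field; rewrite gt_eqF// addr_gt0.
have [d d0 dP] := directed_curve_expansion gor It dt e0.
have est y w : future_causal_vector i (x t) (sg *: w) -> `|y - w| <= e * `|y| ->
    c / 2 * `|y| <= - form G0 T (sg *: y).
  move=> fw yw; have := cP _ _ xt fw; rewrite normrZ sg1 mul1r.
  have := BP (sg *: (y - w)); rewrite normrZ sg1 mul1r.
  have wy : `|y| - e * `|y| <= `|w|.
    by have := ler_normD (y - w) w; rewrite subrK; move: yw; lra.
  have -> : form G0 T (sg *: y) =
      form G0 T (sg *: (y - w)) + form G0 T (sg *: w).
    by rewrite -formDr -scalerDr subrK.
  rewrite ler_norml.
  move: (form G0 T _) (form G0 T _) => f1 f2 /andP[_ h1] h2.
  have h3 : c * (`|y| - e * `|y|) <= c * `|w| by rewrite ler_wpM2l// ltW.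
  have h4 : B * `|y - w| <= B * (e * `|y|) by rewrite ler_wpM2l// ltW.
  have h5 : c / 2 * `|y| = e * (c + B) * `|y| by rewrite eE.
  lra.
exists d => //; split=> z.
  move=> /andP[tz zd] zs.
  have [<-|tz'] := eqVneq t z; first by rewrite /Q subrr scaler0 normr0 mulr0 form0r oppr0.
  have tz2 : t < z by rewrite lt_neqAle tz'.
  have Iz : I z.
    by move: tI => /andP[rt _]; have [] := inW z; rewrite ?zs ?(le_trans rt).
  have [||_ _ [w fw]] := dP z Iz _ _.
  - by rewrite eq_sym.
  - by rewrite gtr0_norm ?subr_gt0//; lra.
  by rewrite tz2; exact: est.
move=> /andP[zd zt] rz.
have [->|tz'] := eqVneq z t; first by rewrite /Q subrr scaler0 normr0 mulr0 form0r oppr0.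
have tz2 : z < t by rewrite lt_neqAle tz'.
have Iz : I z.
  by move: tI => /andP[_ ts]; have [] := inW z; rewrite ?rz ?(le_trans zt).
have [|_ _ [w fw]] := dP z Iz tz' _.
  by rewrite ltr0_norm ?subr_lt0//; lra.
rewrite ltNge zt /= opprK => h; apply: (est _ w) => //.
have <- : - (coord i (gam z) - coord i (gam t) + w) = x t - x z - w.
  by rewrite opprD opprB.
by rewrite normrN [in leRHS]distrC.
Qed.
End CausalCurvesInCharts.

(** * Time functions along causal curves *)

Section TimeFunctions.
Context {R : realType} {n : nat} {M : topologicalType} (X : spacetime R n M).
Implicit Types (sigma gam : R -> M) (T : R -> R).

Lemma chart_change_lipschitz (i j : chart X) (q : M) : dom i q -> dom j q ->
  exists K d : R, [/\ 0 < K, 0 < d & forall a b, dom i a -> dom i b ->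
    `|coord i a - coord i q| < d -> `|coord i b - coord i q| < d ->
    `|coord j a - coord j b| <= K * `|coord i a - coord i b|].
Proof.
move=> di dj.
have sd : strictly_differentiable (fun x => coord j (point i x)) (coord i q).
  apply: (smooth_strictly_differentiable _
    (chart_image_nbhsI (@dom_open _ _ _ X j) dj di)) => l.
  exact: transition_smooth.
have [K [d [K0 d0 KP]]] := strictly_differentiable_lipschitz sd.
exists K, d; split => // a b da db ad bd.
by have := KP _ _ ad bd; rewrite !coordK.
Qed.

(** Lipschitz with respect to [T] instead of the parameter: what remains to be done to get a
    Lipschitz curve is to use [T] as parameter. *)
Definition lipschitz_in_charts (u v : R) sigma T := forall t (i : chart X),
  t \in `[u, v] -> dom i (sigma t) ->
  exists e K : R, [/\ 0 < e, 0 <= K & forall t1 t2,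
    t1 \in `[u, v] -> t2 \in `[u, v] -> `|t1 - t| < e -> `|t2 - t| < e ->
    [/\ dom i (sigma t1), dom i (sigma t2) &
      `|coord i (sigma t1) - coord i (sigma t2)| <= K * `|T t1 - T t2|]].

Lemma within_continuous_near (I : set R) sigma t (A : set M) :
  {within I, continuous sigma} -> I t -> nbhs (sigma t) A ->
  exists2 e : R, 0 < e & forall s, I s -> `|s - t| < e -> A (sigma s).
Proof.
move=> /subspace_continuousP gc It nA.
have /nbhs_distP[e e0 eP] : nbhs t [set s | I s -> A (sigma s)] by exact: gc.
by exists e => // s Is se; exact: eP.
Qed.

Lemma coord_ball_nbhs (i : chart X) q (r : R) : dom i q -> 0 < r ->
  nbhs q [set a | dom i a /\ `|coord i a - coord i q| < r].
Proof.
move=> dq r0; apply: filterI; first exact: open_nbhs_nbhs (conj (dom_open i) dq).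
have /cvgrPdist_lt /(_ _ r0) := coord_continuous dq.
by apply: filterS => a; rewrite distrC.
Qed.

Definition continuous_nondecreasing T :=
  continuous T /\ {homo T : x y / x <= y}.

(** [T] is the time covector of the chart evaluated along the curve. Clamping the parameter to
    [[u, v]] makes it continuous and nondecreasing on the whole line, so that such functions can be
    added when segments are joined. *)
Lemma local_time_function sg (I : set R) gam (i : chart X) p : dom i p ->
  `|sg| = 1 -> oriented_causal X sg I gam ->
  exists2 d : R, 0 < d & forall u v, u <= v -> (forall z, u <= z <= v ->
      [/\ I z, dom i (gam z) & `|coord i (gam z) - coord i p| < d]) ->
    exists2 T, continuous_nondecreasing T & lipschitz_in_charts u v gam T.
Proof.
move=> dp sg1 gor; have [c [d [c0 d0 cP]]] := causal_time_increase dp.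
exists d => // u v uv inW.
set G0 := metric _ _ in cP; set tau := time _ _ in cP.
pose f z := - form G0 tau (sg *: coord i (gam z)).
pose cl z := Num.max u (Num.min z v).
have clI z : u <= cl z <= v.
  by rewrite /cl le_max lexx ge_max uv ge_min lexx orbT.
have clK z : u <= z <= v -> cl z = z.
  by move=> /andP[uz zv]; rewrite /cl (min_idPl zv) (max_idPr uz).
have clc : continuous cl.
  move=> z; apply/cvgrPdist_le => /= e e0; apply/nbhs_ballP; exists e => //= y ye.
  by apply: le_trans (clamp_lipschitz _ _ uv) _; exact: ltW.
have clh z1 z2 : z1 <= z2 -> cl z1 <= cl z2.
  by move=> z12; rewrite /cl ge_max !le_max lexx/= le_min !ge_min z12 lexx !orbT.
have fP r s : u <= r -> r <= s -> s <= v ->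
    c * `|coord i (gam s) - coord i (gam r)| <= f s - f r.
  move=> ur rs sv; have := cP sg I gam r s sg1 gor rs.
  have -> : f s - f r =
      - form G0 tau (sg *: (coord i (gam s) - coord i (gam r))).
    by rewrite /f scalerBr formDr formNr; ring.
  apply => z /andP[rz zs].
  by apply: inW; rewrite (le_trans ur) ?(le_trans zs).
have gcl z : {for z, continuous (gam \o cl)}.
  have [gc _] := gor; move: gc => /subspace_continuousP gc A nA /=.
  have [Iz _ _] := inW _ (clI z).
  have : nbhs (cl z) [set s | I s -> A (gam s)] by exact: gc.
  move=> /clc h.
  have h' : nbhs z [set s | I (cl s) -> A (gam (cl s))] by exact: h.
  have : nbhs z [set s | A (gam (cl s))].
    by apply: filterS h' => s; apply; have [] := inW _ (clI s).
  exact.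
exists (f \o cl).
  split => [z|z1 z2 z12] /=.
    have xc : {for z, continuous (fun s => coord i (gam (cl s)))}.
      apply: (continuous_comp (gcl z)); apply: coord_continuous.
      by have [] := inW _ (clI z).
    suff h : {for z, continuous
        (fun s => form G0 tau (sg *: coord i (gam (cl s))))} by exact: (cvgN h).
    apply: (@form_near _ _ _ z (fun=> G0) (fun=> tau)) => [k l|k|k].
    - exact: cst_continuous.
    - exact: cst_continuous.
    have -> : (fun s => (sg *: coord i (gam (cl s))) 0 k) =
        (fun s => sg * coord i (gam (cl s)) 0 k).
      by apply/funext => s; rewrite mxE.
    apply: cvgM; first exact: cvg_cst.
    exact: (continuous_comp xc (@matrix_normedtype.coord_continuous _ _ _ 0 k _)).
  rewrite -subr_ge0.
  have /andP[? _] := clI z1; have /andP[_ ?] := clI z2.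
  apply: le_trans (fP _ _ _ (clh _ _ z12) _) => //.
  by rewrite mulr_ge0// ltW.
move=> t j; rewrite in_itv /= => tuv dj; have [It dt xt] := inW t tuv.
have [K [r [K0 r0 KP]]] := chart_change_lipschitz dt dj.
have nt : nbhs (gam t) ([set q | dom i q /\ `|coord i q - coord i (gam t)| < r]
    `&` dom j).
  apply: filterI; first exact: coord_ball_nbhs.
  exact: open_nbhs_nbhs (conj (dom_open j) dj).
have [e e0 eP] := within_continuous_near gor.1 It nt.
exists e, (K / c); split => // [|t1 t2]; first by rewrite divr_ge0 ?ltW.
rewrite !in_itv/= => t1I t2I t1e t2e.
have [I1 _ _] := inW _ t1I; have [I2 _ _] := inW _ t2I.
have [[i1 x1] j1] := eP t1 I1 t1e; have [[i2 x2] j2] := eP t2 I2 t2e.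
split => //; apply: le_trans (KP _ _ i1 i2 x1 x2) _.
rewrite -mulrA ler_wpM2l ?(ltW K0)// ler_pdivlMl// !clK//.
wlog t12 : t1 t2 {t1e t2e I1 I2 i1 i2 x1 x2 j1 j2} t1I t2I / t2 <= t1.
  move=> H; case/orP: (le_total t2 t1) => h; first exact: H.
  by rewrite distrC [leRHS]distrC; exact: H.
apply: le_trans (ler_norm _); apply: fP => //.
  by move/andP: t2I => [].
by move/andP: t1I => [].
Qed.

(** For nondecreasing functions an increment of the sum dominates that of each summand, so adding
    replaces any splicing of [T1] and [T2] at [w]. *)
Lemma lipschitz_in_charts_glue u w v sigma T1 T2 : u <= w -> w <= v ->
  continuous_nondecreasing T1 -> continuous_nondecreasing T2 ->
  lipschitz_in_charts u w sigma T1 -> lipschitz_in_charts w v sigma T2 ->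
  lipschitz_in_charts u v sigma (fun z => T1 z + T2 z).
Proof.
move=> uw wv [_ T1n] [_ T2n] L1 L2 t i; rewrite in_itv/= => /andP[ut tv] dt.
have mono a b : `|T1 a - T1 b| <= `|(T1 a + T2 a) - (T1 b + T2 b)| /\
    `|T2 a - T2 b| <= `|(T1 a + T2 a) - (T1 b + T2 b)|.
  wlog ab : a b / b <= a.
    move=> H; case/orP: (le_total b a) => h; first exact: H.
    by rewrite (distrC (T1 a)) (distrC (T2 a)) (distrC (T1 a + T2 a)); exact: H.
  have h1 := T1n _ _ ab; have h2 := T2n _ _ ab.
  by split; apply: le_trans (ler_norm _); rewrite ger0_norm; lra.
have [tw|wt|tw] := ltgtP t w.
- have [|e [K [e0 K0 KP]]] := L1 t i _ dt; first by rewrite in_itv/= ut ltW.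
  exists (Num.min e (w - t)), K; split=> // [|t1 t2].
    by rewrite lt_min e0 subr_gt0.
  rewrite !in_itv/= !lt_min => /andP[u1 v1] /andP[u2 v2] /andP[e1 w1] /andP[e2 w2].
  have [||//|//|d1 d2 le] := KP t1 t2.
  + by rewrite in_itv/= u1/=; have := ler_norm (t1 - t); lra.
  + by rewrite in_itv/= u2/=; have := ler_norm (t2 - t); lra.
  split => //; apply: le_trans le _; apply: ler_wpM2l => //.
  by have [] := mono t1 t2.
- have [|e [K [e0 K0 KP]]] := L2 t i _ dt; first by rewrite in_itv/= tv ltW.
  exists (Num.min e (t - w)), K; split=> // [|t1 t2].
    by rewrite lt_min e0 subr_gt0.
  rewrite !in_itv/= !lt_min => /andP[u1 v1] /andP[u2 v2] /andP[e1 w1] /andP[e2 w2].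
  have [||//|//|d1 d2 le] := KP t1 t2.
  + by rewrite in_itv/= v1 andbT; have := ler_norm (-(t1 - t)); rewrite normrN; lra.
  + by rewrite in_itv/= v2 andbT; have := ler_norm (-(t2 - t)); rewrite normrN; lra.
  split => //; apply: le_trans le _; apply: ler_wpM2l => //.
  by have [] := mono t1 t2.
subst w; have uI : t \in `[u, t] by rewrite in_itv/= ut lexx.
have vI : t \in `[t, v] by rewrite in_itv/= tv lexx.
have [e1 [K1 [e10 K10 P1]]] := L1 t i uI dt.
have [e2 [K2 [e20 K20 P2]]] := L2 t i vI dt.
have tt e : 0 < e -> `|t - t| < e by rewrite subrr normr0.
have side s : s \in `[u, v] -> `|s - t| < Num.min e1 e2 ->
    dom i (sigma s) /\ `|coord i (sigma s) - coord i (sigma t)| <=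
      (K1 + K2) * `|T1 s + T2 s - (T1 t + T2 t)|.
  rewrite in_itv/= lt_min => /andP[us sv] /andP[s1 s2].
  have [m1 m2] := mono s t; case/orP: (le_total s t) => st.
    have [|d1 _ le] := P1 s t _ uI s1 (tt _ e10); first by rewrite in_itv/= us.
    split=> //; apply: le_trans le _; apply: ler_pM => //.
    by rewrite lerDl.
  have [|d1 _ le] := P2 s t _ vI s2 (tt _ e20); first by rewrite in_itv/= sv st.
  split=> //; apply: le_trans le _; apply: ler_pM => //.
  by rewrite lerDr.
exists (Num.min e1 e2), (K1 + K2); split=> [||t1 t2 t1I t2I e1' e2'].
- by rewrite lt_min e10.
- exact: addr_ge0.
have [d1 _] := side t1 t1I e1'; have [d2 _] := side t2 t2I e2'.
split => //.
wlog t12 : t1 t2 t1I t2I e1' e2' d1 d2 / t2 <= t1.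
  move=> H; case/orP: (le_total t2 t1) => h; first exact: H.
  by rewrite distrC [in leRHS]distrC; exact: H.
have [m1 m2] := mono t1 t2.
move: (e1') (e2'); rewrite !lt_min => /andP[h11 h12] /andP[h21 h22].
move: (t1I) (t2I); rewrite !in_itv/= => /andP[u1 v1] /andP[u2 v2].
have [t1t|tt1] := leP t1 t.
  have [||_ _ le] := P1 t1 t2 _ _ h11 h21; try by rewrite in_itv/= ?u1 ?u2 ?(le_trans t12).
  by apply: le_trans le _; apply: ler_pM => //; rewrite lerDl.
have [tt2|t2t] := leP t t2.
  have [||_ _ le] := P2 t1 t2 _ _ h12 h22; try by rewrite in_itv/= ?v1 ?v2 ?(ltW tt1) ?tt2.
  by apply: le_trans le _; apply: ler_pM => //; rewrite lerDr.
(* On opposite sides of the junction the triangle inequality passes through [t]; by monotonicity the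
   two increments of [T1 + T2] add up exactly. *)
have [_ le1] := side t1 t1I e1'; have [_ le2] := side t2 t2I e2'.
rewrite -(subrKA (coord i (sigma t))); apply: le_trans (ler_normD _ _) _.
rewrite [X in _ + X]distrC; apply: le_trans (lerD le1 le2) _.
rewrite -mulrDr ler_wpM2l ?addr_ge0//.
have h1 := T1n _ _ (ltW tt1); have h2 := T2n _ _ (ltW tt1).
have h3 := T1n _ _ (ltW t2t); have h4 := T2n _ _ (ltW t2t).
apply: le_trans (ler_norm _).
by rewrite [X in _ + X]distrC !ger0_norm; lra.
Qed.

Lemma time_function_exists (I : set R) gam u v : u <= v ->
  causal_curve X I gam -> (forall z, u <= z <= v -> I z) ->
  exists2 T, continuous_nondecreasing T & lipschitz_in_charts u v gam T.
Proof.
move=> uv /causal_curve_oriented[sg sg1 gor] uvI.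
apply: (local_to_global (Q := fun a b => exists2 T,
  continuous_nondecreasing T & lipschitz_in_charts a b gam T)) => //; last first.
  move=> a b c ua ab bc cv [T1 c1 l1] [T2 c2 l2].
  exists (fun z => T1 z + T2 z); last exact: lipschitz_in_charts_glue ab bc c1 c2 l1 l2.
  move: c1 c2 => [c1 n1] [c2 n2]; split; last by move=> x y xy; rewrite lerD ?n1 ?n2.
  by move=> z; apply: cvgD; [exact: c1|exact: c2].
move=> t tI; have It := uvI t tI.
have dt := dom_chart_at X (gam t); set i := chart_at X (gam t) in dt.
have [d d0 dP] := local_time_function dt sg1 gor.
have [e e0 eP] := within_continuous_near gor.1 It (coord_ball_nbhs dt d0).
exists e => //; split=> s.
  move=> /andP[ts se] sv; apply: dP => // z /andP[tz zs].
  have Iz : I z.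
    by apply: uvI; move: tI => /andP[ut _]; rewrite (le_trans ut) ?(le_trans zs).
  have [] := eP z Iz; last by split.
  by rewrite ger0_norm ?subr_ge0//; lra.
move=> /andP[es st] us; apply: dP => // z /andP[sz zt].
have Iz : I z.
  by apply: uvI; move: tI => /andP[_ tv]; rewrite (le_trans us) ?(le_trans zt).
have [] := eP z Iz; last by split.
by rewrite ler0_norm ?subr_le0//; lra.
Qed.
End TimeFunctions.

Lemma lipschitz_local_to_global {R : realType} (V : normedModType R) (x : R -> V)
    (u v : R) : u <= v ->
  (forall t, u <= t <= v -> exists e K : R, 0 < e /\
    forall z1 z2, z1 \in `[u, v] -> z2 \in `[u, v] ->
      `|z1 - t| < e -> `|z2 - t| < e -> `|x z1 - x z2| <= K * `|z1 - z2|) ->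
  exists2 K : R, 0 <= K & forall z1 z2, z1 \in `[u, v] -> z2 \in `[u, v] ->
    `|x z1 - x z2| <= K * `|z1 - z2|.
Proof.
move=> uv ll.
apply: (local_to_global (Q := fun a b => exists2 K : R, 0 <= K &
  forall z1 z2, z1 \in `[a, b] -> z2 \in `[a, b] ->
    `|x z1 - x z2| <= K * `|z1 - z2|)) => //; last first.
  move=> a b c ua ab bc cv [K K0 KP] [L L0 LP]; exists (K + L).
    exact: addr_ge0.
  move=> z1 z2; wlog z12 : z1 z2 / z1 <= z2.
    move=> H z1I z2I; case/orP: (le_total z1 z2) => h; first exact: H.
    by rewrite distrC [in leRHS]distrC; exact: H.
  rewrite !in_itv/= => /andP[a1 c1] /andP[a2 c2].
  have n0 : 0 <= `|z1 - z2| by [].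
  have [z2b|bz2] := leP z2 b.
    apply: le_trans (KP z1 z2 _ _) _; rewrite ?in_itv/= ?a1 ?a2 ?(le_trans z12)//.
    by rewrite ler_wpM2r// lerDl.
  have [bz1|z1b] := leP b z1.
    apply: le_trans (LP z1 z2 _ _) _; rewrite ?in_itv/= ?c1 ?c2 ?bz1 ?(ltW bz2)//.
    by rewrite ler_wpM2r// lerDr.
  have h1 : `|x z1 - x b| <= K * `|z1 - b|.
    by apply: KP; rewrite in_itv/= ?a1 ?ab ?(ltW z1b) ?lexx.
  have h2 : `|x b - x z2| <= L * `|b - z2|.
    by apply: LP; rewrite in_itv/= ?c2 ?bc ?(ltW bz2) ?lexx.
  rewrite -(subrKA (x b)); apply: le_trans (ler_normD _ _) _.
  apply: le_trans (lerD h1 h2) _; rewrite mulrDl.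
  apply: lerD; apply: ler_wpM2l => //.
    by rewrite !ler0_norm; lra.
  by rewrite !ler0_norm; lra.
move=> t tI; have [e [K [e0 KP]]] := ll t tI.
exists e => //; split=> s.
  move=> /andP[ts se] sv; exists `|K| => // z1 z2; rewrite !in_itv/=.
  move=> /andP[? ?] /andP[? ?]; have /andP[? ?] := tI.
  apply: le_trans (KP z1 z2 _ _ _ _) _; rewrite ?in_itv/=.
  - by apply/andP; split; lra.
  - by apply/andP; split; lra.
  - by rewrite ger0_norm; lra.
  - by rewrite ger0_norm; lra.
  by rewrite ler_wpM2r// ler_norm.
move=> /andP[es st] us; exists `|K| => // z1 z2; rewrite !in_itv/=.
move=> /andP[? ?] /andP[? ?]; have /andP[? ?] := tI.
apply: le_trans (KP z1 z2 _ _ _ _) _; rewrite ?in_itv/=.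
- by apply/andP; split; lra.
- by apply/andP; split; lra.
- by rewrite ler0_norm; lra.
- by rewrite ler0_norm; lra.
by rewrite ler_wpM2r// ler_norm.
Qed.

(** * Derivatives of causal curves and integration of calibrations *)

Section CausalDerivatives.
Context {R : realType} {n : nat} {M : topologicalType} (X : spacetime R n M).
Implicit Types (sigma : R -> M) (k : R -> R).

(** [speed] uses the chart selected at the point; the chain rule and the transition law of the
    metric give the same value in any chart containing the curve near [z]. *)
Lemma speed_in_chart (i : chart X) sigma z v : dom i (sigma z) ->
  (\forall s \near z, dom i (sigma s)) ->
  is_derive z 1 (fun s => coord i (sigma s)) v ->
  speed X sigma z = Num.sqrt (- form (metric i (coord i (sigma z))) v v).
Proof.
move=> di ni dv; rewrite /speed; set j := chart_at X (sigma z).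
have dj : dom j (sigma z) by exact: dom_chart_at.
pose F x := coord j (point i x).
have sd : strictly_differentiable F (coord i (sigma z)).
  apply: (smooth_strictly_differentiable _
    (chart_image_nbhsI (@dom_open _ _ _ X j) dj di)) => l.
  exact: transition_smooth.
have dF := is_derive_comp_strict sd erefl dv.
have {}dF : is_derive z 1 (fun s => coord j (sigma s))
    (v *m differential F (coord i (sigma z))).
  apply: near_eq_is_derive dF; apply: filterS ni => s ds.
  by rewrite /F coordK.
have -> : velocity j sigma z = v *m differential F (coord i (sigma z)).
  by rewrite /velocity derive1E; have [_ ->] := dF.
rewrite (metric_transition v v di dj).
by have [_ ->] := is_derive_strict sd v.
Qed.

Lemma lim_ge0 (V : normedModType R) (F : V -> R) v : {for v, continuous F} ->
  (forall e : R, 0 < e -> exists2 w, `|w - v| < e & 0 <= F w) -> 0 <= F v.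
Proof.
move=> Fc Fw; rewrite leNgt; apply/negP => Fv.
have Fv0 : 0 < - F v by rewrite oppr_gt0.
move/cvgrPdist_lt : Fc => /(_ _ Fv0) /nbhs_distP[e e0 eP].
have [w we Fw0] := Fw e e0.
by have := eP w we; rewrite ltr_norml => /andP[]; lra.
Qed.

Lemma reparametrisation_itv u v u' v' k : reparametrisation u v u' v' k ->
  forall z, u' <= z <= v' -> u <= k z <= v.
Proof.
move=> [uv' ku kv kc kh] z /andP[uz zv].
have ui : u' \in `[u', v'] by rewrite in_itv/= lexx.
have vi : v' \in `[u', v'] by rewrite in_itv/= lexx uv'.
have zi : z \in `[u', v'] by rewrite in_itv/= uz.
apply/andP; split.
  by move: uz; rewrite le_eqVlt => /predU1P[<-|uz]; [rewrite ku|rewrite -ku ltW// kh].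
by move: zv; rewrite le_eqVlt => /predU1P[->|zv]; [rewrite kv|rewrite -kv ltW// kh].
Qed.

(** Forward difference quotients are close both to the derivative and to causal vectors. The
    derivative itself may be 0, which is not a causal vector, so approximation by causal vectors is
    stated instead of membership in the cone. *)
Lemma causal_derivative_approx (i : chart X) sg (I : set R) sigma u v u' v' k z w :
  oriented_causal X sg I sigma -> (forall t, u <= t <= v -> I t) ->
  reparametrisation u v u' v' k -> u' <= z < v' -> dom i (sigma (k z)) ->
  is_derive z 1 (fun s => coord i (sigma (k s))) w ->
  forall e : R, 0 < e -> exists2 y, `|y - w| < e &
    future_causal_vector i (coord i (sigma (k z))) (sg *: y).
Proof.
move=> gor uvI rep /andP[uz zv] dz /is_derive_distP dw e e0.
have [uv' ku kv kc kh] := rep.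
have zI : u' <= z <= v' by rewrite uz ltW.
have Ikz := uvI _ (reparametrisation_itv rep zI).
have w1 : 0 < `|w| + 2 by have := normr_ge0 w; lra.
(* For an increment [h] the two errors add up to at most [r (|w| + 2) h <= e h / 2]. *)
pose r := Num.min 1 (e / (2 * (`|w| + 2))).
have r0 : 0 < r by rewrite lt_min ltr01 divr_gt0// mulr_gt0.
have [d d0 dP] := directed_curve_expansion gor Ikz dz r0.
have [b b0 bP] := dw r r0.
have zi : z \in `[u', v'] by rewrite in_itv/=.
have [c c0 cP] := within_continuous_near
  (sigma := k : R -> R) kc zi (nbhsx_ballx (k z) _ d0).
pose h := Num.min (Num.min (b / 2) (c / 2)) (v' - z).
have h0 : 0 < h by rewrite !lt_min !divr_gt0//= subr_gt0.
have hb : h < b.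
  by apply: le_lt_trans (_ : b / 2 < b); [rewrite /h !ge_min lexx|lra].
have hc : h < c.
  by apply: le_lt_trans (_ : c / 2 < c); [rewrite /h !ge_min lexx !orbT|lra].
have hv : h <= v' - z by rewrite /h ge_min lexx orbT.
have hn : `|h| = h by rewrite gtr0_norm.
have zhi : h + z \in `[u', v'] by rewrite in_itv/=; apply/andP; split; lra.
have kk : k z < k (h + z) by apply: kh => //; lra.
have Ikh : I (k (h + z)) by apply: uvI; apply: (reparametrisation_itv rep).
have kd : `|k (h + z) - k z| < d.
  by rewrite distrC; apply: (cP (h + z)) => //; rewrite addrK hn.
have [|_ _ [y fy yw]] := dP _ Ikh _ kd; first by rewrite gt_eqF.
rewrite kk in yw.
have := bP h; rewrite hn [h *: 1]mulr1 => /(_ hb).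
set D := coord i (sigma (k (h + z))) - coord i (sigma (k z)) in yw * => Dw.
exists (h^-1 *: y); last first.
  have [fy1 fy2 fy3] := fy; have hV : 0 < h^-1 by rewrite invr_gt0.
  rewrite scalerA mulrC -scalerA; split.
  - by rewrite scaler_eq0 gt_eqF.
  - by rewrite formZl formZr !pmulr_rle0.
  - by rewrite formZr pmulr_rlt0.
have -> : h^-1 *: y - w = h^-1 *: ((D - h *: w) - (D - y)).
  rewrite opprB [D - _ + _]addrC addrA subrK scalerBr scalerA mulVf ?gt_eqF//.
  by rewrite scale1r.
rewrite normrZ gtr0_norm ?invr_gt0// ltr_pdivrMl//.
apply: le_lt_trans (ler_normB _ _) _.
have Dh : `|D| <= (`|w| + 1) * h.
  have := ler_normD (D - h *: w) (h *: w); rewrite subrK normrZ hn.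
  have r1 : r * h <= 1 * h.
    by apply: ler_wpM2r; [exact: ltW|rewrite ge_min lexx].
  by move: Dw; lra.
have re : r * (2 * (`|w| + 2)) <= e.
  by rewrite -ler_pdivlMr ?mulr_gt0// ge_min lexx orbT.
have h1 : r * `|D| <= r * ((`|w| + 1) * h) by rewrite ler_wpM2l// ltW.
have h2 : h * (r * (2 * (`|w| + 2))) <= h * e by rewrite ler_wpM2l// ltW.
have h3 : 0 < h * (r * (`|w| + 2)) by rewrite !mulr_gt0.
by lra.
Qed.

Lemma locally_lipschitz_uniform (i : chart X) sigma u v : u <= v ->
  locally_lipschitz X u v sigma -> (forall z, u <= z <= v -> dom i (sigma z)) ->
  exists2 K : R, 0 <= K & forall z1 z2, z1 \in `[u, v] -> z2 \in `[u, v] ->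
    `|coord i (sigma z1) - coord i (sigma z2)| <= K * `|z1 - z2|.
Proof.
move=> uv ll dz; apply: (lipschitz_local_to_global uv) => t tI.
have tI' : t \in `[u, v] by rewrite in_itv.
have [e [K [e0 KP]]] := ll t i tI' (dz t tI).
by exists e, K; split=> // z1 z2 h1 h2 h3 h4; have [] := KP z1 z2 h1 h2 h3 h4.
Qed.
End CausalDerivatives.

Section AlmostEverywhere.
Context {R : realType}.
Local Notation mu := (@lebesgue_measure R).

Lemma ae_itv_oo_cc (p q : R) (P : R -> Prop) :
  {ae mu, forall z, z \in `]p, q[ -> P z} -> {ae mu, forall z, z \in `[p, q] -> P z}.
Proof.
move=> H.
have E : {ae mu, forall z, z != p /\ z != q}.
  exists [set p; q]; split.
  - exact: measurableU.
  - by apply: countable_lebesgue_measure0; exact: finite_set_countable.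
  move=> z /= h; apply: contrapT => /not_orP[/eqP zp /eqP zq]; exact: h.
apply: (@filterS2 _ _ (ae_filter_ringOfSetsType mu) _ _ _ _ H E).
move=> z Pz [zp zq]; rewrite in_itv/= => /andP[pz qz]; apply: Pz.
by rewrite in_itv/= !lt_neqAle eq_sym zp zq pz qz.
Qed.

Lemma lipschitz_row_ae_derivable {m} (y : R -> 'rV[R]_m) (K p q : R) : p < q ->
  (forall z1 z2, z1 \in `[p, q] -> z2 \in `[p, q] ->
    `|y z1 - y z2| <= K * `|z1 - z2|) ->
  {ae mu, forall z, z \in `]p, q[ -> derivable y z 1}.
Proof.
move=> pq yK.
have H : {ae mu, forall z, forall k, z \in `]p, q[ ->
    derivable (fun s => y s 0 k) z 1}.
  apply: (filter_forall (ae_filter_ringOfSetsType mu)) => k.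
  have [|g [_ dg _]] := @lipschitz_FTC R (fun s => y s 0 k) K p q pq.
    move=> z1 z2 h1 h2; apply: le_trans (yK _ _ h1 h2).
    by have := coord_norm_le (y z1 - y z2) k; rewrite !mxE.
  apply: (@filterS _ _ (ae_filter_ringOfSetsType mu) _ _ _ dg).
  by move=> z dz /dz [].
apply: (@filterS _ _ (ae_filter_ringOfSetsType mu) _ _ _ H).
by move=> z dz zpq; apply/derivable_mxP => a k; rewrite ord1; exact: dz.
Qed.

Lemma is_derive_form {m} (G : 'M[R]_m) (u : 'rV[R]_m) (sg : R) (y : R -> 'rV[R]_m)
    (z : R) (w : 'rV[R]_m) : is_derive z 1 y w ->
  is_derive z 1 (fun s => form G u (sg *: y s)) (form G u (sg *: w)).
Proof.
move=> /is_derive_distP dy; apply/is_derive_distP => e e0.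
have [B B0 BP] := form_norm_bound G u.
have C0 : 0 < B * (`|sg| + 1).
  by rewrite mulr_gt0//; have := normr_ge0 sg; lra.
have [d d0 dP] := dy (e / (B * (`|sg| + 1))) (divr_gt0 e0 C0).
exists d => // h /dP hP.
have -> : form G u (sg *: y (h *: 1 + z)) - form G u (sg *: y z) -
    h *: form G u (sg *: w) = form G u (sg *: (y (h *: 1 + z) - y z - h *: w)).
  rewrite !scalerBr !formDr !formNr !formZr; congr (_ - _).
  by rewrite /GRing.scale /=; ring.
apply: le_trans (BP _) _; rewrite normrZ.
apply: (@le_trans _ _ (B * (`|sg| + 1) * (e / (B * (`|sg| + 1)) * `|h|))).
  rewrite -mulrA ler_wpM2l ?(ltW B0)//; apply: ler_pM => //.
  by rewrite lerDl.
by rewrite mulrA mulrCA divff ?gt_eqF// mulr1.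
Qed.
Lemma calibration_gap_continuous {m} (G H : 'M[R]_m) (u w : 'rV[R]_m) (sg : R) :
  {for w, continuous (fun v : 'rV[R]_m =>
    form G u (sg *: v) - Num.sqrt (- form H v v))}.
Proof.
have h1 : {for w, continuous (fun v : 'rV[R]_m => form G u (sg *: v))}.
  apply: (@form_near _ _ _ w (fun=> G) (fun=> u)) => [a b|a|a].
  - exact: cst_continuous.
  - exact: cst_continuous.
  have -> : (fun t : 'rV[R]_m => (sg *: t) 0 a) = (fun t => sg * t 0 a).
    by apply/funext => t; rewrite mxE.
  have h : {for w, continuous (fun t : 'rV[R]_m => t 0 a)}.
    exact: matrix_normedtype.coord_continuous.
  exact: (cvgM (cvg_cst sg) h).
have h2 : {for w, continuous (fun v : 'rV[R]_m => form H v v)}.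
  apply: (@form_near _ _ _ w (fun=> H) id id) => [a b|a|a].
  - exact: cst_continuous.
  - exact: matrix_normedtype.coord_continuous.
  - exact: matrix_normedtype.coord_continuous.
have h3 : {for w, continuous (fun v : 'rV[R]_m => - form H v v)}.
  exact: (cvgN h2).
have h4 := continuous_comp h3 (@sqrt_continuous R _).
exact: (cvgB h1 h4).
Qed.
End AlmostEverywhere.

Section CalibratedLength.
Context {R : realType} {n : nat} {M : topologicalType} (X : spacetime R n M).
Local Notation mu := (@lebesgue_measure R).

(** Almost everywhere the derivative exists and is a limit of causal vectors, so the calibration
    inequality bounds the speed by the derivative of the form along the curve. Integrating that
    derivative leaves only the displacement between the endpoints. *)
Lemma calibrated_length (i : chart X) (x0 u : 'rV[R]_n.+1) (d : R)
    (sg : R) (I : set R) (sigma : R -> M) (r s p q : R) (k : R -> R) :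
  (forall x y, `|x - x0| < d -> future_causal_vector i x y ->
    Num.sqrt (- form (metric i x) y y) <= form (metric i x0) u y) ->
  `|sg| = 1 -> oriented_causal X sg I sigma ->
  (forall z, r <= z <= s -> [/\ I z, dom i (sigma z) &
    `|coord i (sigma z) - x0| < d]) ->
  reparametrisation r s p q k -> locally_lipschitz X p q (sigma \o k) ->
  (lipschitz_length X p q (sigma \o k) <=
    `|form (metric i x0) u (coord i (sigma s) - coord i (sigma r))|%:E)%E.
Proof.
move=> cal sg1 gor inW rep ll; have [pq kp kq kc kh] := rep.
have sg2 : sg * sg = 1 by rewrite -expr2 -real_normK ?num_real// sg1 expr1n.
have speed0 z : (0 <= (speed X (sigma \o k) z)%:E)%E by rewrite lee_fin sqrtr_ge0.
have kI z : p <= z <= q -> r <= k z <= s by exact: (reparametrisation_itv rep).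
have [pq'|pq'] := eqVneq p q.
  rewrite /lipschitz_length pq' set_itv1.
  apply: (@le_trans _ _ 0%E); last by rewrite lee_fin.
  have <- : (\int[mu]_(x in [set q]) (cst 0%E) x = 0)%E by exact: integral0.
  apply: ae_le_integral_nonmeasurable => //.
  exists [set q]; split => //; first exact: lebesgue_measure_set1.
  by move=> z /= /not_implyP[].
have {}pq' : p < q by rewrite lt_neqAle pq'.
pose y z := coord i (sigma (k z)).
have [K K0 yK] := locally_lipschitz_uniform pq ll
  (fun z zI => let: And3 _ dz _ := inW _ (kI z zI) in dz).
pose f z := form (metric i x0) u (sg *: y z).
have [B B0 BP] := form_norm_bound (metric i x0) u.
have [|g [ig dg gE]] := @lipschitz_FTC R f (B * K) p q pq'.
  move=> z1 z2 z1I z2I; rewrite /f.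
  have -> : form (metric i x0) u (sg *: y z1) - form (metric i x0) u (sg *: y z2) =
      form (metric i x0) u (sg *: (y z1 - y z2)).
    by rewrite scalerBr formDr formNr.
  apply: le_trans (BP _) _; rewrite normrZ sg1 mul1r -mulrA.
  by apply: (ler_wpM2l (ltW B0)); exact: yK.
have dy := lipschitz_row_ae_derivable pq' yK.
have key z : z \in `]p, q[ -> derivable y z 1 -> is_derive z 1 f (g z) ->
    speed X (sigma \o k) z <= g z.
  move=> zpq dyz dfz; have /andP[pz zq] : p < z < q by rewrite in_itv in zpq.
  have zI : p <= z <= q by rewrite !ltW.
  have [Iz dz xz] := inW _ (kI z zI).
  have dyz' : is_derive z 1 y ('D_1 y z) by exact: (derivableP dyz).
  set w := 'D_1 y z in dyz'.
  have -> : g z = form (metric i x0) u (sg *: w).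
    have [_ <-] := dfz.
    by have [_ ->] := is_derive_form (metric i x0) u sg dyz'.
  have nd : \forall s \near z, dom i ((sigma \o k) s).
    apply: filterS (near_in_itvoo zpq) => t; rewrite in_itv/= => /andP[pt tq].
    by have [] := inW (k t) (kI t _); rewrite ?(ltW pt) ?(ltW tq).
  rewrite (speed_in_chart dz nd dyz') /= -/(y z) -subr_ge0.
  apply: (lim_ge0 (F := fun v => form (metric i x0) u (sg *: v) -
    Num.sqrt (- form (metric i (y z)) v v))).
    exact: calibration_gap_continuous.
  move=> e e0.
  have zpq' : p <= z < q by rewrite ltW.
  have rsI t : r <= t <= s -> I t by move=> /inW[].
  have [v vw fv] := causal_derivative_approx gor rsI rep zpq' dz dyz' e0.
  exists v => //; rewrite subr_ge0.
  have := cal _ _ xz fv.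
  by rewrite formZl formZr mulrA sg2 mul1r.
have ae_le : {ae mu, forall z, z \in `[p, q] -> speed X (sigma \o k) z <= g z}.
  apply: ae_itv_oo_cc.
  apply: (@filterS2 _ _ (ae_filter_ringOfSetsType mu) _ _ _ _ dy dg).
  by move=> z dyz dgz zpq; apply: key => //; [exact: dyz|exact: dgz].
have mg : measurable_fun `[p, q] (EFin \o g) := measurable_int _ ig.
(* The comparison of integrals requires nonnegative functions everywhere, while [g] dominates the
   speed, and hence is nonnegative, only almost everywhere; [|g|] is used in between. *)
apply: (@le_trans _ _ (\int[mu]_(z in `[p, q]) (`|g z|)%:E)%E).
  apply: ae_le_integral_nonmeasurable => //.
  apply: (@filterS _ _ (ae_filter_ringOfSetsType mu) _ _ _ ae_le).
  move=> z zle /= zpq; rewrite lee_fin; apply: le_trans (ler_norm _).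
  exact: zle.
have -> : (\int[mu]_(z in `[p, q]) (`|g z|)%:E = \int[mu]_(z in `[p, q]) (g z)%:E)%E.
  apply: ae_eq_integral => //.
    by apply/measurable_EFinP; apply: measurableT_comp => //; exact/measurable_EFinP.
  apply: (@filterS _ _ (ae_filter_ringOfSetsType mu) _ _ _ ae_le).
  move=> z zle /= zpq; rewrite ger0_norm//.
  apply: le_trans (zle zpq); exact: sqrtr_ge0.
rewrite gE lee_fin /f /y kq kp.
have <- : form (metric i x0) u (sg *: (coord i (sigma s) - coord i (sigma r))) =
   form (metric i x0) u (sg *: coord i (sigma s)) -
   form (metric i x0) u (sg *: coord i (sigma r)).
  by rewrite scalerBr formDr formNr.
by apply: le_trans (ler_norm _) _; rewrite formZr normrM sg1 mul1r.
Qed.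
End CalibratedLength.

(** * Upper semicontinuity of length *)

Section EventualLength.
Context {R : realType}.
Local Notation mu := (@lebesgue_measure R).

Lemma is_derive_increment_le (f : R -> R) (s q c w : R) : s < q ->
  is_derive s 1 f w ->
  (exists2 d : R, 0 < d & forall t, s <= t -> t < s + d -> t <= q ->
    f t - f s <= c * (t - s)) -> w <= c.
Proof.
move=> sq /is_derive_distP df [d d0 dP].
rewrite leNgt; apply/negP => cw.
have e0 : 0 < (w - c) / 2 by rewrite divr_gt0// subr_gt0.
have [b b0 bP] := df _ e0.
pose h := Num.min (Num.min (d / 2) (b / 2)) (q - s).
have h0 : 0 < h by rewrite !lt_min !divr_gt0//= subr_gt0.
have hd : h <= d / 2 by rewrite /h !ge_min lexx.
have hb : h <= b / 2 by rewrite /h !ge_min lexx orbT.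
have hq : h <= q - s by rewrite /h ge_min lexx orbT.
have hn : `|h| = h by rewrite gtr0_norm.
have := bP h; rewrite hn => /(_ _); rewrite [h *: 1]mulr1 => hP.
have {}hP : `|f (h + s) - f s - h * w| <= (w - c) / 2 * h by apply: hP; lra.
have h1 : f (h + s) - f s <= c * (h + s - s) by apply: dP; lra.
move: hP; rewrite ler_norml => /andP[h2 _].
have : 0 < (w - c) * h by rewrite mulr_gt0// subr_gt0.
by lra.
Qed.

(* The upper limit of [B j p s] in [j] is Lipschitz and nondecreasing in [s], and
   its derivative is at most [N] almost everywhere. *)
Lemma eventual_length_le (p q : R) (B : nat -> R -> R -> \bar R) (N : R -> R) :
  p < q -> (forall s, 0 <= N s) ->
  (forall j s, (B j s s <= 0)%E) ->
  (forall j r s t, p <= r -> r <= s -> s <= t -> t <= q ->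
    (B j r s <= B j r t)%E /\ (B j r t <= B j r s + B j s t)%E) ->
  (forall s, p <= s <= q -> exists e K : R, [/\ 0 < e, 0 <= K &
    forall s1 s2, p <= s1 -> s1 <= s2 -> s2 <= q ->
      `|s1 - s| < e -> `|s2 - s| < e -> forall eta, 0 < eta ->
      \forall j \near \oo, (B j s1 s2 <= (K * (s2 - s1) + eta)%:E)%E]) ->
  {ae mu, forall s, s \in `]p, q[ -> forall eps, 0 < eps ->
    exists2 d : R, 0 < d & forall t, s <= t -> t < s + d -> t <= q ->
      forall eta, 0 < eta ->
      \forall j \near \oo, (B j s t <= ((N s + eps) * (t - s) + eta)%:E)%E} ->
  forall eta, 0 < eta -> \forall j \near \oo,
    (B j p q <= \int[mu]_(s in `[p, q]) (N s)%:E + eta%:E)%E.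
Proof.
move=> pq N0 B0 BD loc aeN eta eta0.
have ex s : p <= s <= q -> exists2 c : R, 0 <= c &
    \forall j \near \oo, (B j p s <= c%:E)%E.
  move=> /andP[ps sq].
  apply: (local_to_global (Q := fun a b => exists2 c : R, 0 <= c &
    \forall j \near \oo, (B j a b <= c%:E)%E)) => //; last first.
    move=> r t z pr rt tz zs [c c0 cP] [c' c'0 cP']; exists (c + c').
      exact: addr_ge0.
    near=> j; have [_ ] := BD j r t z pr rt tz (le_trans zs sq).
    move=> /le_trans; apply; rewrite EFinD; apply: leeD.
      by near: j.
    by near: j.
  move=> t /andP[pt ts]; have [|e [K [e0 K0 KP]]] := loc t.
    by rewrite pt (le_trans ts).
  exists e => //; split=> z.
    move=> /andP[tz ze] zs; exists (K * (z - t) + 1).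
      by rewrite addr_ge0// mulr_ge0// subr_ge0.
    apply: KP => //; first exact: le_trans zs sq.
      by rewrite subrr normr0.
    by rewrite ger0_norm; lra.
  move=> /andP[ze zt] pz; exists (K * (t - z) + 1).
    by rewrite addr_ge0// mulr_ge0// subr_ge0.
  apply: KP => //; first exact: le_trans ts sq.
    by rewrite ler0_norm; lra.
  by rewrite subrr normr0.
(* [Phi s] is the upper limit as the infimum of the eventual real bounds; admitting only [0 <= c]
   keeps the infimum finite. *)
pose E s := [set c : R | 0 <= c /\ \forall j \near \oo, (B j p s <= c%:E)%E].
have Elb s : has_lbound (E s) by exists 0 => c [].
pose Phi s := inf (E s).
have PhiU s (c : R) : 0 <= c -> (\forall j \near \oo, (B j p s <= c%:E)%E) ->
    Phi s <= c.
  by move=> c0 cP; apply: (ge_inf (Elb s)).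
have PhiE s e : p <= s <= q -> 0 < e ->
    \forall j \near \oo, (B j p s <= (Phi s + e)%:E)%E.
  move=> sI e0; have [c0 c00 c0P] := ex s sI.
  have hi : has_inf (E s) by split; [exists c0|].
  have [c [_ cP] ce] := inf_adherent e0 hi.
  apply: filterS cP => j /le_trans; apply; rewrite lee_fin; exact: ltW.
have Phi0 s : p <= s <= q -> 0 <= Phi s.
  move=> sI; have [c0 c00 c0P] := ex s sI.
  by apply: lb_le_inf; [exists c0|move=> c []].
have Phip : Phi p <= 0.
  by apply: PhiU => //; apply: nearW => j; exact: B0.
have Phimono s t : p <= s -> s <= t -> t <= q -> Phi s <= Phi t.
  move=> ps st tq; have tI : p <= t <= q by rewrite (le_trans ps).
  apply/ler_addgt0Pr => e e0; apply: PhiU.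
    by rewrite addr_ge0 ?Phi0// ltW.
  apply: filterS (PhiE t e tI e0) => j; apply: le_trans.
  by have [] := BD j p s t (lexx _) ps st tq.
have Phiinc s t c : p <= s -> s <= t -> t <= q -> 0 <= c -> (forall eta, 0 < eta ->
    \forall j \near \oo, (B j s t <= (c + eta)%:E)%E) -> Phi t - Phi s <= c.
  move=> ps st tq c0 cP; have sI : p <= s <= q by rewrite ps (le_trans st).
  rewrite lerBlDl; apply/ler_addgt0Pr => e e0.
  have e2 : 0 < e / 2 by rewrite divr_gt0.
  apply: PhiU; first by rewrite !addr_ge0 ?Phi0// ltW.
  have h1 := PhiE s _ sI e2; have h2 := cP _ e2; near=> j.
  have [_ ] := BD j p s t (lexx _) ps st tq.
  move=> /le_trans; apply.
  have -> : Phi s + c + e = (Phi s + e / 2) + (c + e / 2) by lra.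
  by rewrite EFinD; apply: leeD; near: j.
have [K K0 KP] : exists2 K : R, 0 <= K & forall z1 z2,
    z1 \in `[p, q] -> z2 \in `[p, q] -> `|Phi z1 - Phi z2| <= K * `|z1 - z2|.
  apply: (lipschitz_local_to_global (V := R^o) (ltW pq)) => t tI.
  have [e [K [e0 K0 KP]]] := loc t tI.
  exists e, K; split=> // z1 z2; wlog z12 : z1 z2 / z1 <= z2.
    move=> H h1 h2 h3 h4; case/orP: (le_total z1 z2) => h; first exact: H.
    by rewrite distrC [in leRHS]distrC; exact: H.
  rewrite !in_itv/= => /andP[pz1 z1q] /andP[pz2 z2q] z1e z2e.
  rewrite distrC ger0_norm; last by rewrite subr_ge0; exact: Phimono.
  rewrite distrC ger0_norm ?subr_ge0//; apply: Phiinc => //.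
    by rewrite mulr_ge0// subr_ge0.
  by move=> x x0; exact: KP.
have [g [ig dg gE]] := @lipschitz_FTC R Phi K p q pq KP.
have gN : {ae mu, forall s, s \in `[p, q] -> g s <= N s}.
  apply: ae_itv_oo_cc.
  apply: (@filterS2 _ _ (ae_filter_ringOfSetsType mu) _ _ _ _ aeN dg).
  move=> s sN ds sI; have {}ds := ds sI.
  have /andP[ps sq] : p < s < q by rewrite in_itv in sI.
  apply/ler_addgt0Pr => e e0; have [d d0 dP] := sN sI e e0.
  apply: (is_derive_increment_le sq ds); exists d => // t st td tq.
  apply: Phiinc => //; first exact: ltW.
    by rewrite mulr_ge0 ?subr_ge0// addr_ge0// ltW.
  by move=> x x0; exact: dP.
have le : (\int[mu]_(s in `[p, q]) (g s)%:E <= \int[mu]_(s in `[p, q]) (N s)%:E)%E.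
  (* [g] is integrable but has no sign: discarding the negative part makes the nonnegative
     comparison applicable. *)
  rewrite integralE; apply: (@le_trans _ _ (\int[mu]_(s in `[p, q]) ((EFin \o g)^\+ s))%E).
    by apply: geeDl; rewrite oppe_le0; exact: integral_ge0.
  apply: ae_le_integral_nonmeasurable => //.
  - by move=> s _; rewrite lee_fin.
  apply: (@filterS _ _ (ae_filter_ringOfSetsType mu) _ _ _ gN).
  move=> s gs /= sI; rewrite funeposE ge_max /= !lee_fin N0 andbT; exact: gs.
have qI : p <= q <= q by rewrite ltW/=.
apply: filterS (PhiE q eta qI eta0) => j /le_trans; apply.
rewrite EFinD leeD2r//; apply: le_trans le; rewrite gE lee_fin.
by rewrite lerBrDr gerDl.
Unshelve. all: by end_near. Qed.
End EventualLength.

Section Reparametrisation.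
Context {R : realType} {n : nat} {M : topologicalType} (X : spacetime R n M).
Local Notation mu := (@lebesgue_measure R).
Implicit Types (sigma : R -> M) (k : R -> R).

Lemma subset_integral_le (A B : set R) (f : R -> \bar R) :
  A `<=` B -> (forall x, (0 <= f x)%E) ->
  (\int[mu]_(x in A) f x <= \int[mu]_(x in B) f x)%E.
Proof.
move=> AB f0; rewrite integral_mkcond [leRHS]integral_mkcond.
apply: ae_le_integral_nonmeasurable => [x _|x _|].
- by rewrite /patch; case: ifP.
- by rewrite /patch; case: ifP.
apply: aeW => x _; rewrite /patch; case: ifPn => [/set_mem/AB Bx|_].
  by rewrite mem_set.
by case: ifP.
Qed.

Lemma lipschitz_length_ge0 sigma p q : (0 <= lipschitz_length X p q sigma)%E.
Proof. by apply: integral_ge0 => x _; rewrite lee_fin sqrtr_ge0. Qed.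

Lemma lipschitz_length_le sigma p q p' q' : p' <= p -> q <= q' ->
  (lipschitz_length X p q sigma <= lipschitz_length X p' q' sigma)%E.
Proof.
move=> pp qq; apply: subset_integral_le => [x|x].
  by rewrite /= !in_itv/= => /andP[h1 h2]; rewrite (le_trans pp h1) (le_trans h2).
by rewrite lee_fin sqrtr_ge0.
Qed.

Lemma lipschitz_length_cat sigma p q r : p <= q -> q <= r ->
  (lipschitz_length X p r sigma <=
   lipschitz_length X p q sigma + lipschitz_length X q r sigma)%E.
Proof.
move=> pq qr; apply: (@le_trans _ _
    (\int[mu]_(t in `[p, q] `|` `[q, r]) (speed X sigma t)%:E)%E).
  apply: subset_integral_le => [x|x].
    rewrite /= !in_itv/= => /andP[-> ->]; rewrite andbT.
    by case/orP: (le_total x q) => ->; [left|right].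
  by rewrite lee_fin sqrtr_ge0.
by apply: integral_setU_le_nonmeasurable => // x; rewrite lee_fin sqrtr_ge0.
Qed.

Lemma lipschitz_length_point sigma p : (lipschitz_length X p p sigma <= 0)%E.
Proof.
rewrite /lipschitz_length set_itv1.
have <- : (\int[mu]_(x in [set p]) (cst 0%E) x = 0)%E by exact: integral0.
apply: ae_le_integral_nonmeasurable => //.
  by move=> x _; rewrite lee_fin sqrtr_ge0.
exists [set p]; split => //; first exact: lebesgue_measure_set1.
by move=> z /= /not_implyP[].
Qed.

Lemma reparametrisation_sub u v p q k a b : reparametrisation u v p q k ->
  p <= a -> a <= b -> b <= q -> reparametrisation (k a) (k b) a b k.
Proof.
move=> [pq ku kv kc kh] pa ab bq; split => //.
  apply: continuous_subspaceW kc => x /=; rewrite !in_itv/= => /andP[h1 h2].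
  by rewrite (le_trans pa h1) (le_trans h2 bq).
move=> x y; rewrite !in_itv/= => /andP[? ?] /andP[? ?]; apply: kh.
  by rewrite in_itv/=; apply/andP; split; lra.
by rewrite in_itv/=; apply/andP; split; lra.
Qed.

Lemma locally_lipschitz_sub sigma p q a b : locally_lipschitz X p q sigma ->
  p <= a -> b <= q -> locally_lipschitz X a b sigma.
Proof.
move=> ll pa bq t i; rewrite in_itv/= => /andP[at' tb] dt.
have I z : z \in `[a, b] -> z \in `[p, q].
  by rewrite !in_itv/= => /andP[? ?]; apply/andP; split; lra.
have [|e [K [e0 KP]]] := ll t i _ dt; first by apply: I; rewrite in_itv/= at'.
by exists e, K; split=> // t1 t2 /I t1I /I t2I; exact: KP.
Qed.

Lemma reparametrisation_le u v p q k : reparametrisation u v p q k ->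
  forall x y, p <= x <= q -> p <= y <= q -> k x <= k y -> x <= y.
Proof.
move=> [pq ku kv kc kh] x y xI yI; apply: contra_le => yx.
by apply: kh; rewrite ?in_itv.
Qed.

(** [m] is the monotone inverse of [k], obtained from the intermediate value theorem. It translates
    parameters common to all curves into the private Lipschitz parameter of one curve. *)
Lemma reparametrisation_surj u v p q k : reparametrisation u v p q k ->
  exists m : R -> R, [/\ m u = p, m v = q,
    (forall z, u <= z <= v -> p <= m z <= q /\ k (m z) = z)
    & forall x y, u <= x -> x <= y -> y <= v -> m x <= m y].
Proof.
move=> rep; have [pq ku kv kc kh] := rep.
have uv : u <= v.
  have pI : p <= p <= q by rewrite lexx.
  by have /andP[] := reparametrisation_itv rep pI; rewrite ku.
have ex z : exists w, u <= z <= v -> p <= w <= q /\ k w = z.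
  have [zI|nz] := boolP (u <= z <= v); last by exists p.
  have [|w] := @IVT R k p q z pq kc.
    by rewrite ku kv (min_idPl uv) (max_idPr uv).
  by rewrite in_itv/= => wI kw; exists w.
have [m mP] := choice ex.
have inj x y : p <= x <= q -> p <= y <= q -> k x = k y -> x = y.
  move=> xI yI e; apply/eqP; rewrite eq_le.
  by apply/andP; split; apply: (reparametrisation_le rep) => //; rewrite e.
exists m; split => //.
- have [mI kmu] := mP u (introT andP (conj (lexx _) uv)).
  by apply: inj => //; rewrite ?lexx// kmu ku.
- have [mI kmu] := mP v (introT andP (conj uv (lexx _))).
  by apply: inj => //; rewrite ?lexx ?pq// kmu kv.
move=> x y ux xy yv.
have [|mx kx] := mP x; first by rewrite ux (le_trans xy).
have [|my ky] := mP y; first by rewrite yv andbT (le_trans ux).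
by apply: (reparametrisation_le rep) => //; rewrite kx ky.
Qed.

(** The new parameter is [S z = T z + z], the summand [z] making it strictly increasing. For its
    inverse [k], the nonnegative increments of [k] and of [T] composed with [k] add up to that of
    the parameter, so both are 1-Lipschitz. *)
Lemma lipschitz_reparametrisation u v sigma T : u <= v ->
  continuous_nondecreasing T -> lipschitz_in_charts X u v sigma T ->
  exists p q k, reparametrisation u v p q k /\ locally_lipschitz X p q (sigma \o k).
Proof.
move=> uv [Tc Tn] lT; pose S z := T z + z.
have Sc : continuous S by move=> z; exact: (cvgD (Tc z) cvg_id).
have Si x y : x <= y -> y - x <= S y - S x.
  by move=> xy; have := Tn _ _ xy; rewrite /S; lra.
have Suv : S u <= S v by have := Si _ _ uv; lra.
have ex s : exists z, S u <= s <= S v -> u <= z <= v /\ S z = s.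
  have [sI|ns] := boolP (S u <= s <= S v); last by exists u.
  have [|z] := @IVT R S u v s uv (continuous_subspaceT Sc).
    by rewrite (min_idPl Suv) (max_idPr Suv).
  by rewrite in_itv/= => zI Sz; exists z.
have [k kP] := choice ex.
have kd x y : S u <= x -> x <= y -> y <= S v ->
    0 <= k y - k x /\ k y - k x + (T (k y) - T (k x)) = y - x.
  move=> ux xy yv.
  have [|kx Sx] := kP x; first by rewrite ux (le_trans xy).
  have [|ky Sy] := kP y; first by rewrite yv andbT (le_trans ux).
  split; last by move: Sx Sy; rewrite /S; lra.
  case/orP: (le_total (k x) (k y)) => h; first by rewrite subr_ge0.
  by have := Si _ _ h; rewrite Sx Sy; lra.
have inj z : u <= z <= v -> k (S z) = z.
  move=> /andP[uz zv].
  have [|kz Sz] := kP (S z).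
    by have := Si _ _ uz; have := Si _ _ zv; move=> *; apply/andP; split; lra.
  case/orP: (le_total (k (S z)) z) => h; have := Si _ _ h; rewrite Sz; lra.
have kl x y : S u <= x -> x <= y -> y <= S v ->
    `|k y - k x| <= y - x /\ `|T (k y) - T (k x)| <= y - x.
  move=> ux xy yv; have [h1 h2] := kd _ _ ux xy yv.
  have kxy : k x <= k y by rewrite -subr_ge0.
  have := Tn _ _ kxy => h3.
  by rewrite ger0_norm// ger0_norm ?subr_ge0//; split; lra.
have kl2 x y : x \in `[S u, S v] -> y \in `[S u, S v] ->
    `|k x - k y| <= `|x - y| /\ `|T (k x) - T (k y)| <= `|x - y|.
  wlog xy : x y / x <= y.
    move=> H xI yI; case/orP: (le_total x y) => h; first exact: H.
    rewrite distrC (distrC (T _)) (distrC x); exact: H.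
  rewrite !in_itv/= => /andP[ux xv] /andP[uy yv].
  rewrite distrC (distrC (T _)) (distrC x) [X in _ <= X]ger0_norm ?subr_ge0//.
  rewrite [X in _ /\ _ <= X]ger0_norm ?subr_ge0//.
  exact: kl.
have kI x : x \in `[S u, S v] -> k x \in `[u, v].
  by rewrite !in_itv/= => /kP[].
exists (S u), (S v), k; split.
  split => //.
  - by apply: inj; rewrite lexx.
  - by apply: inj; rewrite lexx uv.
  - apply/subspace_continuousP => x xI; apply/cvgrPdist_lt => e e0.
    apply/nbhs_distP; exists e => // y yx yI.
    by apply: le_lt_trans _ yx; rewrite distrC; have [] := kl2 _ _ yI xI.
  move=> x y xI yI xy.
  have := xI; have := yI; rewrite !in_itv/= => /andP[uy yv] /andP[ux xv].
  have [h1 h2] := kd _ _ ux (ltW xy) yv.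
  have [//|yx] := ltP (k x) (k y).
  have e : k x = k y by move: h1 yx; lra.
  by move: h2; rewrite e !subrr addr0; lra.
move=> s i sI ds; have [e [K [e0 K0 KP]]] := lT (k s) i (kI s sI) ds.
exists e, K; split=> // t1 t2 t1I t2I t1e t2e.
have [||||d1 d2 le] := KP (k t1) (k t2); rewrite ?kI//.
- by apply: le_lt_trans t1e; have [] := kl2 _ _ t1I sI.
- by apply: le_lt_trans t2e; have [] := kl2 _ _ t2I sI.
split=> //; apply: le_trans le _; apply: ler_wpM2l => //.
by have [] := kl2 _ _ t1I t2I.
Qed.
End Reparametrisation.

Section UniformLimit.
Context {R : realType} {n : nat} {M : metricType R} (X : spacetime R n M).
Local Notation mu := (@lebesgue_measure R).
Variables (I : set R) (gam_ : nat -> R -> M) (gam : R -> M) (u v : R).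
Hypothesis uvI : `[u, v] `<=` I.
Hypothesis gam_causal_ : forall j, causal_curve X I (gam_ j).
Hypothesis gam_causal : causal_curve X I gam.
Hypothesis gam_cvg : cvg_uniformly_on_compacts I gam_ gam.

Let gam_cont t (A : set M) : t \in `[u, v] -> nbhs (gam t) A ->
  exists2 e : R, 0 < e & forall s, s \in `[u, v] -> `|s - t| < e -> A (gam s).
Proof.
move=> tI nA; have gc : {within I, continuous gam} by case: gam_causal => -[].
have [e e0 eP] := within_continuous_near gc (uvI tI) nA.
by exists e => // s sI; apply: eP; exact: uvI.
Qed.

Lemma uniform_limit_near t (A : set M) : t \in `[u, v] -> nbhs (gam t) A ->
  exists2 e : R, 0 < e & \forall j \near \oo, forall s, s \in `[u, v] ->
    `|s - t| < e -> A (gam_ j s).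
Proof.
move=> tI /nbhs_ballP[r /= r0 rA]; have r2 : 0 < r / 2 by rewrite divr_gt0.
have [e e0 eP] := gam_cont tI (nbhsx_ballx (gam t) _ r2).
exists e => //; have := gam_cvg (@segment_compact R u v) uvI r2.
apply: filterS => j jP s sI se; apply: rA.
apply: (@ball_split _ _ (gam s)); first exact: eP.
by apply: ball_sym; rewrite ballEmdist/=; exact: jP.
Qed.

Lemma coord_cvg (i : chart X) t (e : R) : t \in `[u, v] -> dom i (gam t) -> 0 < e ->
  \forall j \near \oo, `|coord i (gam_ j t) - coord i (gam t)| < e.
Proof.
move=> tI dt e0; have [b b0] := uniform_limit_near tI (coord_ball_nbhs dt e0).
apply: filterS => j /(_ t tI); rewrite subrr normr0 => /(_ b0)[].
by [].
Qed.

Variables (p_ q_ : nat -> R) (k_ m_ : nat -> R -> R).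
Hypothesis k_rep : forall j, reparametrisation u v (p_ j) (q_ j) (k_ j).
Hypothesis k_lip : forall j, locally_lipschitz X (p_ j) (q_ j) (gam_ j \o k_ j).
Hypothesis m_inv : forall j z, u <= z <= v ->
  p_ j <= m_ j z <= q_ j /\ k_ j (m_ j z) = z.
Hypothesis m_mono : forall j x y, u <= x -> x <= y -> y <= v -> m_ j x <= m_ j y.

(** The bound by displacement holds for [gam_ j] as soon as it runs in the calibrated ball, and the
    coordinates of its two endpoints converge. The radius [e] is independent of [s1], [s2] and
    [eta]; only the threshold on [j] depends on them. *)
Lemma eventual_calibrated_length (i : chart X) (w : 'rV[R]_n.+1) (d t : R) :
  t \in `[u, v] -> dom i (gam t) -> 0 < d ->
  (forall x y, `|x - coord i (gam t)| < d -> future_causal_vector i x y ->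
    Num.sqrt (- form (metric i x) y y) <= form (metric i (coord i (gam t))) w y) ->
  exists2 e : R, 0 < e & forall s1 s2, u <= s1 -> s1 <= s2 -> s2 <= v ->
    `|s1 - t| < e -> `|s2 - t| < e -> forall eta, 0 < eta ->
    \forall j \near \oo,
    (lipschitz_length X (m_ j s1) (m_ j s2) (gam_ j \o k_ j) <=
    (`|form (metric i (coord i (gam t))) w
         (coord i (gam s2) - coord i (gam s1))| + eta)%:E)%E.
Proof.
move=> tI dt d0 cal; have nA := coord_ball_nbhs dt d0.
have [e1 e10 e1P] := uniform_limit_near tI nA.
have [e2 e20 e2P] := gam_cont tI nA.
exists (Num.min e1 e2); first by rewrite lt_min e10.
move=> s1 s2 us1 s12 s2v; rewrite !lt_min => /andP[s1e s1e'] /andP[s2e s2e'] eta eta0.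
have s1I : s1 \in `[u, v] by rewrite in_itv/= us1 (le_trans s12).
have s2I : s2 \in `[u, v] by rewrite in_itv/= s2v andbT (le_trans us1).
have [ds1 _] := e2P _ s1I s1e'; have [ds2 _] := e2P _ s2I s2e'.
set G0 := metric _ _; have [B B0 BP] := form_norm_bound G0 w.
have eB : 0 < eta / (2 * B) by rewrite divr_gt0// mulr_gt0.
have jP : \forall j \near \oo, forall z, s1 <= z <= s2 ->
    dom i (gam_ j z) /\ `|coord i (gam_ j z) - coord i (gam t)| < d.
  apply: filterS e1P => j jP z /andP[s1z zs2]; apply: jP.
    by rewrite in_itv/= (le_trans us1)//= (le_trans zs2).
  move: s1e s2e; rewrite !ltr_norml => /andP[? ?] /andP[? ?].
  by apply/andP; split; lra.
have c1 := coord_cvg s1I ds1 eB; have c2 := coord_cvg s2I ds2 eB.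
near=> j.
have [sg sg1 gor] := causal_curve_oriented (gam_causal_ j).
have [m1I k1] : p_ j <= m_ j s1 <= q_ j /\ k_ j (m_ j s1) = s1.
  by apply: m_inv; rewrite in_itv in s1I.
have [m2I k2] : p_ j <= m_ j s2 <= q_ j /\ k_ j (m_ j s2) = s2.
  by apply: m_inv; rewrite in_itv in s2I.
have /andP[pm1 _] := m1I; have /andP[_ m2q] := m2I.
have rep := reparametrisation_sub (k_rep j) pm1 (m_mono j us1 s12 s2v) m2q.
rewrite k1 k2 in rep.
have ll : locally_lipschitz X (m_ j s1) (m_ j s2) (gam_ j \o k_ j).
  exact: (locally_lipschitz_sub (@k_lip j) pm1 m2q).
apply: le_trans (calibrated_length cal sg1 gor _ rep ll) _.
  have jn : forall z, s1 <= z <= s2 ->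
      dom i (gam_ j z) /\ `|coord i (gam_ j z) - coord i (gam t)| < d.
    by near: j.
  move=> z zI; have [dz xz] := jn z zI.
  have /andP[s1z zs2] := zI; split => //; apply: uvI.
  by rewrite /= in_itv/= (le_trans us1)//= (le_trans zs2).
rewrite lee_fin -/G0.
set y1 := coord i (gam s1); set y2 := coord i (gam s2).
have -> : coord i (gam_ j s2) - coord i (gam_ j s1) =
    (y2 - y1) + ((coord i (gam_ j s2) - y2) - (coord i (gam_ j s1) - y1)).
  by rewrite opprB addrA [y2 - y1 + _]addrC !subrKA.
rewrite formDr; apply: le_trans (ler_normD _ _) _; rewrite lerD2l.
apply: le_trans (BP _) _.
have h1 : `|coord i (gam_ j s1) - y1| < eta / (2 * B) by near: j.
have h2 : `|coord i (gam_ j s2) - y2| < eta / (2 * B) by near: j.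
have -> : eta = B * (eta / (2 * B) + eta / (2 * B)) by field; rewrite gt_eqF.
rewrite ler_wpM2l ?(ltW B0)//; apply: le_trans (ler_normB _ _) _.
by rewrite lerD// ltW.
Unshelve. all: by end_near. Qed.
End UniformLimit.

Section LengthSemicontinuity.
Context {R : realType} {n : nat} {M : metricType R} (X : spacetime R n M).
Local Notation mu := (@lebesgue_measure R).

(** In general no single chart contains the curve; the statement is glued from short intervals, each
    mapped into one chart. *)
Lemma locally_lipschitz_ae_derivable p q (sigma : R -> M) : p <= q ->
  locally_lipschitz X p q sigma ->
  {ae mu, forall s, s \in `]p, q[ -> exists i : chart X,
    [/\ dom i (sigma s), \forall t \near s, dom i (sigma t)
      & derivable (fun t => coord i (sigma t)) s 1]}.
Proof.
move=> pq ll.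
pose D s := exists i : chart X,
    [/\ dom i (sigma s), \forall t \near s, dom i (sigma t)
      & derivable (fun t => coord i (sigma t)) s 1].
suff H : {ae mu, forall s, s \in `[p, q] -> D s}.
  apply: (@filterS _ _ (ae_filter_ringOfSetsType mu) _ _ _ H) => s sD.
  by rewrite in_itv/= => /andP[/ltW ps /ltW sq]; apply: sD; rewrite in_itv/= ps.
apply: (local_to_global
  (Q := fun a b => {ae mu, forall s, s \in `[a, b] -> D s})) => //; last first.
  move=> r s t pr rs st tq h1 h2.
  apply: (@filterS2 _ _ (ae_filter_ringOfSetsType mu) _ _ _ _ h1 h2).
  move=> z z1 z2; rewrite in_itv/= => /andP[rz zt].
  case/orP: (le_total z s) => h; first by apply: z1; rewrite in_itv/= rz.
  by apply: z2; rewrite in_itv/= zt andbT.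
move=> t tI; have dt : dom (chart_at X (sigma t)) (sigma t) by exact: dom_chart_at.
have [|e [K [e0 KP]]] := ll t _ _ dt; first by rewrite in_itv.
set i := chart_at X (sigma t) in dt KP.
have key a b : p <= a -> b <= q -> (forall z, a <= z <= b -> `|z - t| < e) ->
    {ae mu, forall s, s \in `[a, b] -> D s}.
  move=> pa bq abe; apply: ae_itv_oo_cc.
  have [ab|ba] := ltP a b; last first.
    apply: aeW => s; rewrite in_itv/= => /andP[? ?]; exfalso; lra.
  have abP z : a <= z <= b -> z \in `[p, q] /\ `|z - t| < e.
    move=> zI; split; last exact: abe.
    by move: zI; rewrite in_itv/= => /andP[? ?]; apply/andP; split; lra.
  have H := @lipschitz_row_ae_derivable R _ (fun z => coord i (sigma z)) K a b ab.
  apply: (@filterS _ _ (ae_filter_ringOfSetsType mu) _ _ _ (H _)); last first.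
    move=> z1 z2; rewrite !in_itv/= => /abP[z1I z1e] /abP[z2I z2e].
    by have [] := KP z1 z2 z1I z2I z1e z2e.
  move=> s ds sI; exists i; split; last exact: ds.
    have [|sI' se] := abP s.
      by move: sI; rewrite in_itv/= => /andP[? ?]; rewrite !ltW.
    by have [] := KP s s sI' sI' se se.
  apply: filterS (near_in_itvoo sI) => z; rewrite in_itv/= => /andP[az zb].
  have [|zI ze] := abP z; first by rewrite !ltW.
  by have [] := KP z z zI zI ze ze.
have /andP[pt tq] := tI.
exists e => //; split=> s.
  move=> /andP[ts se] sq; apply: key => // z /andP[tz zs].
  by rewrite ger0_norm; lra.
move=> /andP[es st] ps; apply: key => // z /andP[sz zt].
by rewrite ler0_norm; lra.
Qed.

(** Weak inequalities survive the limit of approximating causal vectors; these two are what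
    [calibration] asks of the direction along which it is sharp. *)
Lemma causal_derivative_cone (i : chart X) sg (I : set R) (sigma : R -> M)
    u v p q k z w : `|sg| = 1 ->
  oriented_causal X sg I sigma -> (forall t, u <= t <= v -> I t) ->
  reparametrisation u v p q k -> p <= z < q -> dom i (sigma (k z)) ->
  is_derive z 1 (fun s => coord i (sigma (k s))) w ->
  form (metric i (coord i (sigma (k z)))) (sg *: w) (sg *: w) <= 0 /\
  form (metric i (coord i (sigma (k z)))) (time i (coord i (sigma (k z))))
    (sg *: w) <= 0.
Proof.
move=> sg1 gor uvI rep zI dz dw; set x := coord i (sigma (k z)).
have apx := causal_derivative_approx gor uvI rep zI dz dw.
have sc a : {for w, continuous (fun t : 'rV[R]_n.+1 => (sg *: t) 0 a)}.
  have -> : (fun t : 'rV[R]_n.+1 => (sg *: t) 0 a) = (fun t => sg * t 0 a).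
    by apply/funext => t; rewrite mxE.
  have h : {for w, continuous (fun t : 'rV[R]_n.+1 => t 0 a)}.
    exact: matrix_normedtype.coord_continuous.
  exact: (cvgM (cvg_cst sg) h).
split; rewrite -oppr_ge0.
  apply: (@lim_ge0 _ _ (fun y => - form (metric i x) (sg *: y) (sg *: y))).
    have h : {for w, continuous (fun y : 'rV[R]_n.+1 =>
        form (metric i x) (sg *: y) (sg *: y))}.
      by apply: (@form_near _ _ _ w (fun=> metric i x) (fun y => sg *: y)
        (fun y => sg *: y)) => //; move=> a b; exact: cst_continuous.
    exact: (cvgN h).
  move=> e /apx[y yw [_ fy _]]; exists y => //.
  by rewrite oppr_ge0.
apply: (@lim_ge0 _ _ (fun y => - form (metric i x) (time i x) (sg *: y))).
  have h : {for w, continuous (fun y : 'rV[R]_n.+1 =>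
      form (metric i x) (time i x) (sg *: y))}.
    apply: (@form_near _ _ _ w (fun=> metric i x) (fun=> time i x)
      (fun y => sg *: y)) => //.
    - by move=> a b; exact: cst_continuous.
    - by move=> a; exact: cst_continuous.
  exact: (cvgN h).
move=> e /apx[y yw [_ _ fy]]; exists y => //.
by rewrite oppr_ge0 ltW.
Qed.

Lemma increment_le_derivative (G : 'M[R]_n.+1) (a w : 'rV[R]_n.+1)
    (y : R -> 'rV[R]_n.+1) (s e : R) : is_derive s 1 y w -> 0 < e ->
  exists2 d : R, 0 < d & forall t, s <= t -> t < s + d ->
    `|form G a (y t - y s)| <= (`|form G a w| + e) * (t - s).
Proof.
move=> /is_derive_distP dy e0; have [B B0 BP] := form_norm_bound G a.
have [d d0 dP] := dy (e / B) (divr_gt0 e0 B0).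
exists d => // t st td; have ts : `|t - s| = t - s by rewrite ger0_norm// subr_ge0.
have := dP (t - s); rewrite ts [(t - s) *: 1]mulr1 subrK => hP.
have {}hP : `|y t - y s - (t - s) *: w| <= e / B * (t - s) by apply: hP; lra.
rewrite -[y t - y s](subrK ((t - s) *: w)) addrC formDr formZr.
apply: le_trans (ler_normD _ _) _; rewrite normrM ts [leRHS]mulrDl.
apply: lerD; first by rewrite mulrC.
apply: le_trans (BP _) _; have -> : e * (t - s) = B * (e / B * (t - s)).
  by field; rewrite gt_eqF.
by apply: (ler_wpM2l (ltW B0)).
Qed.

(** Everything is expressed in the Lipschitz parameter of the limit curve, even the lengths of the
    [gam_ j]. Calibrations enter twice: an arbitrary one at each point gives the local Lipschitz
    bound, and one adapted to the velocity of the limit gives the bound on the derivative almost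
    everywhere. *)
Lemma eventual_lipschitz_length_le (I : set R) (gam_ : nat -> R -> M)
    (gam : R -> M) u v p q h (p_ q_ : nat -> R) (k_ : nat -> R -> R) :
  `[u, v] `<=` I -> (forall j, causal_curve X I (gam_ j)) ->
  causal_curve X I gam -> cvg_uniformly_on_compacts I gam_ gam ->
  reparametrisation u v p q h -> locally_lipschitz X p q (gam \o h) ->
  (forall j, reparametrisation u v (p_ j) (q_ j) (k_ j)) ->
  (forall j, locally_lipschitz X (p_ j) (q_ j) (gam_ j \o k_ j)) ->
  forall eta : R, 0 < eta -> \forall j \near \oo,
    (lipschitz_length X (p_ j) (q_ j) (gam_ j \o k_ j) <=
     lipschitz_length X p q (gam \o h) + eta%:E)%E.
Proof.
move=> uvI gam_causal_ gam_causal gam_cvg rep ll rep_ ll_.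
have [m mP] := choice (fun j => reparametrisation_surj (rep_ j)).
have [pq hp hq hc hh] := rep.
have hI z : p <= z <= q -> u <= h z <= v by exact: (reparametrisation_itv rep).
have h_mono z1 z2 : p <= z1 -> z1 <= z2 -> z2 <= q -> h z1 <= h z2.
  move=> pz1; rewrite le_eqVlt => /predU1P[->//|z12] z2q; apply/ltW/hh => //.
    by rewrite in_itv/= pz1 ltW// (lt_le_trans z12).
  by rewrite in_itv/= z2q andbT ltW// (le_lt_trans pz1).
have [pq'|pq'] := eqVneq p q.
  move=> eta eta0; apply: nearW => j.
  have uv : u = v by rewrite -hp -hq pq'.
  have [mu_ mv_ _ _] := mP j; rewrite uv mv_ in mu_; rewrite -mu_.
  apply: le_trans (lipschitz_length_point _ _ _) _.
  by rewrite adde_ge0 ?lipschitz_length_ge0// lee_fin ltW.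
have {}pq' : p < q by rewrite lt_neqAle pq'.
have [sg sg1 gor] := causal_curve_oriented gam_causal.
have m_inv j z : u <= z <= v -> p_ j <= m j z <= q_ j /\ k_ j (m j z) = z.
  by have [_ _ + _] := mP j; apply.
have m_mono j x y : u <= x -> x <= y -> y <= v -> m j x <= m j y.
  by have [_ _ _ +] := mP j; apply.
have loc := eventual_calibrated_length uvI gam_causal_ gam_causal gam_cvg rep_
  ll_ m_inv m_mono.
have hin z : p <= z <= q -> h z \in `[u, v] by move=> /hI; rewrite in_itv.
have hnear z (e : R) : p <= z <= q -> 0 < e -> exists2 d : R, 0 < d &
    forall s, p <= s <= q -> `|s - z| < d -> `|h s - h z| < e.
  move=> zI e0; have zi : z \in `[p, q] by rewrite in_itv.
  have [d d0 dP] := within_continuous_near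
    (sigma := h : R -> R) hc zi (nbhsx_ballx (h z) _ e0).
  exists d => // s sI sd; rewrite distrC; apply: dP => //.
(* [h] leads from the parameter of the limit to the common parameter in [[u, v]], and [m j] from
   there to the parameter of [gam_ j]. *)
pose B j s1 s2 := lipschitz_length X (m j (h s1)) (m j (h s2)) (gam_ j \o k_ j).
suff H : forall eta : R, 0 < eta -> \forall j \near \oo, (B j p q <=
    \int[mu]_(s in `[p, q]) (speed X (gam \o h) s)%:E + eta%:E)%E.
  move=> eta /H; apply: filterS => j; rewrite /B hp hq.
  by have [-> -> _ _] := mP j.
apply: (eventual_length_le (B := B) pq').
- by move=> s; exact: sqrtr_ge0.
- by move=> j s; exact: lipschitz_length_point.
- move=> j r s t pr rs st tq.
  have h1 : m j (h r) <= m j (h s).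
    apply: m_mono.
    - by have /andP[] := hI r (introT andP (conj pr (le_trans rs (le_trans st tq)))).
    - by apply: h_mono => //; exact: le_trans st tq.
    by have /andP[] := hI s (introT andP (conj (le_trans pr rs) (le_trans st tq))).
  have h2 : m j (h s) <= m j (h t).
    apply: m_mono.
    - by have /andP[] := hI s (introT andP (conj (le_trans pr rs) (le_trans st tq))).
    - by apply: h_mono => //; exact: le_trans pr rs.
    by have /andP[] := hI t (introT andP (conj (le_trans pr (le_trans rs st)) tq)).
  by split; [exact: lipschitz_length_le|exact: lipschitz_length_cat].
- move=> s sI; pose i := chart_at X (gam (h s)).
  have di : dom i (gam (h s)) by exact: dom_chart_at.
  have [||w [d d0 [cal _]]] := calibration di (v := 0) _ _ ltr01.
  (* For the Lipschitz bound any dominating form will do, hence the direction 0 in [calibration]. *)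
  + by rewrite form0r.
  + by rewrite form0r.
  have [e1 e10 e1P] := loc i w d (h s) (hin s sI) di d0 cal.
  have [e2 e20 e2P] := hnear s e1 sI e10.
  have [|e3 [K [e30 KP]]] := ll s i _ di; first by rewrite in_itv.
  have [C C0 CP] := form_norm_bound (metric i (coord i (gam (h s)))) w.
  exists (Num.min e2 e3), (C * `|K|); split.
  + by rewrite lt_min e20.
  + by rewrite mulr_ge0// ltW.
  move=> s1 s2 ps1 s12 s2q; rewrite !lt_min => /andP[s1e s1e'] /andP[s2e s2e'] eta eta0.
  have s1I : p <= s1 <= q by rewrite ps1 (le_trans s12).
  have s2I : p <= s2 <= q by rewrite s2q (le_trans ps1).
  have /andP[uh1 _] := hI s1 s1I; have /andP[_ h2v] := hI s2 s2I.
  have := e1P (h s1) (h s2) uh1 (h_mono _ _ ps1 s12 s2q) h2v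
    (e2P _ s1I s1e) (e2P _ s2I s2e) eta eta0.
  apply: filterS => j /le_trans; apply; rewrite lee_fin lerD2r.
  apply: le_trans (CP _) _; rewrite -mulrA; apply: (ler_wpM2l (ltW C0)).
  have [||_ _] := KP s2 s1 _ _ s2e' s1e'; rewrite ?in_itv//.
  move=> /le_trans; apply; rewrite ger0_norm ?subr_ge0//.
  by apply: ler_wpM2r; [rewrite subr_ge0|exact: ler_norm].
apply: (@filterS _ _ (ae_filter_ringOfSetsType mu) _ _ _
  (locally_lipschitz_ae_derivable pq ll)).
move=> s sD spq eps eps0; have [i [ds nds dys]] := sD spq.
have [w dy] : exists w, is_derive s 1 (fun t => coord i (gam (h t))) w.
  by eexists; exact: (derivableP dys).
have /andP[ps sq] : p < s < q by rewrite in_itv in spq.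
have sI : p <= s <= q by rewrite !ltW.
set x0 := coord i (gam (h s)).
have sI' : p <= s < q by rewrite (ltW ps).
have uvI' t : u <= t <= v -> I t by move=> tI; apply: uvI; rewrite /= in_itv.
have [c1 c2] := causal_derivative_cone sg1 gor uvI' rep sI' ds dy.
(* One half of [eps] is spent on the sharpness of the calibration, the other on the first-order
   expansion of the limit curve. *)
have e2 : 0 < eps / 2 by rewrite divr_gt0.
have [a [d d0 [cal calw]]] := calibration ds c1 c2 e2.
have [e e0 eP] := loc i a d (h s) (hin s sI) ds d0 cal.
have [e' e'0 e'P] := hnear s e sI e0.
have [b b0 bP] := increment_le_derivative (metric i x0) a dy e2.
exists (Num.min e' b); first by rewrite lt_min e'0.
move=> t st; rewrite -ltrBlDl lt_min !ltrBlDl => /andP[te' tb] tq eta eta0.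
have tI : p <= t <= q by rewrite tq (le_trans (ltW ps)).
have /andP[uhs _] := hI s sI; have /andP[_ htv] := hI t tI.
have ts : `|t - s| < e' by rewrite ger0_norm; lra.
have ss : `|h s - h s| < e by rewrite subrr normr0.
have := eP (h s) (h t) uhs (h_mono _ _ (ltW ps) st tq) htv ss (e'P _ tI ts) eta eta0.
apply: filterS => j /le_trans; apply; rewrite lee_fin lerD2r.
apply: le_trans (bP t st tb) _; apply: ler_wpM2r; first by rewrite subr_ge0.
rewrite (speed_in_chart ds nds dy) /= -/x0.
move: calw; rewrite formZr normrM sg1 mul1r formZl formZr mulrA.
have -> : sg * sg = 1 by rewrite -expr2 -real_normK ?num_real// sg1 expr1n.
by rewrite mul1r; lra.
Qed.
End LengthSemicontinuity.

(** * Segment length as a function of the curve and of the endpoints *)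

Section SegmentLength.
Context {R : realType} {n : nat} {M : metricType R} (X : spacetime R n M).
Implicit Types (I : set R) (sigma gam : R -> M).

Lemma lipschitz_reparametrisation_exists I sigma u v : u <= v ->
  `[u, v] `<=` I -> causal_curve X I sigma -> exists p q k,
    reparametrisation u v p q k /\ locally_lipschitz X p q (sigma \o k).
Proof.
move=> uv uvI cs; have [|T Tc Tl] := time_function_exists uv cs.
  by move=> z zI; apply: uvI; rewrite /= in_itv.
exact: lipschitz_reparametrisation Tc Tl.
Qed.

(* A constant sequence of curves converges, so upper semicontinuity compares any
   two reparametrisations. *)
Lemma segment_lengthE I sigma u v p q k : `[u, v] `<=` I ->
  causal_curve X I sigma -> reparametrisation u v p q k ->
  locally_lipschitz X p q (sigma \o k) ->
  segment_length X sigma u v = lipschitz_length X p q (sigma \o k).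
Proof.
move=> uvI cs rep ll; apply/eqP; rewrite eq_le; apply/andP; split; last first.
  by apply: ereal_sup_ubound; exists p, q, k.
apply: ge_ereal_sup => _ [p' [q' [k' [rep' ll' ->]]]].
apply/lee_addgt0Pr => e e0.
have cst_cvg : cvg_uniformly_on_compacts I (fun=> sigma) sigma.
  by move=> K _ _ r r0; apply: nearW => j t _; rewrite mdistxx.
have := @eventual_lipschitz_length_le _ _ _ X I (fun=> sigma) sigma u v p q k
  (fun=> p') (fun=> q') (fun=> k') uvI (fun=> cs) cs cst_cvg rep ll
  (fun=> rep') (fun=> ll') e e0.
by move=> [N _ NP]; exact: (NP N (leqnn _)).
Qed.

Lemma segment_length_ge0 I sigma u v : u <= v -> `[u, v] `<=` I ->
  causal_curve X I sigma -> (0 <= segment_length X sigma u v)%E.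
Proof.
move=> uv uvI cs; have [p [q [k [rep ll]]]] := lipschitz_reparametrisation_exists uv uvI cs.
by rewrite (segment_lengthE uvI cs rep ll); exact: lipschitz_length_ge0.
Qed.

(** A Lipschitz parameter of the longer segment restricts to one of the shorter, after which both
    lengths are integrals of the same speed over nested intervals. *)
Lemma segment_length_le I sigma u v u' v' : `[u', v'] `<=` I ->
  causal_curve X I sigma -> u' <= u -> u <= v -> v <= v' ->
  (segment_length X sigma u v <= segment_length X sigma u' v')%E.
Proof.
move=> uvI cs uu uv vv; have uv' := le_trans uu (le_trans uv vv).
have [p [q [k [rep ll]]]] := lipschitz_reparametrisation_exists uv' uvI cs.
have [m [_ _ mP m_mono]] := reparametrisation_surj rep.
have [|/andP[pu _] ku] := mP u; first by rewrite uu (le_trans uv).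
have [|/andP[_ vq] kv] := mP v; first by rewrite vv andbT (le_trans uu).
have rep' := reparametrisation_sub rep pu (m_mono _ _ uu uv vv) vq.
rewrite ku kv in rep'.
have ll' : locally_lipschitz X (m u) (m v) (sigma \o k).
  exact: (locally_lipschitz_sub ll pu vq).
rewrite (segment_lengthE uvI cs rep ll) (segment_lengthE _ cs rep' ll').
  exact: lipschitz_length_le.
apply: subset_trans uvI => z /=; rewrite !in_itv/= => /andP[uz zv].
by rewrite (le_trans uu uz) (le_trans zv vv).
Qed.

Lemma segment_length_cat I sigma u v w : `[u, w] `<=` I ->
  causal_curve X I sigma -> u <= v -> v <= w ->
  (segment_length X sigma u w <=
   segment_length X sigma u v + segment_length X sigma v w)%E.
Proof.
move=> uwI cs uv vw; have uw := le_trans uv vw.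
have [p [q [k [rep ll]]]] := lipschitz_reparametrisation_exists uw uwI cs.
have [m [_ _ mP m_mono]] := reparametrisation_surj rep.
have [|/andP[pv vq] kv] := mP v; first by rewrite uv.
have [pq ku kw _ _] := rep.
have rep1 := reparametrisation_sub rep (lexx _) pv vq.
have rep2 := reparametrisation_sub rep pv vq (lexx _).
rewrite ku kv in rep1; rewrite kv kw in rep2.
have ll1 : locally_lipschitz X p (m v) (sigma \o k).
  exact: (locally_lipschitz_sub ll (lexx _) vq).
have ll2 : locally_lipschitz X (m v) q (sigma \o k).
  exact: (locally_lipschitz_sub ll pv (lexx _)).
rewrite (segment_lengthE uwI cs rep ll).
rewrite (segment_lengthE _ cs rep1 ll1); last first.
  apply: subset_trans uwI => z /=; rewrite !in_itv/= => /andP[-> zv].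
  exact: le_trans zv vw.
rewrite (segment_lengthE _ cs rep2 ll2); last first.
  apply: subset_trans uwI => z /=; rewrite !in_itv/= => /andP[vz ->].
  by rewrite (le_trans uv).
exact: lipschitz_length_cat.
Qed.

Lemma segment_length_usc I (gam_ : nat -> R -> M) gam u v (e : R) : u <= v ->
  `[u, v] `<=` I -> (forall j, causal_curve X I (gam_ j)) ->
  causal_curve X I gam -> cvg_uniformly_on_compacts I gam_ gam -> 0 < e ->
  \forall j \near \oo,
    (segment_length X (gam_ j) u v <= segment_length X gam u v + e%:E)%E.
Proof.
move=> uv uvI cs_ cs gcvg e0.
have [p [q [k [rep ll]]]] := lipschitz_reparametrisation_exists uv uvI cs.
have [P HP] := choice (fun j => lipschitz_reparametrisation_exists uv uvI (cs_ j)).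
have [Q HQ] := choice HP.
have [K HK] := choice HQ.
have rep_ j : reparametrisation u v (P j) (Q j) (K j) by have [] := HK j.
have ll_ j : locally_lipschitz X (P j) (Q j) (gam_ j \o K j) by have [] := HK j.
have := eventual_lipschitz_length_le uvI cs_ cs gcvg rep ll rep_ ll_ e0.
apply: filterS => j; rewrite (segment_lengthE uvI cs rep ll).
by rewrite (segment_lengthE uvI (cs_ j) (rep_ j) (@ll_ j)).
Qed.
End SegmentLength.

(** * From compact segments to the half-open interval *)

Lemma fine_dist_le {R : realType} (x y : \bar R) (e : R) :
  x \is a fin_num -> y \is a fin_num -> (y <= x + e%:E)%E ->
  (x - e%:E <= y)%E -> `|fine x - fine y| <= e.
Proof.
move=> /fineK <- /fineK <-; rewrite -EFinB -EFinD !lee_fin /= => h1 h2.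
by rewrite ler_distlC h1 h2.
Qed.

Theorem lemma2p14 (R : realType) (n : nat) (M : metricType R)
    (X : spacetime R n M) (a : R) (gam_ : nat -> R -> M) (gam : R -> M)
    (a_gt0 : 0 < a)
    (gam_causal_ : forall i, causal_curve X `[0, a[ (gam_ i))
    (gam_causal : causal_curve X `[0, a[ gam)
    (gam_cvg : cvg_uniformly_on_compacts `[0, a[ gam_ gam)
    (len_finite : forall i, (curve_length X `[0%R, a[ (gam_ i) < +oo)%E)
    (len_bounded : exists C : R,
      forall i, (curve_length X `[0%R, a[ (gam_ i) <= C%:E)%E)
    (len_le : exists2 b : R, 0 < b &
      forall i t1 t2, t1 \in `[0, a[ -> t2 \in `[0, a[ -> t1 <= t2 ->
        (segment_length X (gam_ i) t1 t2 <= (b * `|t2 - t1|)%:E)%E /\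
        (curve_length X `[t1, a[ (gam_ i) <= (b * `|a - t1|)%:E)%E) :
  exists f : nat -> nat,
    [/\ {homo f : k l / (k < l)%N},
        (limn_esup (fun k => curve_length X `[0%R, a[ (gam_ (f k)))
           <= curve_length X `[0%R, a[ gam)%E
      & (forall t, t \in `[0, a[ ->
           segment_length X (gam_ (f k)) 0 t @[k --> \oo]
             --> segment_length X gam 0 t) ->
        curve_length X `[0%R, a[ (gam_ (f k)) @[k --> \oo]
          --> curve_length X `[0%R, a[ gam].
Proof.
have [b b0 {}len_le] := len_le.
have sub t : t < a -> `[0, t] `<=` (`[0, a[ : set R).
  move=> ta z; rewrite /= !in_itv/= => /andP[-> zt]; exact: le_lt_trans ta.
have seg_le (sigma : R -> M) t : causal_curve X `[0, a[ sigma -> 0 < t -> t < a ->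
    (segment_length X sigma 0 t <= curve_length X `[0%R, a[ sigma)%E.
  move=> cs t0 ta; apply: ereal_sup_ubound; exists 0, t.
  by split=> //=; rewrite in_itv/= ?lexx ?a_gt0// (ltW t0).
(* A segment reaching beyond [t] is cut at [t]; the second hypothesis bounds the remainder by
   [b * (a - t)] whatever its end, which survives the supremum over segments. *)
have tail j t : 0 < t -> t < a -> (curve_length X `[0%R, a[ (gam_ j) <=
    segment_length X (gam_ j) 0 t + (b * (a - t))%:E)%E.
  move=> t0 ta; have cs := gam_causal_ j; have bat : 0 <= b * (a - t).
    by rewrite mulr_ge0 ?subr_ge0 ?ltW.
  apply: ge_ereal_sup => _ [u [v [uI vI uv ->]]].
  move: uI vI; rewrite /= !in_itv/= => /andP[u0 ua] /andP[v0 va].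
  apply: le_trans (segment_length_le (sub _ va) cs u0 (ltW uv) (lexx _)) _.
  have [vt|tv] := leP v t.
    apply: le_trans (segment_length_le (sub _ ta) cs (lexx _) v0 vt) _.
    by rewrite leeDl// lee_fin.
  apply: le_trans (segment_length_cat (sub _ va) cs (ltW t0) (ltW tv)) _.
  apply: leeD2l; have [||+ _] := len_le j t v _ _ (ltW tv).
  - by rewrite in_itv/= ta ltW.
  - by rewrite in_itv/= va v0.
  move=> /le_trans; apply; rewrite lee_fin; apply: (ler_wpM2l (ltW b0)).
  by rewrite ger0_norm ?subr_ge0 ?(ltW tv)// lerD2r ltW.
have upper (e : R) : 0 < e -> \forall j \near \oo,
    (curve_length X `[0%R, a[ (gam_ j) <= curve_length X `[0%R, a[ gam + e%:E)%E.
  (* [a - e / (2 * b)] makes the tail at most [e / 2]; the maximum with [a / 2] keeps [t]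
     positive. *)
  move=> e0; pose t := Num.max (a / 2) (a - e / (2 * b)).
  have t0 : 0 < t by rewrite lt_max divr_gt0.
  have ta : t < a.
    rewrite gt_max; apply/andP; split; first by lra.
    by rewrite ltrBlDr ltrDl divr_gt0// mulr_gt0.
  have bt : b * (a - t) <= e / 2.
    apply: (@le_trans _ _ (b * (e / (2 * b)))).
      apply: (ler_wpM2l (ltW b0)).
      have : a - e / (2 * b) <= t by rewrite le_max lexx orbT.
      by lra.
    by rewrite le_eqVlt; apply/orP; left; apply/eqP; field; rewrite gt_eqF.
  have e2 : 0 < e / 2 by rewrite divr_gt0.
  have := segment_length_usc (ltW t0) (sub _ ta) gam_causal_ gam_causal gam_cvg e2.
  apply: filterS => j jP; apply: le_trans (tail j t t0 ta) _.
  have -> : e = e / 2 + e / 2 by lra.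
  rewrite EFinD addeA; apply: leeD; last by rewrite lee_fin.
  by apply: le_trans jP _; rewrite leeD2r// seg_le.
exists id; split=> //.
  (* The upper limit is an infimum over eventual sets of suprema; the set of indices satisfying the
     bound is one of them. *)
  apply/lee_addgt0Pr => e e0; apply: ge_ereal_inf => /=.
  eexists; first by exists [set j | (curve_length X `[0%R, a[ (gam_ j) <=
    curve_length X `[0%R, a[ gam + e%:E)%E]; [exact: upper|reflexivity].
  by apply: ge_ereal_sup => _ [j jP <-].
move=> seg_cvg.
have a2 : 0 < a / 2 < a by apply/andP; split; lra.
have /andP[a20 a2a] := a2.
have L0 : (0 <= curve_length X `[0%R, a[ gam)%E.
  apply: le_trans (seg_le _ _ gam_causal a20 a2a).
  exact: (segment_length_ge0 (ltW a20) (sub _ a2a) gam_causal).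
have Lj0 j : (0 <= curve_length X `[0%R, a[ (gam_ j))%E.
  apply: le_trans (seg_le _ _ (gam_causal_ j) a20 a2a).
  exact: (segment_length_ge0 (ltW a20) (sub _ a2a) (gam_causal_ j)).
(* The bound [b * a] passes from the [gam_ j] to [gam] through the assumed convergence on segments.
   It makes the length of [gam] finite, so that the remaining convergence is one of real numbers. *)
have segb t : 0 <= t -> t < a -> (segment_length X gam 0 t <= (b * a)%:E)%E.
  move=> t0 ta; have tI : t \in `[0, a[ by rewrite in_itv/= t0.
  apply: (cvge_to_le (seg_cvg t tI)).
  apply: nearW => j; have [||+ _] := len_le j 0 t _ _ t0.
  - by rewrite in_itv/= lexx.
  - by rewrite in_itv/= t0.
  move=> /le_trans; apply; rewrite lee_fin; apply: (ler_wpM2l (ltW b0)).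
  by rewrite subr0 ger0_norm// ltW.
have Lb : (curve_length X `[0%R, a[ gam <= (b * a)%:E)%E.
  apply: ge_ereal_sup => _ [u [v [uI vI uv ->]]].
  move: uI vI; rewrite /= !in_itv/= => /andP[u0 ua] /andP[v0 va].
  apply: le_trans (segb v v0 va).
  exact: (segment_length_le (sub _ va) gam_causal u0 (ltW uv) (lexx _)).
have Lfin : curve_length X `[0%R, a[ gam \is a fin_num.
  rewrite (ge0_fin_numE L0); exact: le_lt_trans Lb (ltry _).
have Ljfin j : curve_length X `[0%R, a[ (gam_ j) \is a fin_num.
  by rewrite (ge0_fin_numE (Lj0 j)); exact: len_finite.
(* Semicontinuity supplies only the upper estimate. The lower one comes from a segment [[0, v]] that
   nearly exhausts the length of [gam] and on which the lengths converge by assumption. *)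
have lower (e : R) : 0 < e -> \forall j \near \oo,
    (curve_length X `[0%R, a[ gam - e%:E <= curve_length X `[0%R, a[ (gam_ j))%E.
  move=> e0.
  have [_ [u [v [uI vI uv ->]]]] := ub_ereal_sup_adherent e0 Lfin.
  rewrite -/(curve_length X `[0%R, a[ gam) => lt_seg.
  move: uI vI; rewrite /= !in_itv/= => /andP[u0 ua] /andP[v0 va].
  have v0' : 0 < v by exact: le_lt_trans uv.
  have := segment_length_le (sub _ va) gam_causal u0 (ltW uv) (lexx _).
  move=> /(lt_le_trans lt_seg) lt_v.
  have vI : v \in `[0, a[ by rewrite in_itv/= v0.
  have : \forall j \near \oo, (curve_length X `[0%R, a[ gam - e%:E <
      segment_length X (gam_ j) 0 v)%E := seg_cvg v vI _ (open_ereal_gt' lt_v).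
  apply: filterS => j /ltW /le_trans; apply.
  exact: (seg_le _ _ (gam_causal_ j) v0' va).
rewrite -(fineK Lfin); apply/fine_cvgP; split; first exact: nearW.
apply/cvgrPdist_le => e e0; have h1 := upper e e0; have h2 := lower e e0.
apply: filterS2 h1 h2 => j; exact: (fine_dist_le Lfin (Ljfin j)).
Qed.
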